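(* As $N\to\infty$ we have $Z(N)\geqslant(\log\log N)^{1-o(1)}$, where $Z(N)$ is the minimum, over all sets $A$ of non-negative integers with $|A|=N$, of the number of zeros in $[0,2\pi]$ of the cosine polynomial $f_A(t)=\sum_{n\in A}\cos nt$. That is, for every $\varepsilon>0$ there exists $N_0$ such that for every $N\geqslant N_0$ and every set $A$ of non-negative integers with $|A|=N$, the function $f_A(t)=\sum_{n\in A}\cos nt$ has at least $(\log\log N)^{1-\varepsilon}$ zeros in $[0,2\pi]$.
   Context: Zeros are counted as (distinct) real numbers $t\in[0,2\pi]$ with $f_A(t)=0$. $\log$ is the natural logarithm. The $o(1)$ denotes a quantity tending to $0$ as $N\to\infty$. *)

(* Defs.v *)
From mathcomp Require Import all_boot all_order all_algebra.
From mathcomp Require Import finmap.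
From mathcomp Require Import all_classical all_reals all_analysis.

Set Implicit Arguments.
Unset Strict Implicit.
Unset Printing Implicit Defensive.

Import Order.TTheory GRing.Theory Num.Theory.

Local Open Scope classical_set_scope.
Local Open Scope ring_scope.

Definition cos_poly (R : realType) (A : {fset nat}) (t : R) : R :=
  \sum_(n <- A) cos (n%:R * t).

Definition cos_poly_zeros (R : realType) (A : {fset nat}) : set R :=
  [set t : R | 0 <= t <= 2 * pi /\ cos_poly A t = 0].

(* The zeros are counted without multiplicity. The value is +oo when there are
   infinitely many of them, which happens only for the empty [A]. *)
Definition num_zeros (R : realType) (A : {fset nat}) : \bar R :=
  counting (@cos_poly_zeros R A).

(* For [0 < N] this is the infimum of a nonempty set of natural numbers, hence a
   minimum; the only empty [A] arises for [N = 0], where the value is +oo. *)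
Definition min_num_zeros (R : realType) (N : nat) : \bar R :=
  ereal_inf [set num_zeros R A | A in [set A : {fset nat} | #|` A|%fset = N]].

(* Main.v *)
(** Let [f] have [K] zeros. Dirichlet's theorem gives [q = exp (O (K))] such that
    [q t / 2 pi] is close to an integer at every zero [t]. Between two zeros [f]
    keeps its sign, so testing against Fejér kernels bounds its [L^1] norm by
    [O (1)] on every interval whose length is comparable to its distance from the
    zeros; as [1 - e^{iqt}] is small at the zeros, [(1 - e^{iqt})^m f] has small
    [L^1] norm once [m] is of order [log log N]. It has integer coefficients, so
    the Cohen-Davenport lower bound for [L^1] norms leaves only few nonzero ones:
    apart from few places, the coefficients of [f] are [q]-periodic.

    Near [0], the even function [f] keeps its sign on a long range of scales, so
    its [L^1] norm over some of these scales is tiny. Hence two averages of the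
    coefficient sequence, taken at very different scales, almost agree. The
    coarse average varies slowly from at least about [1 / q] to almost [0], so it
    stays close to [1 / 2q] on a long window; but this window contains a
    [q]-periodic block, where the fine average is close to a multiple of [1 / q].

    This yields [K >= c log log N] for some constant [c > 0]. Integrals over the
    circle are replaced by sums over the points [2 pi x / Q] with [Q] huge. *)

Require Import Defs.
From mathcomp Require Import all_boot all_order all_algebra.
From mathcomp Require Import finmap.
From mathcomp Require Import all_classical all_reals all_analysis.
From mathcomp Require Import complex.
From mathcomp Require Import ring lra zify.

Set Implicit Arguments.
Unset Strict Implicit.
Unset Printing Implicit Defensive.

Import Order.TTheory GRing.Theory Num.Theory.
Import numFieldNormedType.Exports.
Import ComplexField.Normc ComplexField.

Local Open Scope ring_scope.

(** * Selecting frequencies *)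

(** The double logarithm comes from a trade-off. With [N] frequencies, the trivial bound [|f| <= N]
    is affordable only on a fraction about [1 / N] of the circle around the zeros, so about [log N]
    dyadic distances remain, each contributing [O(1)] per zero. The damping by [|1 - e^{iqt}|^m] has
    to beat this number of scales. At the few largest scales it does not damp and may reach [2 ^ m],
    so the norm is only bounded by [4 ^ m]; the lower bound for norms then permits up to
    [2 ^ (2 ^ (23 m))] nonzero coefficients, which must stay far below [N]. This confines [N]
    between [2 ^ (2 ^ (40 m))] and [2 ^ (2 ^ (45 m))], while simultaneous approximation of the zeros
    needs [m] of order [K].

    The grid size [Q] is a multiple of [q], so that a Fejér kernel of order at most [Q / q] gives
    every residue class modulo [q] exactly the same mass. It is fixed after the test polynomial, and
    so large that no aliasing occurs. *)

Lemma seq_int_min (C : seq int) :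
  C != [::] -> exists2 n, n \in C & forall l, l \in C -> n <= l.
Proof.
elim: C => //= c C IH _.
have [->|/IH[n nC nmin]] := eqVneq C [::].
  by exists c => [|l]; rewrite mem_seq1 // => /eqP ->.
have [cn|nc] := leP c n.
  exists c; first by rewrite mem_head.
  move=> l; rewrite inE => /orP[/eqP -> //|/nmin]; exact: le_trans.
exists n; first by rewrite inE nC orbT.
by move=> l; rewrite inE => /orP[/eqP ->|/nmin //]; exact: ltW.
Qed.

(* Take the least element above the threshold outside all translates
   [a + n' - l] with [l] in [Lam] below the threshold: since [a + n' - n < a],
   there is no other way for [a + n' - n] to fall in [Lam]. *)
Lemma avoiding_element (Lam Sp ns : seq int) (x : int) (P r T : nat) :
  uniq Lam -> (0 < P)%N ->
  (forall a, a \in Sp -> a <= x) -> (forall n, n \in ns -> n <= x) ->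
  (count (fun l => (l <= x)%R) Lam <= P)%N -> (size ns <= r)%N ->
  (2 + size Sp * r <= T)%N -> (P * T <= size Lam)%N ->
  exists n, [/\ n \in Lam, x < n,
    forall a n', a \in Sp -> n' \in ns -> a + n' - n \notin Lam &
    (count (fun l => (l <= n)%R) Lam <= P * T)%N].
Proof.
move=> uL P0 Spx nsx cP sr T2 sL.
pose Low : seq int := [seq l <- Lam | l <= x].
pose Bad : seq int := [seq a.1 + a.2 - l | a <- [seq (a, n) | a <- Sp, n <- ns], l <- Low].
have sLow : (size Low <= P)%N by rewrite size_filter.
have sBad : (size Bad <= size Sp * r * P)%N.
  by rewrite !size_allpairs; apply: leq_mul => //; rewrite leq_mul2l sr orbT.
have sPT : (P + size Sp * r * P + P <= P * T)%N by nia.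
pose C : seq int := [seq l <- Lam | (x < l) && (l \notin Bad)].
have [|n] := @seq_int_min C.
  apply/eqP => C0.
  have : (size Lam <= size (Low ++ Bad))%N.
    apply: uniq_leq_size => // l lL; rewrite mem_cat mem_filter lL andbT.
    case: leP => //= xl; apply/negPn/negP => lB.
    have : l \in C by rewrite mem_filter lL xl lB.
    by rewrite C0.
  by rewrite (@size_cat int); move: sLow sBad sPT sL P0; clear; lia.
rewrite mem_filter => /andP[/andP[xn nB] nL] nmin.
exists n; split => //.
- move=> a n' aS n'n; apply/negP => lL; move/negP: nB; apply.
  apply/allpairsP; exists ((a, n'), a + n' - n); split => /=.
  + by apply/allpairsP; exists (a, n').
  + rewrite mem_filter lL andbT.
    by move: (Spx _ aS) (nsx _ n'n) xn; clear; lia.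
  + by rewrite subKr.
- rewrite -size_filter.
  have : (size [seq l <- Lam | (l <= n)%R] <= size (n :: Low ++ Bad))%N.
    apply: uniq_leq_size; first exact: filter_uniq.
    move=> l; rewrite mem_filter => /andP[ln lL].
    rewrite inE mem_cat mem_filter lL andbT.
    case: (leP l x) => [_|xl]; first by rewrite orbT.
    case lB : (l \in Bad); first by rewrite !orbT.
    have lC : l \in C by rewrite mem_filter lL xl lB.
    have -> : l = n by apply/eqP; rewrite eq_le ln nmin.
    by rewrite eqxx.
  by rewrite /= (@size_cat int); move: sLow sBad sPT P0; clear; lia.
Qed.

(** New frequencies are put at the head of the list, so the first component of a pair is the one
    chosen later, hence the larger one. *)
Fixpoint later_earlier (ns : seq int) : seq (int * int) :=
  if ns is n :: ns' then [seq (n, n') | n' <- ns'] ++ later_earlier ns' else [::].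

Lemma size_later_earlier ns :
  (2 * size (later_earlier ns) <= size ns ^ 2)%N.
Proof. by elim: ns => //= n ns IH; rewrite size_cat size_map; nia. Qed.

(** Progress is measured by the number of elements of [Lam] below the threshold, not by the
    threshold itself: each choice multiplies it by at most [T], however sparse [Lam] is. *)
Lemma avoiding_elements (Lam Sp : seq int) (x : int) (P r T k : nat) :
  uniq Lam -> (0 < P)%N -> (forall a, a \in Sp -> a <= x) ->
  (count (fun l => (l <= x)%R) Lam <= P)%N -> (2 + size Sp * r <= T)%N ->
  (k <= r)%N -> (P * T ^ k <= size Lam)%N ->
  exists ns x', [/\ size ns = k, all (mem Lam) ns,
    x <= x' /\ (forall n, n \in ns -> n <= x'),
    (forall d, d \in later_earlier ns -> d.2 < d.1) /\
    (forall a d, a \in Sp -> d \in later_earlier ns -> a + d.2 - d.1 \notin Lam) &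
    (count (fun l => (l <= x')%R) Lam <= P * T ^ k)%N].
Proof.
move=> uL P0 Spx cP T2; elim: k => [|k IH] kr sL.
  by exists [::], x; split=> //=; rewrite expn0 muln1.
have T0 : (0 < T)%N by apply: leq_trans T2; rewrite addnC addn2.
have PT0 : (0 < P * T ^ k)%N by rewrite muln_gt0 P0 expn_gt0 T0.
have [|ns [x' [sz al [xx' nsx'] [dec av] cP']]] := IH (ltnW kr).
  by apply: leq_trans sL; rewrite leq_mul2l leq_pexp2l ?orbT.
have [| | |n [nL xn nav cn]] :=
    @avoiding_element Lam Sp ns x' (P * T ^ k) r T uL PT0 _ nsx' cP' _ T2.
- by move=> a /Spx ax; exact: le_trans xx'.
- by rewrite sz ltnW.
- by rewrite -mulnA -expnSr.
exists (n :: ns), n; split => /=.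
- by rewrite sz.
- by rewrite nL.
- split; first by rewrite (le_trans xx') ?ltW.
  move=> m; rewrite inE => /orP[/eqP -> //|/nsx' h].
  by rewrite (le_trans h) ?ltW.
- split=> [d|a d aS]; rewrite mem_cat => /orP[/mapP[n' n'ns ->]|] /=.
  + by apply: le_lt_trans xn; exact: nsx'.
  + exact: dec.
  + exact: nav.
  + exact: av.
- by rewrite expnSr mulnA.
Qed.

(** * A lower bound for L1 norms *)

Section TrigPoly.
Variable R : realType.
Implicit Types (t : R) (P E : seq (R * int)) (b : int -> int).

Definition cis t : R[i] := (cos t +i* sin t)%C.

Lemma cisD s t : cis (s + t) = cis s * cis t.
Proof. by rewrite /cis cosD sinD; simpc; congr Complex; ring. Qed.

Lemma cis0 : cis 0 = 1.
Proof. by rewrite /cis cos0 sin0. Qed.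

Lemma normc_cis t : normc (cis t) = 1.
Proof. by rewrite /cis /normc cos2Dsin2 sqrtr1. Qed.

Lemma normc_triangle (x y : R[i]) : normc (x + y) <= normc x + normc y.
Proof. exact: le_normcD. Qed.

Lemma normc_ge0 (x : R[i]) : 0 <= normc x.
Proof. by case: x => a b /=; exact: sqrtr_ge0. Qed.

Lemma normcR (x : R) : normc (x%:C)%C = `|x|.
Proof. by rewrite /normc /= expr0n addr0 sqrtr_sqr. Qed.

Lemma normc_sqr (x : R[i]) : normc x ^+ 2 = complex.Re x ^+ 2 + complex.Im x ^+ 2.
Proof. by case: x => a b /=; rewrite sqr_sqrtr // addr_ge0 ?sqr_ge0. Qed.

(* A trigonometric polynomial is the list of its (coefficient, frequency)
   pairs. *)
Definition trig_eval P t : R[i] :=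
  \sum_(p <- P) (p.1%:C)%C * cis (p.2%:~R * t).

Definition trig_pair b P : R := \sum_(p <- P) p.1 * (b p.2)%:~R.

Definition trig_mul P E : seq (R * int) :=
  [seq (p.1 * e.1, p.2 + e.2) | p <- P, e <- E].

Definition trig_scale (a : R) P : seq (R * int) := [seq (a * p.1, p.2) | p <- P].

Lemma trig_eval_cat P E t : trig_eval (P ++ E) t = trig_eval P t + trig_eval E t.
Proof. by rewrite /trig_eval big_cat. Qed.

Lemma trig_eval_scale (a : R) P t :
  trig_eval (trig_scale a P) t = (a%:C)%C * trig_eval P t.
Proof.
rewrite /trig_eval /trig_scale big_map big_distrr /=; apply: eq_bigr => p _.
by rewrite rmorphM mulrA.
Qed.

Lemma trig_eval_mul P E t :
  trig_eval (trig_mul P E) t = trig_eval P t * trig_eval E t.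
Proof.
rewrite /trig_eval /trig_mul big_allpairs_dep /= big_distrl /=.
apply: eq_bigr => p _; rewrite big_distrr /=; apply: eq_bigr => e _.
by rewrite rmorphM rmorphD /= mulrDl cisD mulrACA.
Qed.

Lemma normc_trig_eval P t : normc (trig_eval P t) <= \sum_(p <- P) `|p.1|.
Proof.
rewrite /trig_eval; elim: P => [|p P IH]; first by rewrite !big_nil normc0.
rewrite !big_cons (le_trans (normc_triangle _ _))// lerD//.
by rewrite normcM normc_cis mulr1 normcR.
Qed.

Lemma ReD (x y : R[i]) : complex.Re (x + y) = complex.Re x + complex.Re y.
Proof. by case: x => a b; case: y. Qed.

Lemma ImD (x y : R[i]) : complex.Im (x + y) = complex.Im x + complex.Im y.
Proof. by case: x => a b; case: y. Qed.

Lemma Re_trig_eval P t :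
  complex.Re (trig_eval P t) = \sum_(p <- P) p.1 * cos (p.2%:~R * t).
Proof.
rewrite /trig_eval; elim: P => [|p P IH]; first by rewrite !big_nil.
by rewrite !big_cons ReD IH /cis /= !mul0r subr0.
Qed.

Lemma Im_trig_eval P t :
  complex.Im (trig_eval P t) = \sum_(p <- P) p.1 * sin (p.2%:~R * t).
Proof.
rewrite /trig_eval; elim: P => [|p P IH]; first by rewrite !big_nil.
by rewrite !big_cons ImD IH /cis /= !mul0r addr0.
Qed.

Definition signed_sum (s : int -> R) (ns : seq int) : seq (R * int) :=
  [seq (s n, n) | n <- ns].

(** Of the two opposite frequencies that a pair contributes to [|p|^2], only [d.2 - d.1] is kept;
    twice the real part accounts for both. *)
Definition signed_diffs (s : int -> R) (ns : seq int) : seq (R * int) :=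
  [seq (s d.1 * s d.2, d.2 - d.1) | d <- later_earlier ns].

Lemma normc_signed_sum (s : int -> R) ns t : (forall n, n \in ns -> s n ^+ 2 = 1) ->
  normc (trig_eval (signed_sum s ns) t) ^+ 2 =
  (size ns)%:R + 2 * complex.Re (trig_eval (signed_diffs s ns) t).
Proof.
rewrite normc_sqr !Re_trig_eval !Im_trig_eval /signed_sum /signed_diffs !big_map.
elim: ns => [_|n ns IH sns] /=; first by rewrite !big_nil; ring.
rewrite !big_cons big_cat big_map /=.
have {}IH := IH (fun m mns => sns m (mem_behead (s := n :: ns) mns)).
rewrite /= in IH.
set X := \sum_(j <- ns) _ in IH *; set Y := \sum_(j <- ns) _ in IH *.
set Z := \sum_(j <- later_earlier ns) _ in IH *.
have -> : \sum_(j <- ns) s n * s j * cos ((j - n)%:~R * t) =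
   s n * cos (n%:~R * t) * X + s n * sin (n%:~R * t) * Y.
  rewrite /X /Y !big_distrr -big_split /=; apply: eq_bigr => j _.
  by rewrite intrB mulrBl cosB; ring.
have sn : s n ^+ 2 = 1 by apply: sns; rewrite mem_head.
have -> : (size ns).+1%:R = 1 + (size ns)%:R :> R by rewrite -natr1 addrC.
have cs := cos2Dsin2 (n%:~R * t).
transitivity (s n ^+ 2 * (cos (n%:~R * t) ^+ 2 + sin (n%:~R * t) ^+ 2) +
  2 * (s n * cos (n%:~R * t) * X + s n * sin (n%:~R * t) * Y) + (X ^+ 2 + Y ^+ 2)).
  by ring.
rewrite IH cs sn; ring.
Qed.

Lemma normc_signed_diffs (s : int -> R) ns t :
  (forall n, n \in ns -> s n ^+ 2 = 1) ->
  normc (trig_eval (signed_diffs s ns) t) <= (size ns)%:R ^+ 2 / 2.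
Proof.
move=> sns; apply: le_trans (normc_trig_eval _ _) _.
rewrite /signed_diffs big_map /=.
have s1 n : n \in ns -> `|s n| = 1.
  by move=> /sns/eqP; rewrite sqrf_eq1 => /orP[]/eqP ->; rewrite ?normrN normr1.
have mem12 d : d \in later_earlier ns -> (d.1 \in ns) && (d.2 \in ns).
  elim: (ns) => //= n l IH; rewrite mem_cat => /orP[/mapP[m ml ->]|/IH/andP[h1 h2]] /=.
    by rewrite mem_head inE ml orbT.
  by rewrite !inE h1 h2 !orbT.
rewrite big_seq (eq_bigr (fun=> 1)); last first.
  by move=> d /mem12/andP[h1 h2]; rewrite normrM !s1 // mulr1.
rewrite -big_seq big_const_seq count_predT iter_addr_0.
rewrite ler_pdivlMr // mulrC -natrX -natrM ler_nat.
exact: size_later_earlier.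
Qed.

(** Here [X = |1 - 2 c E|], [y = |p|] and [nE = |E|]. From [X <= (1 + X^2) / 2] comes a term
    [- c y^2], which absorbs [c' y]. The losses [c r], [c^2 r^4 / 2] and [c'^2 / (4 c)] are [1/4],
    [1/32] and [1/16] of [rho^-4], together less than half of it. *)
Lemma damping_bound (rho : nat) (B X y nE ReE : R) : (0 < rho)%N -> 1 <= B ->
  let r : R := (rho%:R ^+ 2) in let c := (4 * r ^+ 3)^-1 in
  0 <= X -> 0 <= y -> y ^+ 2 = r + 2 * ReE -> 0 <= nE -> nE <= r ^+ 2 / 2 ->
  X ^+ 2 = 1 - 4 * c * ReE + 4 * c ^+ 2 * nE ^+ 2 ->
  B * X + (4 * rho%:R ^+ 5)^-1 * y <= B * (1 + (2 * rho%:R ^+ 4)^-1).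
Proof.
move=> rho0 B1 r c X0 y0 yE nE0 nEr XE.
have p0 : 0 < rho%:R :> R by rewrite ltr0n.
have r0 : 0 < r by rewrite exprn_gt0.
have c0 : 0 < c by rewrite invr_gt0 mulr_gt0 ?exprn_gt0.
pose c' := (4 * rho%:R ^+ 5 : R)^-1; rewrite -/c'.
have c'0 : 0 < c' by rewrite invr_gt0 mulr_gt0 ?exprn_gt0.
have X1 : X <= 1 - c * y ^+ 2 + c * r + c ^+ 2 * r ^+ 4 / 2.
  have nE2 : nE ^+ 2 <= r ^+ 4 / 4.
    have -> : r ^+ 4 / 4 = (r ^+ 2 / 2) ^+ 2 by field.
    by rewrite ler_sqr ?nnegrE // divr_ge0 ?exprn_ge0 ?ltW.
  have X2 : X ^+ 2 <= 1 - 2 * c * (y ^+ 2 - r) + c ^+ 2 * r ^+ 4.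
    rewrite XE yE.
    have : c ^+ 2 * nE ^+ 2 <= c ^+ 2 * (r ^+ 4 / 4).
      by rewrite ler_wpM2l ?sqr_ge0.
    lra.
  have : 0 <= (X - 1) ^+ 2 by exact: sqr_ge0.
  rewrite sqrrB1 => h; lra.
(* AM-GM: [c' y - c y^2 <= c'^2 / (4 c)] *)
have y1 : c' * y - c * y ^+ 2 <= c' ^+ 2 / (4 * c).
  have h : 0 <= (2 * c * y - c') ^+ 2 / (4 * c).
    by rewrite divr_ge0 ?sqr_ge0 // mulr_ge0 // ltW.
  have -> : c' ^+ 2 / (4 * c) = (2 * c * y - c') ^+ 2 / (4 * c) +
     (c' * y - c * y ^+ 2) by field; rewrite gt_eqF.
  by rewrite lerDr.
pose u := (rho%:R ^+ 4 : R)^-1.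
have u0 : 0 < u by rewrite invr_gt0 exprn_gt0.
have e1 : c * r = u / 4 by rewrite /c /r /u; field; rewrite gt_eqF.
have e2 : c ^+ 2 * r ^+ 4 / 2 = u / 32 by rewrite /c /r /u; field; rewrite gt_eqF.
have e3 : c' ^+ 2 / (4 * c) = u / 16 by rewrite /c' /c /r /u; field; rewrite gt_eqF.
have -> : (2 * rho%:R ^+ 4 : R)^-1 = u / 2 by rewrite /u; field; rewrite gt_eqF.
have B0 : 0 <= B by lra.
have cB : c' * y <= B * (c' * y) by rewrite ler_peMl // mulr_ge0 // ltW.
apply: le_trans (_ : B * (X + c' * y) <= _); first by rewrite mulrDr lerD2l.
apply: ler_wpM2l => //.
by rewrite e1 e2 in X1; rewrite e3 in y1; lra.
Qed.

End TrigPoly.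

Section CohenDavenport.
Variable R : realType.

Lemma trig_pair_cat (b : int -> int) (P E : seq (R * int)) :
  trig_pair b (P ++ E) = trig_pair b P + trig_pair b E.
Proof. by rewrite /trig_pair big_cat. Qed.

Lemma trig_pair_scale (b : int -> int) (a : R) (P : seq (R * int)) :
  trig_pair b (trig_scale a P) = a * trig_pair b P.
Proof.
rewrite /trig_pair /trig_scale big_map big_distrr /=.
by apply: eq_bigr => p _; rewrite mulrA.
Qed.

(** The factor by which one choice of a frequency uses up [Lam]: in each of the [rho ^ 4] steps the
    length of [P] grows by a factor of at most [(rho ^ 2) ^ 2 + 1], and [rho ^ 2] frequencies are
    chosen. *)
Definition cd_base (rho : nat) : nat :=
  (2 * rho ^ 2 * ((rho ^ 2) ^ 2).+1 ^ (rho ^ 4))%N.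

(* Each step replaces [P] by [P (1 - 2 c E) + c' p], where [p] is a signed sum of
   frequencies [n] in [Lam] and [|p|^2 = r + 2 Re E]. The frequencies of [P E]
   avoid [Lam], so only [c' p] changes the pairing, while [|1 - 2 c E|] is
   smallest where [|p|] is large, which keeps the sup norm bounded. *)
Lemma cohen_davenport_steps (rho : nat) (b : int -> int) (Lam : seq int) (i : nat) :
  (0 < rho)%N -> uniq Lam -> (forall n, (n \in Lam) = (b n != 0)) ->
  (cd_base rho ^ (rho ^ 2 * rho ^ 4) <= size Lam)%N -> (i <= rho ^ 4)%N ->
  exists (P : seq (R * int)) (x : int),
    [/\ forall t, normc (trig_eval P t) <= 1 + i%:R / rho%:R ^+ 4,
      i%:R * (rho%:R ^+ 2 * (4 * rho%:R ^+ 5)^-1) <= trig_pair b P,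
      ((size P).+1 <= ((rho ^ 2) ^ 2).+1 ^ i)%N,
      (forall p, p \in P -> p.2 <= x) &
      (count (fun l => (l <= x)%R) Lam <= cd_base rho ^ (rho ^ 2 * i))%N].
Proof.
move=> rho0 uL LamE sL; set T := cd_base rho.
have p0 : 0 < rho%:R :> R by rewrite ltr0n.
have T0 : (0 < T)%N by rewrite /T /cd_base !muln_gt0 !expn_gt0 rho0.
elim: i => [_|i IH iS].
  exists [::].
  have [x xc] : exists x, count (fun l => (l <= x)%R) Lam = 0%N.
    have [->|/seq_int_min[n nL nmin]] := eqVneq Lam [::]; first by exists 0.
    exists (n - 1); apply/eqP; rewrite -leqn0 leqNgt -has_count.
    by apply/hasPn => l /nmin; move: l n {nL nmin} => l n; lia.
  exists x; split => //.
  - by move=> t; rewrite /trig_eval big_nil normc0 mul0r addr0.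
  - by rewrite /trig_pair big_nil mul0r.
  - by rewrite xc.
have [P [x [Pn Pp Ps Px Pc]]] := IH (ltnW iS).
pose r := (rho ^ 2)%N.
have r0 : (0 < r)%N by rewrite expn_gt0 rho0.
have [| | | |ns [x' [sns /allP nsL [xx' nsx'] [dec av] cx']]] :=
    @avoiding_elements Lam (map snd P) x (T ^ (r * i)) r T r uL _ _ Pc _ (leqnn _).
- by rewrite expn_gt0 T0.
- by move=> a /mapP[p pP ->]; exact: Px.
- rewrite size_map.
  have h : ((size P).+1 <= (r ^ 2).+1 ^ (rho ^ 4))%N.
    by apply: leq_trans Ps _; rewrite leq_pexp2l // ltnW.
  rewrite /T /cd_base -/r; apply: leq_trans (_ : 2 * r * (size P).+1 <= _)%N.
    move: r0; clear; nia.
  by rewrite leq_mul2l h orbT.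
- apply: leq_trans sL; rewrite -expnD addnC -mulnS leq_pexp2l //.
  by rewrite leq_mul2l iS orbT.
(* With these signs each chosen frequency adds [|b n|] to the pairing, which is at least 1 because
   [b] takes integer values. *)
pose s (n : int) : R := Num.sg (b n)%:~R.
have s2 n : n \in ns -> s n ^+ 2 = 1.
  move=> /nsL; rewrite /= LamE => bn.
  by rewrite /s sqr_sg intr_eq0 bn.
pose c : R := (4 * (rho%:R ^+ 2) ^+ 3)^-1.
pose c' : R := (4 * rho%:R ^+ 5)^-1.
pose E := signed_diffs s ns; pose p := signed_sum s ns.
exists (P ++ trig_scale (- (2 * c)) (trig_mul P E) ++ trig_scale c' p), x'.
have szE : (size E <= r ^ 2)%N.
  by rewrite size_map -sns (leq_trans _ (size_later_earlier ns)) // leq_pmull.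
split.
- move=> t; rewrite !trig_eval_cat !trig_eval_scale trig_eval_mul addrA.
  set u := trig_eval P t; set w := trig_eval E t; set v := trig_eval p t.
  have -> : u + ((- (2 * c))%:C)%C * (u * w) = u * (1 + ((- (2 * c))%:C)%C * w) by ring.
  apply: le_trans (normc_triangle _ _) _; rewrite !normcM normcR.
  have c'0 : 0 <= c' by rewrite invr_ge0 mulr_ge0 ?exprn_ge0 ?ltW.
  rewrite ger0_norm //.
  set X := normc (1 + _).
  pose B : R := 1 + i%:R / rho%:R ^+ 4.
  have B1 : 1 <= B by rewrite /B lerDl divr_ge0 ?ler0n ?exprn_ge0 ?ltW.
  have := @damping_bound R rho B X (normc v) (normc w) (complex.Re w) rho0 B1.
  move=> /(_ (normc_ge0 _) (normc_ge0 _)); rewrite -/c.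
  have -> : rho%:R ^+ 2 = (size ns)%:R :> R by rewrite sns natrX.
  move=> /(_ (normc_signed_sum _ s2) (normc_ge0 _) (normc_signed_diffs _ s2)) h.
  have {}h : B * X + c' * normc v <= B * (1 + (2 * rho%:R ^+ 4)^-1).
    apply: h; rewrite !normc_sqr.
    rewrite /X; case: (w) => w1 w2 /=; rewrite -/c; ring.
  apply: le_trans (_ : B * X + c' * normc v <= _).
    by rewrite lerD2r ler_wpM2r ?normc_ge0 // Pn.
  apply: le_trans h _.
  pose z : R := (rho%:R ^+ 4)^-1.
  have z0 : 0 <= z by rewrite invr_ge0 exprn_ge0 // ltW.
  have -> : (2 * rho%:R ^+ 4 : R)^-1 = z / 2 by rewrite /z; field; rewrite gt_eqF.
  rewrite /B -/z -[i.+1%:R]natr1.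
  (* Having at most [rho ^ 4] steps keeps the compounding linear:
     [(1 + i z) (1 + z / 2) <= 1 + (i + 1) z] when [i z <= 1]. *)
  have iz : i%:R * z <= 1.
    by rewrite ler_pdivrMr ?exprn_gt0 // mul1r -natrX ler_nat ltnW.
  have izz : i%:R * z * z <= z by rewrite ler_piMl.
  by move: izz; clear; set u := i%:R * z; rewrite [(_ + 1) * z]mulrDl -/u; lra.
- rewrite !trig_pair_cat !trig_pair_scale.
  have -> : trig_pair b (trig_mul P E) = 0.
    rewrite /trig_pair /trig_mul big_allpairs_dep big_seq big1 // => q qP.
    rewrite /E /signed_diffs big_map big_seq big1 // => d dd /=.
    have := av q.2 d (map_f snd qP) dd; rewrite LamE negbK addrA => /eqP ->.
    by rewrite mulr0.
  rewrite mulr0 add0r -[i.+1%:R]natr1 mulrDl mul1r lerD // mulrC; apply: ler_wpM2l.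
    by rewrite invr_ge0 mulr_ge0 ?exprn_ge0 ?ltW.
  rewrite /p /signed_sum /trig_pair big_map /=.
  have -> : rho%:R ^+ 2 = \sum_(n <- ns) (1 : R).
    by rewrite big_const_seq count_predT iter_addr_0 sns natrX.
  rewrite !big_seq; apply: ler_sum => n /nsL; rewrite /= LamE => bn.
  rewrite /s -normrEsg -intr_norm.
  by rewrite (_ : 1 = 1%:~R) // ler_int; move: bn; clear; lia.
- rewrite !size_cat !size_map /trig_mul size_allpairs sns.
  rewrite expnSr; apply: leq_trans (leq_mul Ps (leqnn _)).
  rewrite -/r; apply: leq_trans (_ : (size P + (size P * r ^ 2 + r)).+1 <= _)%N.
    by rewrite ltnS leq_add2l leq_add2r leq_mul2l szE orbT.
  by move: (size P) r0 => l; clear; nia.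
- move=> q; rewrite !mem_cat => /or3P[/Px h| |].
  + exact: le_trans xx'.
  + move=> /mapP[q1 /allpairsP[[q2 q3] [/= q2P q3E ->]] ->] /=.
    have /mapP[d dd ->] := q3E => /=.
    by rewrite (le_trans _ xx') // (le_trans _ (Px _ q2P)) // gerDl subr_le0 ltW ?dec.
  + by move=> /mapP[q1 /mapP[n nn ->] ->] /=; exact: nsx'.
- by rewrite mulnS addnC expnD.
Qed.

(** Each of the [rho ^ 4] steps adds [1 / (4 rho ^ 3)] to the pairing but only [1 / rho ^ 4] to the
    bound on the sup norm. *)
Lemma cohen_davenport (rho : nat) (b : int -> int) (Lam : seq int) :
  (0 < rho)%N -> uniq Lam -> (forall n, (n \in Lam) = (b n != 0)) ->
  (cd_base rho ^ (rho ^ 2 * rho ^ 4) <= size Lam)%N ->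
  exists P : seq (R * int),
    (forall t, normc (trig_eval P t) <= 2) /\ rho%:R / 4 <= trig_pair b P.
Proof.
move=> rho0 uL LamE sL.
have p0 : rho%:R != 0 :> R by rewrite pnatr_eq0 -lt0n.
have [P [x [Pn Pp _ _ _]]] :=
  @cohen_davenport_steps rho b Lam (rho ^ 4)%N rho0 uL LamE sL (leqnn _).
exists P; split=> [t|].
  apply: le_trans (Pn t) _; rewrite natrX divff ?expf_neq0 //; lra.
by apply: le_trans Pp; rewrite natrX le_eqVlt; apply/orP; left; apply/eqP; field.
Qed.

End CohenDavenport.

(** * Trigonometric inequalities *)

Section TrigInequalities.
Variable R : realType.

Lemma natr_size (T : Type) (s : seq T) : (size s)%:R = \sum_(x <- s) (1 : R).
Proof. by rewrite big_const_seq count_predT iter_addr_0. Qed.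

Lemma sin_half_sq (x : R) : 2 - 2 * cos x = 4 * sin (x / 2) ^+ 2.
Proof.
have -> : cos x = cos (x / 2 *+ 2) by congr cos; rewrite mulr2n; field.
by rewrite cos_mulr2n cos2sin2 mulr2n; ring.
Qed.

Lemma normc_1Bcis (t : R) : normc (1 - cis t) ^+ 2 = 2 - 2 * cos t.
Proof.
rewrite normc_sqr /cis /=; have := cos2Dsin2 t => h.
transitivity (1 - 2 * cos t + (cos t ^+ 2 + sin t ^+ 2)); first by ring.
rewrite h; ring.
Qed.

Lemma sin_le_id (x : R) : 0 <= x -> sin x <= x.
Proof.
rewrite le_eqVlt => /orP[/eqP <-|x0]; first by rewrite sin0.
have der y : y \in `]0, x[%R -> is_derive y 1 (fun t : R => t - sin t) (1 - cos y).
  by move=> _; exact: is_deriveB.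
have cont : {within `[0, x]%classic, continuous (fun t : R => t - sin t)}%classic.
  apply: continuous_subspaceT => y; apply: continuousB; first exact: cvg_id.
  exact: continuous_sin.
have [c _ E] := MVT x0 der cont.
rewrite -subr_ge0; have -> : x - sin x = (1 - cos c) * (x - 0).
  by rewrite -E sin0 subr0 subr0.
by rewrite mulr_ge0 ?subr_ge0 ?cos_le1 // ltW.
Qed.

Lemma sin_norm_le (x : R) : `|sin x| <= `|x|.
Proof.
wlog x0 : x / 0 <= x => [hw|].
  have [/hw //|/ltW x0] := leP 0 x.
  by rewrite -normrN -sinN -(normrN x) hw ?oppr_ge0.
rewrite (ger0_norm x0) ler_norml sin_le_id // andbT.
have [x1|x1] := leP x 1; last by apply: le_trans (sin_geN1 x); lra.
have : 0 <= sin x by apply: sin_ge0_pi; rewrite x0 /=; have := pi_ge2 R; lra.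
lra.
Qed.

Lemma cosD2pi_int (x : R) (p : int) : cos (x + p%:~R * (2 * pi)) = cos x.
Proof.
have E : 2 * pi = pi *+ 2 :> R by rewrite mulr_natl.
have nat_case (n : nat) y : cos (y + n%:R * (2 * pi)) = cos y :> R.
  by rewrite E mulr_natl (periodicn (@cosD2pi R)).
case: p => n; first exact: nat_case.
by rewrite NegzE intrN mulNr -[LHS]cosN opprD opprK (nat_case n.+1 (- x)) cosN.
Qed.

Lemma sinD2pi_int (x : R) (p : int) : sin (x + p%:~R * (2 * pi)) = sin x.
Proof. by rewrite -!cosBpihalf addrAC cosD2pi_int. Qed.

Lemma cisD2pi_int (x : R) (p : int) : cis (x + p%:~R * (2 * pi)) = cis x.
Proof. by rewrite /cis cosD2pi_int sinD2pi_int. Qed.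

Lemma normc_1Bcis_le (t : R) (p : int) : normc (1 - cis t) <= `|t - p%:~R * (2 * pi)|.
Proof.
have -> : cis t = cis (t - p%:~R * (2 * pi)).
  by rewrite -[RHS](cisD2pi_int _ p) subrK.
move: (t - _) => u; rewrite -ler_sqr ?nnegrE ?normc_ge0 // normc_1Bcis sin_half_sq.
rewrite real_normK ?num_real //.
have h : sin (u / 2) ^+ 2 <= (u / 2) ^+ 2.
  rewrite -[leLHS]real_normK ?num_real // -[leRHS]real_normK ?num_real //.
  by rewrite ler_sqr ?nnegrE ?normr_ge0 // sin_norm_le.
by rewrite exprMn in h; lra.
Qed.

Lemma normc_1Bcis_le2 (t : R) : normc (1 - cis t) <= 2.
Proof.
rewrite -ler_sqr ?nnegrE ?normc_ge0 // normc_1Bcis; have := cos_geN1 t; lra.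
Qed.

End TrigInequalities.

(** * The grid and Fejér kernels *)

Section PeriodicSum.
Variables (V : zmodType) (Q : nat) (g : int -> V).
Hypothesis gQ : forall j, g (j + Q%:Z) = g j.

Lemma periodic_int (j p : int) : g (j + p * Q%:Z) = g j.
Proof.
have nat_case (n : nat) i : g (i + n%:Z * Q%:Z) = g i.
  elim: n i => [|n IH] i; first by rewrite mul0r addr0.
  by rewrite -addn1 PoszD mulrDl mul1r addrA gQ IH.
case: p => n; first exact: nat_case.
by rewrite NegzE mulNr -[LHS](nat_case n.+1) subrK.
Qed.

Lemma sum_periodic_shift (s : int) :
  \sum_(x < Q) g (x%:Z + s) = \sum_(x < Q) g x%:Z.
Proof.
have [->|Q0] := eqVneq Q 0%N; first by rewrite !big_ord0.
have nat_case (n : nat) : \sum_(x < Q) g (x%:Z + n%:Z) = \sum_(x < Q) g x%:Z.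
  elim: n => [|n IH]; first by apply: eq_bigr => x _; rewrite addr0.
  rewrite -IH; case: (Q) Q0 gQ => // m _ gm.
  rewrite big_ord_recr big_ord_recl /= addrC; congr (_ + _).
    by rewrite -(gm (0 + n%:Z)); congr g; lia.
  by apply: eq_bigr => i _; congr g; rewrite /bump /=; lia.
have -> : s = (`|(s %% Q%:Z)%Z|%N)%:Z + (s %/ Q%:Z)%Z * Q%:Z.
  by rewrite gez0_abs ?modz_ge0 // addrC -divz_eq.
rewrite -[RHS](nat_case `|(s %% Q%:Z)%Z|%N).
by apply: eq_bigr => x _; rewrite addrA periodic_int.
Qed.

End PeriodicSum.

Section Grid.
Variables (R : realType) (Q : nat).

Definition ang (k : int) : R := k%:~R * (2 * pi / Q%:R).
Definition ez (k : int) : R[i] := cis (ang k).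
Definition cs (k : int) : R := cos (ang k).

Lemma ezD j k : ez (j + k) = ez j * ez k.
Proof. by rewrite /ez /ang intrD mulrDl cisD. Qed.

Lemma ez0 : ez 0 = 1.
Proof. by rewrite /ez /ang mul0r cis0. Qed.

Lemma normc_ez k : normc (ez k) = 1.
Proof. exact: normc_cis. Qed.

Lemma csN k : cs (- k) = cs k.
Proof. by rewrite /cs /ang intrN mulNr cosN. Qed.

Lemma cs0 : cs 0 = 1.
Proof. by rewrite /cs /ang mul0r cos0. Qed.

Lemma cs_le1 k : cs k <= 1. Proof. exact: cos_le1. Qed.

Lemma cs_geN1 k : -1 <= cs k. Proof. exact: cos_geN1. Qed.

Lemma csM j k : cs (j + k) + cs (j - k) = 2 * (cs j * cs k).
Proof. by rewrite /cs /ang intrD intrB mulrDl mulrBl cosD cosB; ring. Qed.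

Lemma Re_ez k : complex.Re (ez k) = cs k.
Proof. by []. Qed.

Hypothesis Q_gt0 : (0 < Q)%N.

Let QR : 0 < Q%:R :> R. Proof. by rewrite ltr0n. Qed.

Lemma angQ k p : ang (k + p * Q%:Z) = ang k + p%:~R * (2 * pi).
Proof.
rewrite /ang intrD mulrDl intrM; congr (_ + _).
by rewrite -[Q%:Z%:~R]/(Q%:R); field; rewrite gt_eqF.
Qed.

Lemma ezQ k : ez (k + Q%:Z) = ez k.
Proof. by rewrite /ez -[Q%:Z]mul1r angQ cisD2pi_int. Qed.

Lemma cs_lt1 (k : int) : ~~ (Q%:Z %| k)%Z -> cs k < 1.
Proof.
move=> Qk; rewrite (divz_eq k Q%:Z) addrC /cs angQ cosD2pi_int -/(cs _).
have kQ : (k %% Q%:Z)%Z < Q%:Z by rewrite ltz_pmod // ltz_nat.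
have k0 : 0 < (k %% Q%:Z)%Z.
  rewrite lt_neqAle modz_ge0 ?andbT; last by rewrite eqz_nat -lt0n.
  by rewrite eq_sym; apply: contra Qk => /eqP/dvdz_mod0P.
move: (k %% Q%:Z)%Z kQ k0 => {Qk}k kQ k0.
have s0 : 0 < sin (ang k / 2).
  have p0 := pi_gt0 R; apply: sin_gt0_pi; apply/andP; split.
    by rewrite divr_gt0 // mulr_gt0 ?ltr0z // divr_gt0 ?mulr_gt0.
  rewrite /ang; have -> : k%:~R * (2 * pi / Q%:R) / 2 = (k%:~R / Q%:R) * pi :> R.
    by field; rewrite gt_eqF.
  by rewrite gtr_pMl // ltr_pdivrMr // mul1r -[Q%:R]/(Q%:Z%:~R) ltr_int.
have := sin_half_sq (ang k); have : 0 < sin (ang k / 2) ^+ 2 by rewrite exprn_gt0.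
rewrite -/(cs k); lra.
Qed.

Lemma sum_ez (k : int) : ~~ (Q%:Z %| k)%Z -> \sum_(x < Q) ez (k * x%:Z) = 0.
Proof.
move=> Qk; set S := \sum_(x < Q) _.
have : ez k * S = S.
  rewrite big_distrr /= /S.
  rewrite -(@sum_periodic_shift _ Q (fun j => ez (k * j)) _ 1).
    by apply: eq_bigr => x _; rewrite mulrDr mulr1 ezD mulrC.
  by move=> j; rewrite mulrDr /ez angQ cisD2pi_int.
move=> /eqP; rewrite -subr_eq0 -{2}[S]mul1r -mulrBl mulf_eq0 subr_eq0.
move=> /orP[/eqP e|/eqP //].
by have := cs_lt1 Qk; rewrite -Re_ez e /= ltxx.
Qed.

Lemma sum_ez_dvd (k : int) : (Q%:Z %| k)%Z -> \sum_(x < Q) ez (k * x%:Z) = Q%:R.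
Proof.
move=> /dvdzP[p ->]; rewrite (eq_bigr (fun=> 1)) ?sumr_const ?card_ord // => x _.
have -> : p * Q%:Z * x%:Z = 0 + (p * x%:Z) * Q%:Z by ring.
by rewrite /ez angQ cisD2pi_int -/(ez _) ez0.
Qed.

End Grid.

Section Fejer.
Variables (R : realType) (Q : nat).
Hypothesis Q_gt0 : (0 < Q)%N.
Local Notation ez := (@ez R Q).
Local Notation cs := (@cs R Q).

(** For even [g] this is the sum of [(r - |x|) g x] over [|x| < r], folded onto [x >= 0]. *)
Definition triangle_sum (g : int -> R) (r : nat) : R :=
  r%:R * g 0 + \sum_(1 <= x < r) (r - x)%:R * (2 * g x%:Z).

(** This equals [|sum_(x < r) ez (k x)|^2], that is, [r] times the usual Fejér kernel. *)
Definition fejer (r : nat) (k : int) : R := triangle_sum (fun x => cs (k * x)) r.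

Lemma triangle_sumS (g : int -> R) r :
  triangle_sum g r.+1 = triangle_sum g r + (g 0 + \sum_(1 <= x < r.+1) 2 * g x%:Z).
Proof.
rewrite /triangle_sum; case: r => [|r].
  by rewrite !big_geq //; ring.
rewrite big_nat_recr //= [X in _ = _ + (_ + X)]big_nat_recr //= subSnn.
rewrite (@big_cat_nat _ _ _ r.+1 1 r.+1) //= [X in _ + X + _]big_geq // addr0.
have -> : \sum_(1 <= i < r.+1) (r.+2 - i)%:R * (2 * g i%:Z) =
  \sum_(1 <= i < r.+1) (r.+1 - i)%:R * (2 * g i%:Z) + \sum_(1 <= i < r.+1) 2 * g i%:Z.
  rewrite -big_split /=; apply: eq_big_nat => i /andP[_ ir].
  by rewrite subSn ?(ltnW ir) // -natr1 mulrDl mul1r.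
by rewrite -[r.+2%:R]natr1; ring.
Qed.

Lemma eq_triangle_sum (g h : int -> R) r :
  (forall x : nat, g x = h x) -> triangle_sum g r = triangle_sum h r.
Proof.
by move=> gh; rewrite /triangle_sum gh; congr (_ + _); apply: eq_bigr => x _; rewrite gh.
Qed.

Lemma triangle_sum_sum (I : Type) (s : seq I) (g : I -> int -> R) r :
  triangle_sum (fun x => \sum_(i <- s) g i x) r = \sum_(i <- s) triangle_sum (g i) r.
Proof.
rewrite /triangle_sum big_distrr big_split /=; congr (_ + _).
rewrite exchange_big /=; apply: eq_bigr => x _.
by rewrite !big_distrr /=.
Qed.

Lemma triangle_sumZ (a : R) (g : int -> R) r :
  triangle_sum (fun x => a * g x) r = a * triangle_sum g r.
Proof.
rewrite /triangle_sum mulrDr big_distrr /= mulrCA; congr (_ + _).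
by apply: eq_bigr => x _; ring.
Qed.

(** The Fejér kernel is a sum of Dirichlet kernels, and multiplying one of these by [1 - cs k] gives
    a difference of consecutive cosines, so the sum telescopes. *)
Lemma fejer_closed r k : (1 - cs k) * fejer r k = 1 - cs (r%:Z * k).
Proof.
have dirichlet n : (1 - cs k) * (cs (k * 0) + \sum_(1 <= x < n.+1) 2 * cs (k * x%:Z)) =
    cs (n%:Z * k) - cs (n.+1%:Z * k).
  elim: n => [|n IH].
    by rewrite big_geq // mulr0 cs0 mul0r cs0 mul1r; ring.
  rewrite big_nat_recr //= addrA mulrDr IH.
  have := @csM R Q (n.+1%:Z * k) k.
  have -> : n.+1%:Z * k + k = n.+2%:Z * k by rewrite -[n.+2]addn1 PoszD mulrDl mul1r.
  have -> : n.+1%:Z * k - k = n%:Z * k by rewrite -[n.+1]addn1 PoszD mulrDl mul1r addrK.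
  rewrite [k * _]mulrC; lra.
elim: r => [|r IH].
  by rewrite /fejer /triangle_sum big_geq // !mul0r cs0; ring.
rewrite /fejer triangle_sumS mulrDr dirichlet -/(fejer r k) IH; ring.
Qed.

Lemma fejer_ge0 r k : 0 <= fejer r k.
Proof.
have [Qk|/(@cs_lt1 R _ Q_gt0) ck] := boolP (Q%:Z %| k)%Z.
  have c1 (x : int) : cs (k * x) = 1.
    move/dvdzP: Qk => [p ->].
    have -> : p * Q%:Z * x = 0 + (p * x) * Q%:Z by ring.
    by rewrite /cs angQ // cosD2pi_int -/(cs _) cs0.
  rewrite /fejer /triangle_sum c1 addr_ge0 ?mulr1 // sumr_ge0 // => i _.
  by rewrite c1 mulr_ge0 // mulr1.
have : 0 <= (1 - cs k) * fejer r k by rewrite fejer_closed subr_ge0 cs_le1.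
by rewrite pmulr_rge0 // subr_gt0.
Qed.

Lemma fejerN r k : fejer r (- k) = fejer r k.
Proof. by apply: eq_triangle_sum => x; rewrite mulNr csN. Qed.

Lemma fejerQ r k : fejer r (k + Q%:Z) = fejer r k.
Proof.
apply: eq_triangle_sum => x.
by rewrite mulrDl mulrC [Q%:Z * _]mulrC /cs angQ // cosD2pi_int mulrC.
Qed.

Lemma normc_1Bez_mul (j : nat) k :
  normc (1 - ez (j%:Z * k)) <= j%:R * normc (1 - ez k).
Proof.
elim: j => [|j IH]; first by rewrite !mul0r ez0 subrr normc0.
have -> : 1 - ez (j.+1%:Z * k) = (1 - ez (j%:Z * k)) + ez (j%:Z * k) * (1 - ez k).
  by rewrite -addn1 PoszD mulrDl mul1r ezD; ring.
rewrite (le_trans (normc_triangle _ _)) // normcM normc_ez mul1r.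
by rewrite -natr1 mulrDl mul1r lerD2r.
Qed.

(* Multiplying [i] by [j = ceil (Q / 4 i)] moves the angle to
   [pi / 2, pi], where [1 - cos] is at least [1]. *)
Lemma cs_gap (i : nat) : (0 < i)%N -> (2 * i <= Q)%N ->
  4 * i%:R ^+ 2 / Q%:R ^+ 2 <= 1 - cs i%:Z.
Proof.
move=> i0 iQ.
have QR : 0 < Q%:R :> R by rewrite ltr0n.
have iR : 0 < i%:R :> R by rewrite ltr0n.
pose j := ((Q + (4 * i).-1) %/ (4 * i))%N.
have d4 : (0 < 4 * i)%N by rewrite muln_gt0.
have h1 : (Q <= 4 * (i * j))%N.
  have := ltn_ceil (Q + (4 * i).-1) d4; rewrite -/j (mulSn j).
  by rewrite (mulnCA j 4%N) (mulnC j); move: (i * j)%N i0 => v; clear; lia.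
have h2 : (2 * (i * j) <= Q)%N.
  have := leq_trunc_div (Q + (4 * i).-1) (4 * i); rewrite -/j.
  rewrite (mulnCA j 4%N) (mulnC j) => h.
  have [i4|i4] := leqP (4 * i) Q; first by move: (i * j)%N h i4 i0 => v; clear; lia.
  have j1 : (j <= 1)%N by rewrite -ltnS ltn_divLR //; move: i4 i0; clear; lia.
  by apply: leq_trans iQ; rewrite leq_mul2l /= -[leqRHS]muln1 leq_mul2l j1 orbT.
have j0 : (0 < j)%N by move: h1 Q_gt0; clear; case: j => //; rewrite muln0; lia.
have jR : 0 < j%:R :> R by rewrite ltr0n.
have c0 : cs (j%:Z * i%:Z) <= 0.
  rewrite /cs; set u := ang _ _ _.
  have uE : u = 2 * (i * j)%:R / Q%:R * pi.
    by rewrite /u /ang -PoszM -pmulrn mulnC; field; rewrite gt_eqF.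
  have p0 := pi_gt0 R.
  have u1 : 1 / 2 * pi <= u.
    rewrite uE ler_pM2r // ler_pdivlMr //.
    have : Q%:R <= (4 * (i * j))%:R :> R by rewrite ler_nat.
    rewrite natrM; lra.
  have u2 : u <= 1 * pi.
    rewrite uE ler_pM2r // ler_pdivrMr //.
    have : (2 * (i * j))%:R <= Q%:R :> R by rewrite ler_nat.
    rewrite natrM; lra.
  have := @cos_ge0_pihalf R (pi - u).
  have -> : cos u = - cos (pi - u).
    by rewrite cosB cospi sinpi; ring.
  rewrite oppr_le0; apply; apply/andP; split; lra.
have h3 : normc (1 - ez (j%:Z * i%:Z)) ^+ 2 <= (j%:R * normc (1 - ez i%:Z)) ^+ 2.
  by rewrite ler_sqr ?nnegrE ?mulr_ge0 ?normc_ge0 // normc_1Bez_mul.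
rewrite exprMn !normc_1Bcis -/(cs _) -/(cs _) in h3.
have h4 : 1 / j%:R ^+ 2 <= 1 - cs i%:Z.
  rewrite ler_pdivrMr ?exprn_gt0 //; lra.
apply: le_trans h4; rewrite ler_pdivrMr ?exprn_gt0 //.
rewrite mulrAC mul1r ler_pdivlMr ?exprn_gt0 //.
have -> : 4 * i%:R ^+ 2 * j%:R ^+ 2 = (2 * (i * j))%:R ^+ 2 :> R.
  by rewrite !natrM; ring.
by rewrite ler_sqr ?nnegrE ?ler_nat.
Qed.

Lemma fejer_tail r (i : nat) : (0 < i)%N -> (2 * i <= Q)%N ->
  fejer r i%:Z <= Q%:R ^+ 2 / (2 * i%:R ^+ 2).
Proof.
move=> i0 iQ.
have QR : 0 < Q%:R :> R by rewrite ltr0n.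
have iR : 0 < i%:R :> R by rewrite ltr0n.
have g0 : 0 < 4 * i%:R ^+ 2 / Q%:R ^+ 2 :> R.
  by rewrite divr_gt0 ?mulr_gt0 ?exprn_gt0.
have : 4 * i%:R ^+ 2 / Q%:R ^+ 2 * fejer r i%:Z <= 2.
  apply: le_trans (_ : (1 - cs i%:Z) * fejer r i%:Z <= _).
    by rewrite ler_wpM2r ?fejer_ge0 // cs_gap.
  by rewrite fejer_closed; have := @cs_geN1 R Q (r%:Z * i%:Z); lra.
rewrite mulrC -ler_pdivlMr //; congr (_ <= _); field; rewrite !gt_eqF //.
Qed.

End Fejer.

Section FejerMass.
Variables (R : realType) (q P : nat).
Hypotheses (q_gt0 : (0 < q)%N) (P_gt0 : (0 < P)%N).

(** Summing the frequency [x] over a residue class gives 0 unless [P] divides [x]. As [r <= P], only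
    [x = 0] survives, so the mass does not depend on the class. *)
Lemma sum_fejer_class (r : nat) (s : int) : (r <= P)%N ->
  \sum_(i < P) fejer R (q * P) r (s + q%:Z * i%:Z) = (r * P)%:R.
Proof.
move=> rP; set Q := (q * P)%N.
have Q_gt0 : (0 < Q)%N by rewrite muln_gt0 q_gt0.
rewrite /fejer -(@triangle_sum_sum R _ (index_enum 'I_P)).
rewrite (@eq_triangle_sum _ _ (fun x =>
    complex.Re (ez R Q (s * x) * \sum_(i < P) ez R P (x * i%:Z)))); last first.
  move=> x; rewrite big_distrr /=.
  have ReS (I : Type) (l : seq I) (F : I -> R[i]) :
      complex.Re (\sum_(i <- l) F i) = \sum_(i <- l) complex.Re (F i).
    by elim: l => [|a l IH]; rewrite ?big_nil ?big_cons // ReD IH.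
  rewrite ReS; apply: eq_bigr => i _.
  rewrite mulrDl -Re_ez ezD; congr (complex.Re (_ * _)).
  rewrite /ez; congr cis; rewrite /ang /Q !intrM natrM -!pmulrn.
  by field; rewrite !pnatr_eq0 -!lt0n q_gt0 P_gt0.
rewrite /triangle_sum mulr0 ez0 mul1r sum_ez_dvd // big_nat_cond big1 ?addr0.
  rewrite natrM; congr (_ * _).
  by elim: (P) => // n IH; rewrite -!natr1 ReD IH.
move=> x; rewrite andbT => /andP[x0 xr].
rewrite sum_ez //; first by rewrite mulr0 /= !mulr0.
by rewrite dvdzE /= gtnNdvd // (leq_trans xr).
Qed.

End FejerMass.

(** * L1 bounds away from the zeros *)

Section Sums.
Variable R : realType.

Lemma ler_sum_sub (T : eqType) (s t : seq T) (f : T -> R) :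
  uniq s -> {subset s <= t} -> (forall x, 0 <= f x) ->
  \sum_(x <- s) f x <= \sum_(x <- t) f x.
Proof.
move=> us st f0.
have : uniq (undup t) by exact: undup_uniq.
have h1 : \sum_(x <- undup t) f x <= \sum_(x <- t) f x.
  elim: (t) => //= x l IH; case: ifP => _; rewrite !big_cons.
    by apply: le_trans IH _; rewrite lerDr.
  by rewrite lerD2l.
move=> ut; apply: le_trans h1.
have pe : perm_eq s [seq x <- undup t | x \in s].
  apply: uniq_perm; rewrite ?filter_uniq // => x.
  by rewrite mem_filter mem_undup; case xs : (x \in s); rewrite //= st.
rewrite (perm_big _ pe) big_filter [leLHS]big_mkcond; apply: ler_sum => x _.
by case: ifP.
Qed.

Lemma ler_sum_cover (I : finType) (T : eqType) (ps : seq T) (P : pred I)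
    (mem : T -> pred I) (G : I -> R) (beta : T -> R) :
  (forall x, 0 <= G x) -> (forall x, P x -> exists2 p, p \in ps & mem p x) ->
  (forall p, p \in ps -> \sum_(x | mem p x) G x <= beta p) ->
  \sum_(x | P x) G x <= \sum_(p <- ps) beta p.
Proof.
move=> G0 cov bd.
apply: le_trans (_ : \sum_(p <- ps) \sum_(x | mem p x) G x <= _); last first.
  by rewrite !big_seq; apply: ler_sum.
rewrite (eq_bigr (fun p => \sum_x (if mem p x then G x else 0))); last first.
  by move=> p _; rewrite big_mkcond.
rewrite exchange_big big_mkcond /=; apply: ler_sum => x _.
case: ifP => [/cov[p pp mp]|_]; last first.
  by apply: sumr_ge0 => p _; case: ifP.
rewrite (big_rem p pp) /= mp lerDl; apply: sumr_ge0 => p' _; by case: ifP.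
Qed.

Lemma ler_sum_window (Q n : nat) (lo : int) (h : int -> R) : (forall x, 0 <= h x) ->
  \sum_(x < Q | (lo <= x%:Z < lo + n%:Z)) h x%:Z <= \sum_(y < n) h (lo + y%:Z).
Proof.
move=> h0.
rewrite -(big_mkord (fun x => (lo <= x%:Z < lo + n%:Z)%R) (fun x => h x%:Z)).
rewrite -(big_mkord xpredT (fun y => h (lo + y%:Z))) -big_filter.
rewrite -(big_map Posz xpredT h) -(big_map (fun y : nat => lo + y%:Z) xpredT h).
apply: ler_sum_sub => //.
  by rewrite map_inj_uniq ?filter_uniq ?iota_uniq // => a b [].
move=> z /mapP[x]; rewrite mem_filter => /andP[/andP[h1 h2] _ ->].
apply/mapP; exists (`|x%:Z - lo|)%N.
  by rewrite mem_index_iota; move: h1 h2; clear; lia.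
by move: h1 h2; clear; lia.
Qed.

End Sums.

Section CosSum.
Variable R : realType.

Definition cos_sum (s : seq nat) (t : R) : R := \sum_(k <- s) cos (k%:R * t).

Lemma cos_sumD2pi s t (p : int) : cos_sum s (t + p%:~R * (2 * pi)) = cos_sum s t.
Proof.
apply: eq_bigr => k _; rewrite mulrDr mulrA -[k%:R]/(k%:Z%:~R) -intrM.
by rewrite cosD2pi_int.
Qed.

Lemma cos_sum_norm s t : `|cos_sum s t| <= (size s)%:R.
Proof.
rewrite natr_size (le_trans (ler_norm_sum _ _ _)) //.
by apply: ler_sum => k _; exact: cos_max.
Qed.

Lemma continuous_cos_sum s : continuous (cos_sum s).
Proof.
rewrite /cos_sum; elim: s => [|k s IH] t.
  rewrite (_ : (fun _ => _) = fun=> 0); first exact: cvg_cst.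
  by apply/funext => x; rewrite big_nil.
rewrite (_ : (fun _ => _) = fun x => cos (k%:R * x) + \sum_(k <- s) cos (k%:R * x));
  last by apply/funext => x; rewrite big_cons.
apply: continuousD; last exact: IH.
apply: continuous_comp; last exact: continuous_cos.
by apply: continuousM; [exact: cvg_cst|exact: cvg_id].
Qed.

Lemma zero_free_sign (f : R -> R) (a b : R) : continuous f ->
  (forall t, a <= t <= b -> f t != 0) ->
  (forall t, a <= t <= b -> 0 <= f t) \/ (forall t, a <= t <= b -> f t <= 0).
Proof.
move=> fc f0.
have [[t [tab ft]]|hn] := pselect (exists t, a <= t <= b /\ f t < 0); last first.
  by left => t tab; rewrite leNgt; apply/negP => h; apply: hn; exists t.
right => u uab; rewrite leNgt; apply/negP => fu.
have [ta tb] := andP tab; have [ua ub] := andP uab.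
have c0 (x y : R) : {within `[x, y]%classic, continuous f}%classic.
  exact: continuous_subspaceT.
have z0 x y : x <= y -> a <= x -> y <= b -> Num.min (f x) (f y) <= 0 <= Num.max (f x) (f y) -> False.
  move=> xy ax yb h; have [c] := IVT xy (@c0 x y) h.
  rewrite in_itv /= => /andP[xc cy] fc0; have := f0 c.
  by rewrite (le_trans ax) // (le_trans cy) // fc0 eqxx => /(_ isT).
have ftu : f t <= f u by rewrite ltW // (lt_trans ft).
have [tu|ut] := leP t u.
  by apply: (z0 t u) => //; rewrite (min_l ftu) (max_r ftu) (ltW ft) (ltW fu).
apply: (z0 u t) => //; first exact: ltW.
by rewrite (min_r ftu) (max_l ftu) (ltW ft) (ltW fu).
Qed.

End CosSum.

Section IntervalBound.
Variables (R : realType) (Q : nat) (s : seq nat).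
Hypotheses (Q_gt0 : (0 < Q)%N) (s_uniq : uniq s).
Hypothesis s_ltQ : forall k, k \in s -> (k < Q)%N.
Local Notation cs := (@cs R Q).

Definition grid_val (x : int) : R := cos_sum s (ang R Q x).

Lemma grid_valE x : grid_val x = \sum_(k <- s) cs (k%:Z * x).
Proof.
apply: eq_bigr => k _; rewrite /cs /ang intrM mulrA.
by rewrite -[k%:Z%:~R]/(k%:R).
Qed.

Lemma sum_fejer (r : nat) : (r <= Q)%N -> \sum_(j < Q) fejer R Q r j%:Z = (r * Q)%:R.
Proof.
move=> rQ; have := @sum_fejer_class R 1 Q isT Q_gt0 r 0 rQ.
by rewrite mul1n => <-; apply: eq_bigr => j _; rewrite add0r mul1r.
Qed.

Lemma sum_fejer_le (r : nat) : (r <= Q)%N ->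
  \sum_(k <- s) fejer R Q r k%:Z <= (r * Q)%:R.
Proof.
move=> rQ; rewrite -(sum_fejer rQ) -(big_mkord xpredT (fun j => fejer R Q r j%:Z)).
apply: ler_sum_sub => //; last by move=> k; exact: fejer_ge0.
by move=> k /s_ltQ kQ; rewrite mem_index_iota.
Qed.

(* Triangle weights have a nonnegative transform, so the weighted sum of
   [grid_val] is at most the total mass of the transform. *)
Lemma interval_bound (c : int) (sg : nat) : (0 < sg)%N -> (2 * sg <= Q)%N ->
  (forall z : int, `|z| <= (2 * sg)%:Z -> 0 <= grid_val (c + z)) \/
  (forall z : int, `|z| <= (2 * sg)%:Z -> grid_val (c + z) <= 0) ->
  \sum_(y < 2 * sg) `|grid_val (c - sg%:Z + y%:Z)| <= (2 * Q)%:R.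
Proof.
move=> sg0 sgQ sgn; set r := (2 * sg)%N.
(* Symmetrizing about [c] turns the translation into the factor [cs (k c)], of absolute value at
   most 1, so the bound does not depend on [c]. *)
pose g (z : int) := 2^-1 * (grid_val (c + z) + grid_val (c - z)).
pose h (z : int) := 2^-1 * (`|grid_val (c + z)| + `|grid_val (c - z)|).
have gE z : g z = \sum_(k <- s) cs (k%:Z * c) * cs (k%:Z * z).
  rewrite /g !grid_valE -big_split big_distrr /=; apply: eq_bigr => k _.
  by rewrite (mulrDr k%:Z) (mulrBr k%:Z) csM; field.
have gB : `|triangle_sum g r| <= (r * Q)%:R.
  rewrite (@eq_triangle_sum _ g (fun z => \sum_(k <- s) cs (k%:Z * c) * cs (k%:Z * z)));
    last by move=> x; exact: gE.
  rewrite triangle_sum_sum (le_trans (ler_norm_sum _ _ _)) //.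
  apply: le_trans (sum_fejer_le sgQ); apply: ler_sum => k _.
  rewrite triangle_sumZ normrM -/(fejer R Q r k%:Z) (ger0_norm (fejer_ge0 _ Q_gt0 _ _)).
  by rewrite ler_piMl ?fejer_ge0 // cos_max.
have h0 z : 0 <= h z by rewrite mulr_ge0 ?invr_ge0 ?addr_ge0.
have hg : (forall z, `|z| <= r%:Z -> h z = g z) \/ (forall z, `|z| <= r%:Z -> h z = - g z).
  case: sgn => sgn; [left|right] => z zr; rewrite /h /g.
    by rewrite !ger0_norm ?sgn ?normrN.
  by rewrite !ler0_norm ?sgn ?normrN // -opprD mulrN.
have hE : triangle_sum h r = `|triangle_sum g r|.
  have t0 : 0 <= triangle_sum h r.
    rewrite addr_ge0 ?mulr_ge0 // sumr_ge0 // => x _.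
    by rewrite !mulr_ge0.
  have lt_r x : (1 <= x < r)%N -> `|x%:Z| <= r%:Z by clear; lia.
  case: hg => hg.
    suff E : triangle_sum h r = triangle_sum g r by rewrite -E ger0_norm.
    rewrite /triangle_sum hg //; congr (_ + _).
    by apply: eq_big_nat => x /lt_r /hg ->.
  suff E : triangle_sum h r = - triangle_sum g r by rewrite -normrN -E ger0_norm.
  rewrite /triangle_sum hg // opprD -sumrN mulrN; congr (_ + _).
  by apply: eq_big_nat => x /lt_r /hg ->; rewrite !mulrN.
(* Only the inner half is kept, where the weight [2 sg - |z|] is at least [sg]; dividing [r Q] by
   [sg] leaves [2 Q]. *)
have sgR : 0 < sg%:R :> R by rewrite ltr0n.
rewrite -(ler_pM2l sgR); apply: le_trans (_ : triangle_sum h r <= _); last first.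
  by rewrite hE (le_trans gB) // -natrM ler_nat /r mulnCA mulnA.
have -> : \sum_(y < r) `|grid_val (c - sg%:Z + y%:Z)| =
   \sum_(0 <= y < sg) `|grid_val (c + y%:Z)| + \sum_(1 <= y < sg.+1) `|grid_val (c - y%:Z)|.
  rewrite -(big_mkord xpredT (fun y => `|grid_val (c - sg%:Z + y%:Z)|)).
  rewrite (@big_cat_nat _ _ _ sg) //=; last by rewrite /r leq_pmull.
  rewrite addrC; congr (_ + _).
    rewrite -{1}[sg]add0n big_addn /r mul2n -addnn addnK.
    by apply: eq_bigr => y _; congr (`|grid_val _|); lia.
  rewrite big_add1 /= big_nat_rev /= add0n; apply: eq_big_nat => y /andP[_ ys].
  by congr (`|grid_val _|); lia.
have -> : triangle_sum h r = \sum_(0 <= x < r) (r - x)%:R * `|grid_val (c + x%:Z)| +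
    \sum_(1 <= x < r) (r - x)%:R * `|grid_val (c - x%:Z)|.
  rewrite /triangle_sum (@big_ltn _ _ _ 0%N) ?muln_gt0 // subn0 -addrA; congr (_ + _).
    rewrite /h subr0.
    by field.
  rewrite -big_split /=; apply: eq_bigr => x _.
  by rewrite /h; field.
rewrite mulrDr !big_distrr /=; apply: lerD.
  rewrite (@big_cat_nat _ _ _ sg 0 r) //=; last by rewrite /r leq_pmull.
  rewrite -[leLHS]addr0; apply: lerD; last first.
    by apply: sumr_ge0 => x _; rewrite mulr_ge0.
  rewrite !big_nat; apply: ler_sum => x /andP[_ xs].
  by rewrite ler_wpM2r // ler_nat /r; move: xs; clear; lia.
rewrite (@big_cat_nat _ _ _ sg.+1 1 r) //=; last first.
  by rewrite /r; move: sg0; clear; lia.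
rewrite -[leLHS]addr0; apply: lerD; last first.
  by apply: sumr_ge0 => x _; rewrite mulr_ge0.
rewrite !big_nat; apply: ler_sum => x /andP[_ xs].
by rewrite ler_wpM2r // ler_nat /r; move: xs; clear; lia.
Qed.

Lemma zero_free_interval_bound (c : int) (sg : nat) : (0 < sg)%N -> (2 * sg <= Q)%N ->
  (forall t, ang R Q (c - (2 * sg)%:Z) <= t <= ang R Q (c + (2 * sg)%:Z) ->
     cos_sum s t != 0) ->
  \sum_(y < 2 * sg) `|grid_val (c - sg%:Z + y%:Z)| <= (2 * Q)%:R.
Proof.
move=> sg0 sgQ zf; apply: interval_bound => //.
have th0 : 0 <= 2 * pi / Q%:R :> R by rewrite divr_ge0 ?mulr_ge0 ?pi_ge0.
have incl z : `|z| <= (2 * sg)%:Z ->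
    ang R Q (c - (2 * sg)%:Z) <= ang R Q (c + z) <= ang R Q (c + (2 * sg)%:Z).
  by move=> zr; rewrite /ang !ler_wpM2r // ler_int; move: zr; clear; lia.
have [h|h] := zero_free_sign (@continuous_cos_sum R s) zf; [left|right] => z /incl; exact: h.
Qed.

End IntervalBound.

Section WeightedSum.
Variables (R : realType) (s : seq nat) (I s0 : nat) (ws : seq int).
Let Q := (32 * 2 ^ I * s0)%N.
Hypotheses (s0_gt0 : (0 < s0)%N) (s_uniq : uniq s).
Hypothesis s_ltQ : forall k, k \in s -> (k < Q)%N.
Hypothesis ws_zeros : forall t : R, - (2 * pi) <= t <= 4 * pi -> cos_sum s t = 0 ->
  exists2 w, w \in ws & ang R Q w <= t < ang R Q (w + 1).
Hypothesis ws_cover : forall x : int, 0 <= x < Q%:Z ->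
  exists2 w, w \in ws & `|x - w| <= (16 * 2 ^ I * s0)%:Z.
Local Notation F := (grid_val R Q s).

Let Q_gt0 : (0 < Q)%N.
Proof. by rewrite /Q !muln_gt0 expn_gt0 s0_gt0. Qed.

Definition scale (i : nat) : nat := (2 ^ i * s0)%N.

(* Pieces of length [2 * scale i] cover the points whose distance to the nearest
   marked point lies between [16 * scale i] and [32 * scale i]. *)
Definition piece_lo (p : int * (nat * nat)) : int :=
  p.1 + (2 * p.2.2 * scale p.2.1)%:Z - (34 * scale p.2.1)%:Z.

Definition in_piece (p : int * (nat * nat)) (x : int) : bool :=
  (piece_lo p <= x < piece_lo p + (2 * scale p.2.1)%:Z) &&
  all (fun w => ((16 * scale p.2.1)%:Z <= `|x - w|)%R) ws.

Lemma scale_gt0 i : (0 < scale i)%N.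
Proof. by rewrite muln_gt0 expn_gt0 s0_gt0. Qed.

Lemma scale_leQ i : (i <= I)%N -> (32 * scale i <= Q)%N.
Proof.
by move=> iI; rewrite /Q -mulnA leq_mul2l leq_mul2r leq_pexp2l ?orbT.
Qed.

Lemma far_in_piece (x : int) : 0 <= x < Q%:Z ->
  all (fun w => ((16 * s0)%:Z <= `|x - w|)%R) ws ->
  exists2 p, [/\ p.1 \in ws, (p.2.1 <= I)%N & (p.2.2 < 34)%N] & in_piece p x.
Proof.
move=> xQ /allP far.
have [w0 w0s w0I] := ws_cover xQ.
have [w ws' wmin] : exists2 w : int, w \in ws &
    forall w' : int, w' \in ws -> `|x - w| <= `|x - w'|.
  have [|_ /mapP[w ws' ->] wmin] := @seq_int_min [seq `|x - w| | w <- ws].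
    by case: (ws) w0s.
  by exists w => // w' w's; apply/wmin/map_f.
pose d := absz (x - w).
have dE : `|x - w| = d%:Z by rewrite /d abszE.
have d1 : (16 * s0 <= d)%N.
  by have := far _ ws'; rewrite dE.
have d2 : (d <= 16 * 2 ^ I * s0)%N.
  by have := le_trans (wmin _ w0s) w0I; rewrite dE.
have s16 : (0 < 16 * s0)%N by rewrite muln_gt0.
pose i := trunc_log 2 (d %/ (16 * s0)).
have dd : (0 < d %/ (16 * s0))%N by rewrite divn_gt0.
have /andP[i1 i2] := trunc_log_bounds (isT : (1 < 2)%N) dd.
rewrite -/i in i1 i2.
have e1 : (16 * scale i <= d)%N.
  by rewrite /scale mulnCA -leq_divRL.
have e2 : (d < 32 * scale i)%N.
  by move: i2; rewrite ltn_divLR // expnS /scale; clear; lia.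
have iI : (i <= I)%N.
  rewrite -(@leq_exp2l 2) // -(leq_pmul2r s0_gt0) -/(scale i).
  by move: (leq_trans e1 d2); rewrite -mulnA leq_pmul2l.
have sc0 := scale_gt0 i.
(* Since [|x - w| < 32 scale i], the offset by [34 scale i] makes the argument positive and below
   [66 scale i], so 34 pieces of length [2 scale i] suffice. *)
pose u := absz (x - w + (34 * scale i)%:Z).
have uE : u%:Z = x - w + (34 * scale i)%:Z.
  by rewrite /u; move: e2 dE; clear; lia.
have sc2 : (0 < 2 * scale i)%N by move: sc0; clear; lia.
pose k := (u %/ (2 * scale i))%N.
exists (w, (i, k)); first split => //=.
  by rewrite /k ltn_divLR //; move: uE e2 dE; clear; lia.
rewrite /in_piece /piece_lo /=; apply/andP; split.
  have h1 := leq_trunc_div u (2 * scale i); have h2 := ltn_ceil u sc2.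
  rewrite -/k in h1 h2.
  have e : (2 * k * scale i = k * (2 * scale i))%N by rewrite mulnAC mulnC.
  rewrite e; rewrite mulSn in h2; move: h1 h2 uE; clear.
  by move: (k * (2 * scale i))%N => v; lia.
apply/allP => w' w's; apply: le_trans (wmin _ w's).
by rewrite dE.
Qed.

(** A nonempty piece has a point at distance at least [16 scale] from all marked points, so the
    concentric interval of twice its length still contains no zero. *)
Lemma piece_bound (p : int * (nat * nat)) :
  p.1 \in ws -> (p.2.1 <= I)%N ->
  \sum_(x < Q | in_piece p x%:Z) `|F x%:Z| <= (2 * Q)%:R.
Proof.
move=> pws pI; set sg := scale p.2.1.
have sg0 : (0 < sg)%N := scale_gt0 _.
have sgQ : (32 * sg <= Q)%N := scale_leQ pI.
have [/existsP[x xp]|/existsPn none] := boolP [exists x : 'I_Q, in_piece p x%:Z]; last first.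
  by rewrite big1 ?ler0n // => x xp; have := none x; rewrite xp.
have /andP[xlo /allP xfar] := xp.
apply: le_trans (_ : \sum_(x < Q | piece_lo p <= x%:Z < piece_lo p + (2 * sg)%:Z) `|F x%:Z| <= _).
  rewrite [leLHS]big_mkcond [leRHS]big_mkcond; apply: ler_sum => y _.
  case: ifP => [/andP[h _]|_]; last by case: ifP.
  by rewrite -/sg in h; rewrite h.
apply: le_trans (@ler_sum_window R Q (2 * sg) (piece_lo p) (fun x => `|F x|) (fun=> normr_ge0 _)) _.
set c := piece_lo p + sg%:Z.
have -> : piece_lo p = c - sg%:Z by rewrite addrK.
apply: zero_free_interval_bound => //; first by move: sgQ; clear; lia.
move=> t /andP[t1 t2]; apply/eqP => t0.
have QR : 0 < Q%:R :> R by rewrite ltr0n.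
have th0 : 0 < 2 * pi / Q%:R :> R by rewrite divr_gt0 ?mulr_gt0 ?pi_gt0.
have le_ang i j : (ang R Q i <= ang R Q j) = (i <= j).
  by rewrite /ang ler_pM2r // ler_int.
have angQE (k : int) : ang R Q (k * Q%:Z) = k%:~R * (2 * pi).
  by rewrite -[k * _]add0r angQ // /ang mul0r add0r.
have xQ : (x < Q)%N := ltn_ord x.
have [|w wws /andP[w1 w2]] := ws_zeros _ t0.
  have -> : - (2 * pi) = ang R Q (-1 * Q%:Z) by rewrite angQE mulN1r.
  have -> : 4 * pi = ang R Q (2 * Q%:Z) :> R by rewrite angQE; ring.
  apply/andP; split.
    apply: le_trans t1; rewrite le_ang; move: xlo xQ sgQ; rewrite /c -/sg; clear; lia.
  apply: le_trans t2 _; rewrite le_ang; move: xlo xQ sgQ; rewrite /c -/sg; clear; lia.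
have h1 : w <= c + (2 * sg)%:Z by rewrite -le_ang; exact: le_trans t2.
have h2 : c - (2 * sg)%:Z < w + 1.
  by rewrite ltNge -le_ang -ltNge; exact: le_lt_trans w2.
have := xfar _ wws; move: xlo h1 h2 sg0; rewrite /c -/sg; clear; lia.
Qed.

(** Within [16 s0] of a marked point [|F|] is bounded trivially by [size s]. Elsewhere each marked
    point has 34 pieces at each scale, of norm at most [2 Q] each, whence [68 Q]. *)
Lemma weighted_sum_bound (Psi : int -> R) (Binf : R) (B : nat -> R) :
  (forall x, 0 <= Psi x <= Binf) ->
  (forall x w i, w \in ws -> (i <= I)%N -> `|x - w| <= (34 * scale i)%:Z -> Psi x <= B i) ->
  (forall i, 0 <= B i) ->
  \sum_(x < Q) `|F x%:Z| * Psi x%:Z <=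
    (size ws)%:R * ((32 * s0 * size s)%:R * Binf + \sum_(i < I.+1) (68 * Q)%:R * B i).
Proof.
move=> Psi0 PsiB B0.
have Binf0 : 0 <= Binf by have /andP[h1 h2] := Psi0 0; exact: le_trans h2.
pose far (x : int) := all (fun w => ((16 * s0)%:Z <= `|x - w|)%R) ws.
rewrite (bigID (fun x : 'I_Q => ~~ far x%:Z)) /= mulrDr; apply: lerD.
- apply: le_trans (@ler_sum_cover R _ _ ws _
    (fun w (x : 'I_Q) => (w - (16 * s0)%:Z <= x%:Z < w - (16 * s0)%:Z + (32 * s0)%:Z)%R) _
    (fun w => (32 * s0 * size s)%:R * Binf) _ _ _) _.
  + by move=> x; have /andP[? ?] := Psi0 x%:Z; rewrite mulr_ge0.
  + move=> x /allPn[w wws]; rewrite -ltNge => h; exists w => //.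
    by move: h; clear; lia.
  + move=> w wws.
    apply: le_trans (_ : \sum_(x < Q | w - (16 * s0)%:Z <= x%:Z < w - (16 * s0)%:Z + (32 * s0)%:Z)
        (size s)%:R * Binf <= _).
      apply: ler_sum => x _; have /andP[? ?] := Psi0 x%:Z.
      by apply: ler_pM => //; exact: cos_sum_norm.
    apply: le_trans (@ler_sum_window R Q (32 * s0) _ (fun=> (size s)%:R * Binf) _) _.
      by move=> _; rewrite mulr_ge0.
    by rewrite sumr_const card_ord -[leLHS]mulr_natl [(_ * size s)%:R]natrM mulrA.
  + by rewrite big_const_seq count_predT iter_addr_0 -[leLHS]mulr_natl.
- have [ik ikP ikS] : exists2 ik : seq (nat * nat),
      forall i k, ((i, k) \in ik) = ((i <= I)%N && (k < 34)%N) &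
      \sum_(p <- ik) (2 * Q)%:R * B p.1 = \sum_(i < I.+1) (68 * Q)%:R * B i.
    exists [seq (i, k) | i <- iota 0 I.+1, k <- iota 0 34].
      move=> i k; apply/allpairsP/andP => [[[i' k'] []]|[ii kk]].
        by rewrite !mem_iota => i1 k1 [-> ->].
      by exists (i, k); rewrite !mem_iota; split.
    rewrite big_allpairs_dep -[iota 0 I.+1]/(index_iota 0 I.+1) big_mkord.
    apply: eq_bigr => i _; rewrite (eq_bigr (fun=> (2 * Q)%:R * B i)) //.
    rewrite big_const_seq count_predT iter_addr_0 size_iota.
    by rewrite -[LHS]mulr_natl mulrA -natrM mulnA.
  pose ps := [seq (w, p) | w <- ws, p <- ik].
  apply: le_trans (@ler_sum_cover R _ _ ps _ (fun p (x : 'I_Q) => in_piece p x%:Z) _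
    (fun p => (2 * Q)%:R * B p.2.1) _ _ _) _.
  + by move=> x; have /andP[? ?] := Psi0 x%:Z; rewrite mulr_ge0.
  + move=> x; rewrite negbK => xfar.
    have [|[w [i k]] [/= pw pi pk] pin] := @far_in_piece x%:Z _ xfar.
      by rewrite ltz_nat ltn_ord.
    exists (w, (i, k)) => //; apply/allpairsP; exists (w, (i, k)).
    by split; rewrite //= ikP pi.
  + move=> p /allpairsP[[w [i k]] [/= wws]]; rewrite ikP => /andP[iI k34] pE.
    apply: le_trans (_ : \sum_(x < Q | in_piece p x%:Z) `|F x%:Z| * B p.2.1 <= _).
      apply: ler_sum => x /andP[xp _]; rewrite ler_wpM2l //; apply: (PsiB _ w) => //.
        by rewrite pE.
      move: xp; rewrite pE /piece_lo /=.
      have : (k * scale i <= 33 * scale i)%N by rewrite leq_mul2r -(ltnS k) k34 orbT.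
      by rewrite -mulnA; move: (k * scale i)%N => v; clear; lia.
    by rewrite -big_distrl /= ler_wpM2r // piece_bound ?pE.
  + rewrite /ps big_allpairs_dep /= big_const_seq count_predT iter_addr_0 -[leLHS]mulr_natl.
    by rewrite ler_wpM2l // ikS.
Qed.

End WeightedSum.

(** * Differences of the coefficients *)

Section Difference.
Variables (q : nat) (a : int -> int).
Hypothesis q_gt0 : (0 < q)%N.

Definition diff (a : int -> int) (n : int) : int := a n - a (n - q%:Z).

Lemma iter_diff_bound (m : nat) (n : int) : (forall n, `|a n| <= 2) ->
  `|iter m diff a n| <= 2 * 2 ^+ m.
Proof.
move=> a2; elim: m n => [|m IH] n; first by rewrite expr0 mulr1.
rewrite iterS /diff exprS (le_trans (ler_normB _ _)) //.
by rewrite (_ : 2 * (2 * 2 ^+ m) = 2 * 2 ^+ m + 2 * 2 ^+ m) ?lerD ?IH //; ring.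
Qed.

(* A vanishing [m]-th difference makes the sequence polynomial along each
   residue class, and a bounded polynomial on a long progression is constant. *)
Lemma diff_eq0_of_iter (m : nat) (u v : int) : (forall n, `|a n| <= 2) ->
  u + (q * (2 ^ m.+1).+1)%:Z <= v ->
  (forall n, u <= n < v -> iter m.+1 diff a n = 0) ->
  forall n, u <= n < v -> diff a n = 0.
Proof.
move=> a2; elim: m => [|m IH] uv h n nuv; first exact: h.
apply: IH (nuv) => [|{}n {}nuv].
  apply: le_trans uv; rewrite lerD2l lez_nat leq_mul2l ltnS leq_pexp2l ?orbT //.
set w := iter m diff a; set w1 := iter m.+1 diff a.
have w1E k : w1 k = w k - w (k - q%:Z) by rewrite /w1 iterS.
have w1q k : u <= k < v -> w1 k = w1 (k - q%:Z).
  by move=> /h; rewrite iterS -/w1 => /eqP; rewrite subr_eq0 => /eqP.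
have qz : 0 < q%:Z by rewrite ltz_nat.
pose n0 := u + ((n - u) %% q%:Z)%Z.
have n0u : u <= n0 by rewrite lerDl modz_ge0 // gt_eqF.
have n0q : n0 < u + q%:Z by rewrite ltrD2l ltz_pmod.
have nE : n = n0 + ((n - u) %/ q%:Z)%Z * q%:Z.
  by rewrite /n0 -addrA [_ + _ * _]addrC -divz_eq addrC subrK.
pose j := absz ((n - u) %/ q%:Z)%Z.
have jE : j%:Z = ((n - u) %/ q%:Z)%Z.
  by rewrite /j gez0_abs // divz_ge0 //; move: nuv; clear; lia.
rewrite -jE in nE.
have step i : n0 + i%:Z * q%:Z < v -> w1 (n0 + i%:Z * q%:Z) = w1 n0.
  elim: i => [_|i IHi lv]; first by rewrite mul0r addr0.
  have e : n0 + i.+1%:Z * q%:Z - q%:Z = n0 + i%:Z * q%:Z.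
    by rewrite -addn1 PoszD mulrDl mul1r; ring.
  rewrite w1q ?e ?IHi //.
    by rewrite -e; move: lv qz; clear; lia.
  rewrite lv andbT (le_trans n0u) // lerDl; apply: mulr_ge0 => //; exact: ltW.
have sum i : n0 + i%:Z * q%:Z < v ->
    w (n0 + i%:Z * q%:Z) = w (n0 - q%:Z) + i.+1%:Z * w1 n0.
  elim: i => [lv|i IHi lv]; first by rewrite mul0r addr0 mul1r w1E; ring.
  have e : n0 + i.+1%:Z * q%:Z - q%:Z = n0 + i%:Z * q%:Z.
    by rewrite -addn1 PoszD mulrDl mul1r; ring.
  have := step _ lv; rewrite w1E e IHi; last first.
    by rewrite -e; move: lv qz; clear; lia.
  by rewrite -[i.+2]addn1 PoszD mulrDl mul1r => /eqP; rewrite subr_eq => /eqP ->; ring.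
(* Two values of [w], both bounded by [2 ^ m.+1], differ by [(2 ^ m.+2).+1] times the integer
   [w1 n0], which must therefore vanish. *)
have lT : n0 + (2 ^ m.+2)%:Z * q%:Z < v.
  apply: lt_le_trans uv; apply: lt_le_trans (_ : u + q%:Z + (2 ^ m.+2)%:Z * q%:Z <= _).
    by rewrite ltrD2r.
  by rewrite mulnS PoszD PoszM addrA [q%:Z * _]mulrC.
rewrite nE step -?nE; last by case/andP: nuv.
have := sum _ lT => E.
have b1 := iter_diff_bound m (n0 + (2 ^ m.+2)%:Z * q%:Z) a2.
have b2 := iter_diff_bound m (n0 - q%:Z) a2.
rewrite -/w E in b1; rewrite -/w in b2.
have e2 : 2 * 2 ^+ m = (2 ^ m.+1)%:Z :> int by rewrite -exprS -natrX natz.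
rewrite e2 in b1 b2.
rewrite (expnS 2 m.+1) in b1.
by move: b1 b2; move: (w _) (w1 n0) (2 ^ m.+1)%N => x c K; clear; nia.
Qed.

End Difference.

Section Coefficients.
Variables (R : realType) (s : seq nat) (q : nat).
Hypothesis s_uniq : uniq s.

(* Twice the Fourier coefficients of [cos_sum s]. *)
Definition coef (n : int) : int :=
  ((n \in map Posz s) + (- n \in map Posz s))%N%:Z.

Definition dcoef (m : nat) : int -> int := iter m (diff q) coef.

Lemma coef_ge0 n : 0 <= coef n.
Proof. by []. Qed.

Lemma coef_le2 n : coef n <= 2.
Proof. by rewrite /coef; case: (_ \in _); case: (_ \in _). Qed.

Lemma coef_norm_le2 n : `|coef n| <= 2.
Proof. by rewrite ger0_norm ?coef_ge0 // coef_le2. Qed.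

Lemma coef_mem (k : nat) : k \in s -> 0 < coef k%:Z.
Proof. by move=> ks; rewrite /coef map_f. Qed.

Lemma coef_eq0 (E : nat) n : (forall k, k \in s -> (k < E)%N) -> E%:Z <= `|n| -> coef n = 0.
Proof.
move=> sE En; rewrite /coef; case: mapP => [[k /sE kE nk]|_].
  by move: En kE; rewrite nk; clear; lia.
case: mapP => [[k /sE kE nk]|//].
move: En kE; have -> : n = - k%:Z by rewrite -nk opprK.
by clear; lia.
Qed.

Lemma dcoef_eq0 (E m : nat) n : (forall k, k \in s -> (k < E)%N) ->
  (E + q * m)%:Z <= `|n| -> dcoef m n = 0.
Proof.
move=> sE; elim: m n => [|m IH] n; first by rewrite muln0 addn0; exact: coef_eq0.
rewrite mulnS => h; rewrite /dcoef iterS /diff -/(dcoef m) !IH //;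
  by move: h; move: (q * m)%N => v; clear; lia.
Qed.

Lemma dcoef_support (m : nat) :
  exists2 Lam : seq int, uniq Lam & forall n, (n \in Lam) = (dcoef m n != 0).
Proof.
pose E := (\max_(k <- s) k).+1.
have sE k : k \in s -> (k < E)%N by move=> ks; rewrite ltnS; exact: leq_bigmax_seq.
pose B := (E + q * m)%N.
exists [seq n <- [seq i%:Z - B%:Z | i <- iota 0 (2 * B).+1] | dcoef m n != 0].
  by rewrite filter_uniq // map_inj_uniq ?iota_uniq // => i j; clear; lia.
move=> n; rewrite mem_filter; have [//|nz] := eqVneq (dcoef m n) 0.
have hB : `|n| < B%:Z.
  by rewrite ltNge; apply: contra nz => h; apply/eqP; exact: dcoef_eq0 sE h.
apply/mapP; exists (absz (n + B%:Z)); first by rewrite mem_iota add0n; move: hB; clear; lia.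
by move: hB; clear; lia.
Qed.

Variable Q : nat.
Hypothesis Q_gt0 : (0 < Q)%N.
Local Notation ez := (@ez R Q).
Local Notation F := (grid_val R Q s).

Definition shifted_val (m : nat) (x : int) : R[i] :=
  ((2 * F x)%:C)%C * (1 - ez (q%:Z * x)) ^+ m.

Lemma normc_shifted_val m x :
  normc (shifted_val m x) = 2 * `|F x| * normc (1 - ez (q%:Z * x)) ^+ m.
Proof.
rewrite normcM normcR normrM ger0_norm //; congr (_ * _).
by elim: m => [|m IH]; rewrite ?expr0 ?normc1 // !exprS normcM IH.
Qed.

Lemma sum_ez_eq (k n : int) : `|k - n| < Q%:Z ->
  \sum_(x < Q) ez ((k - n) * x%:Z) = (k == n)%:R * Q%:R.
Proof.
move=> kn; have [->|ne] := eqVneq k n; first by rewrite mul1r sum_ez_dvd // subrr dvdz0.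
rewrite mul0r sum_ez //; apply: contra ne => /dvdzP[p pE].
have : p = 0 by move: kn; rewrite pE; move: (Q) => Q'; clear; nia.
by move=> p0; rewrite p0 mul0r in pE; rewrite -subr_eq0 pE.
Qed.

(** A factor [1 - ez (q x)] acts on the Fourier coefficients as the [q]-step difference. The
    condition on [Q] excludes aliasing, so the grid sum picks out a single coefficient. *)
Lemma shifted_val_fourier m (n : int) :
  (forall k, k \in s -> k%:Z + `|n| + (q * m)%:Z < Q%:Z) ->
  \sum_(x < Q) ez (- n * x%:Z) * shifted_val m x%:Z = (dcoef m n)%:~R * Q%:R.
Proof.
elim: m n => [|m IH] n sQ.
  rewrite /shifted_val (eq_bigr (fun x : 'I_Q => \sum_(k <- s)
      (ez ((k%:Z - n) * x%:Z) + ez ((- k%:Z - n) * x%:Z)))); last first.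
    move=> x _; rewrite expr0 mulr1 grid_valE mulr_sumr rmorph_sum /= big_distrr /=.
    apply: eq_bigr => k _.
    have -> : ((2 * cs R Q (k%:Z * x%:Z))%:C)%C = ez (k%:Z * x%:Z) + ez (- k%:Z * x%:Z).
      rewrite /ez /cis -/(cs _ _ _) -/(cs _ _ _) mulNr csN.
      rewrite /ang intrN mulNr sinN.
      by rewrite -[RHS]/(_ +i* _)%C; congr Complex; ring.
    by rewrite mulrDr -!ezD -!mulrDl ![_ - n]addrC.
  rewrite exchange_big /=.
  rewrite big_seq (eq_bigr (fun k : nat => ((k%:Z == n) + (k%:Z == - n))%N%:R * Q%:R)); last first.
    move=> k /sQ; rewrite muln0 addr0 => kn.
    rewrite big_split /= !sum_ez_eq; last 2 first.
    - by move: kn; clear; lia.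
    - by move: kn; clear; lia.
    by rewrite natrD mulrDl; congr (_ + (_%:R * _)); congr nat_of_bool; apply/eqP/eqP; lia.
  rewrite -big_seq -big_distrl /=; congr (_ * _).
  rewrite -natr_sum /dcoef /= /coef -pmulrn; congr (_%:R).
  have cnt (z : int) : (\sum_(k <- s) (k%:Z == z))%N = (z \in map Posz s).
    rewrite -(big_map Posz xpredT (fun k => nat_of_bool (k == z))).
    rewrite -(count_uniq_mem z (_ : uniq (map Posz s))); last first.
      by rewrite map_inj_uniq // => i j [].
    by rewrite -sum1_count [RHS]big_mkcond; apply: eq_bigr => k _ /=; case: eqP.
  by rewrite big_split /= !cnt.
have {}IH n' := IH n'.
rewrite /dcoef iterS /diff -/(dcoef m) intrB mulrBl -!IH.
- rewrite -sumrB; apply: eq_bigr => x _; rewrite /shifted_val exprSr.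
  have -> : - (n - q%:Z) * x%:Z = - n * x%:Z + q%:Z * x%:Z by ring.
  by rewrite ezD; ring.
- move=> k /sQ; rewrite mulnS; clear; lia.
- move=> k /sQ; rewrite mulnS; clear; lia.
Qed.

(** By duality the pairing is a mean of [shifted_val] against [P] at the opposite angle. The sup
    norm of [P] and the factor 2 in [shifted_val] give the 4. *)
Lemma trig_pair_le m (P : seq (R * int)) :
  (forall t, normc (trig_eval P t) <= 2) ->
  (forall p k, p \in P -> k \in s -> k%:Z + `|p.2| + (q * m)%:Z < Q%:Z) ->
  Q%:R * trig_pair (dcoef m) P <=
  4 * \sum_(x < Q) `|F x%:Z| * normc (1 - ez (q%:Z * x%:Z)) ^+ m.
Proof.
move=> P2 PQ.
have -> : Q%:R * trig_pair (dcoef m) P =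
    complex.Re (\sum_(x < Q) trig_eval P (- ang R Q x%:Z) * shifted_val m x%:Z).
  rewrite /trig_eval; under eq_bigr do rewrite mulr_suml.
  rewrite exchange_big /= big_seq (eq_bigr (fun p => ((p.1 * (dcoef m p.2)%:~R * Q%:R)%:C)%C)); last first.
    move=> p pP; under eq_bigr do rewrite -mulrA.
    rewrite -mulr_sumr.
    rewrite (eq_bigr (fun x : 'I_Q => ez (- p.2 * x%:Z) * shifted_val m x%:Z)); last first.
      by move=> x _; congr (cis _ * _); rewrite /ang intrM intrN; ring.
    rewrite shifted_val_fourier; last by move=> k; exact: PQ.
    by rewrite -mulrA !rmorphM /= rmorph_int rmorph_nat.
  rewrite -big_seq -rmorph_sum /= /trig_pair mulr_sumr.
  by apply: eq_bigr => p _; ring.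
have Re_normc (z : R[i]) : complex.Re z <= normc z.
  case: z => u v /=; apply: le_trans (ler_norm u) _.
  by rewrite -sqrtr_sqr ler_wsqrtr // lerDl sqr_ge0.
apply: le_trans (Re_normc _) _.
apply: le_trans (_ : \sum_(x < Q) normc (trig_eval P (- ang R Q x%:Z) * shifted_val m x%:Z) <= _).
  elim: (index_enum _) => [|x l IH]; first by rewrite !big_nil normc0.
  by rewrite !big_cons (le_trans (normc_triangle _ _)) ?lerD2l.
rewrite mulr_sumr; apply: ler_sum => x _.
rewrite normcM normc_shifted_val.
have h : 0 <= `|F x%:Z| * normc (1 - ez (q%:Z * x%:Z)) ^+ m.
  by rewrite mulr_ge0 ?exprn_ge0 ?normc_ge0.
have := ler_wpM2r h (P2 (- ang R Q x%:Z)); rewrite -mulrA; lra.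
Qed.

End Coefficients.

Section Dirichlet.
Variable R : realType.

Lemma dirichlet_approx (zs : seq R) (D : nat) : (0 < D)%N ->
  exists q : nat, [/\ (0 < q)%N, (q <= D ^ size zs)%N &
    forall z, z \in zs -> exists p : int, `|q%:R * z - p%:~R| <= D%:R^-1].
Proof.
move=> D0; have DR : 0 < D%:R :> R by rewrite ltr0n.
pose fr (y : R) := y - (Num.floor y)%:~R.
have fr01 y : 0 <= fr y < 1.
  by have /andP[h1 h2] := floor_itv y; rewrite /fr; rewrite intrD in h2; lra.
pose bx (y : R) := absz (Num.floor (D%:R * fr y)).
have bxE y : (bx y)%:R <= D%:R * fr y < (bx y)%:R + 1.
  have /andP[f0 f1] := fr01 y.
  have /andP[h1 h2] := floor_itv (D%:R * fr y).
  have e : (bx y)%:R = (Num.floor (D%:R * fr y))%:~R :> R.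
    rewrite /bx -[LHS]/((absz _)%:Z%:~R) gez0_abs //.
    have : 0 < (Num.floor (D%:R * fr y) + 1).
      by rewrite -(ltr0z R); apply: le_lt_trans h2; rewrite mulr_ge0 // ltW.
    lia.
  by rewrite e h1 /=; rewrite intrD in h2.
have bxD y : (bx y < D)%N.
  have /andP[f0 f1] := fr01 y; have /andP[h1 _] := bxE y.
  rewrite -(ltr_nat R); apply: le_lt_trans h1 _.
  by rewrite -[ltRHS]mulr1 ltr_pM2l.
pose k := size zs.
pose f (j : 'I_(D ^ k).+1) : k.-tuple 'I_D :=
  [tuple Ordinal (bxD ((j : nat)%:R * zs`_i)) | i < k].
have : ~~ injectiveb f.
  apply/negP => /injectiveP/leq_card.
  by rewrite card_ord card_tuple card_ord ltnn.
move=> /injectivePn[j1 [j2 j12 fE]].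
wlog lt12 : j1 j2 j12 fE / (j1 < j2)%N => [hw|].
  have [l|l|e] := ltngtP j1 j2; first exact: (hw j1 j2).
    by apply: (hw j2 j1) => //; rewrite eq_sym.
  by move: j12; rewrite (val_inj e) eqxx.
exists (j2 - j1)%N; split; first by rewrite subn_gt0.
  by rewrite leq_subLR (leq_trans (_ : (j2 <= D ^ k)%N)) ?leq_addl // -ltnS.
move=> z zzs; have iz : (index z zs < k)%N by rewrite index_mem.
have bE : bx (j1%:R * z) = bx (j2%:R * z).
  have := congr1 (fun t => val (tnth t (Ordinal iz))) fE.
  by rewrite !tnth_map !tnth_ord_tuple /= nth_index.
exists (Num.floor (j2%:R * z) - Num.floor (j1%:R * z)).
have /andP[a1 a2] := bxE (j1%:R * z); have /andP[b1 b2] := bxE (j2%:R * z).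
rewrite bE in a1 a2.
have -> : (j2 - j1)%N%:R * z - (Num.floor (j2%:R * z) - Num.floor (j1%:R * z))%:~R =
    fr (j2%:R * z) - fr (j1%:R * z).
  by rewrite natrB ?(ltnW lt12) // intrB /fr; ring.
rewrite -(ler_pM2l DR) mulfV ?gt_eqF // -[X in X * _](gtr0_norm DR) -normrM mulrBr.
by rewrite ler_norml; apply/andP; split; lra.
Qed.

(** The test polynomial depends on the coefficients alone, so the grid can be made fine enough for
    it afterwards; its frequencies are not bounded in advance. *)
Lemma support_bound (s : seq nat) (q m rho : nat) (Lam : seq int) :
  uniq s -> (0 < rho)%N -> uniq Lam -> (forall n, (n \in Lam) = (dcoef s q m n != 0)) ->
  (cd_base rho ^ (rho ^ 2 * rho ^ 4) <= size Lam)%N ->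
  exists Q0 : nat, forall Q : nat, (0 < Q)%N -> (Q0 <= Q)%N ->
    rho%:R / 16 * Q%:R <= \sum_(x < Q) `|grid_val R Q s x%:Z| *
      normc (1 - ez R Q (q%:Z * x%:Z)) ^+ m.
Proof.
move=> us rho0 uL LamE sL.
have [P [P2 Pp]] := @cohen_davenport R rho (dcoef s q m) Lam rho0 uL LamE sL.
exists (\max_(k <- s) k + \max_(p <- P) absz p.2 + q * m).+1 => Q Q0 QQ.
have QR : 0 < Q%:R :> R by rewrite ltr0n.
have sep (p : R * int) (k : nat) : p \in P -> k \in s -> k%:Z + `|p.2| + (q * m)%:Z < Q%:Z.
  move=> pP ks.
  have h1 : (k <= \max_(k <- s) k)%N by exact: leq_bigmax_seq.
  have h2 : (absz p.2 <= \max_(p <- P) absz p.2)%N by exact: (@leq_bigmax_seq _ P xpredT (fun p => absz p.2)).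
  by move: h1 h2 QQ; move: (\max_(k <- s) k)%N (\max_(p <- P) _)%N (q * m)%N => a b c; clear; lia.
have := trig_pair_le us Q0 P2 sep; have := ler_wpM2l (ltW QR) Pp; lra.
Qed.

End Dirichlet.

(** * Averages of the coefficients *)

Section Density.
Variables (R : realType) (Q : nat) (s : seq nat).
Hypotheses (Q_gt0 : (0 < Q)%N) (s_uniq : uniq s).
Hypothesis s_ltQ : forall k, k \in s -> (k < Q)%N.
Local Notation F := (grid_val R Q s).
Local Notation cs := (@cs R Q).
Local Notation fejer := (@fejer R Q).

Let QR : 0 < Q%:R :> R. Proof. by rewrite ltr0n. Qed.

(* By [densityE], an average of [coef s] around [n] at scale [Q / r]. *)
Definition density (r : nat) (n : int) : R :=
  2 / (Q%:R * r%:R) * triangle_sum (fun x => F x * cs (n * x)) r.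

Lemma densityE r n :
  density r n = (Q%:R * r%:R)^-1 * \sum_(k <- s) (fejer r (k%:Z - n) + fejer r (k%:Z + n)).
Proof.
rewrite /density [2 / _]mulrC -mulrA; congr (_ * _).
rewrite -triangle_sumZ /fejer.
under [RHS]eq_bigr do rewrite -[X in X + _]mul1r -[X in _ + X]mul1r.
rewrite (@eq_triangle_sum _ _ (fun x => \sum_(k <- s)
    (cs ((k%:Z - n) * x) + cs ((k%:Z + n) * x)))); last first.
  move=> x; rewrite grid_valE mulr_suml mulr_sumr; apply: eq_bigr => k _.
  by rewrite [(_ - n) * _]mulrBl [(_ + n) * _]mulrDl [RHS]addrC csM.
rewrite triangle_sum_sum; apply: eq_bigr => k _.
rewrite /triangle_sum !mul1r mulrDr addrACA; congr (_ + _).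
by rewrite -big_split /=; apply: eq_bigr => x _; ring.
Qed.

Lemma density_ge0 r n : 0 <= density r n.
Proof.
rewrite densityE mulr_ge0 ?invr_ge0 ?mulr_ge0 // sumr_ge0 // => k _.
by rewrite addr_ge0 ?fejer_ge0.
Qed.

Lemma density0_le2 r : (0 < r)%N -> (r <= Q)%N -> density r 0 <= 2.
Proof.
move=> r0 rQ; have rR : 0 < r%:R :> R by rewrite ltr0n.
rewrite densityE mulrC ler_pdivrMr ?mulr_gt0 //.
rewrite (eq_bigr (fun k : nat => 2 * fejer r k%:Z)); last first.
  by move=> k _; rewrite subr0 ?addr0 mulr_natl mulr2n.
rewrite -mulr_sumr.
have := @sum_fejer_le R Q s Q_gt0 s_uniq s_ltQ r rQ; rewrite natrM; lra.
Qed.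

Lemma sum_density r : (0 < r)%N -> (r <= Q)%N ->
  \sum_(n < Q) density r n%:Z = 2 * (size s)%:R.
Proof.
move=> r0 rQ; have rR : 0 < r%:R :> R by rewrite ltr0n.
under eq_bigr do rewrite densityE.
rewrite -mulr_sumr exchange_big /= (eq_bigr (fun=> 2 * (r * Q)%:R)); last first.
  move=> k _; rewrite big_split /=.
  have sh (t : int) : \sum_(i < Q) fejer r (i%:Z + t) = (r * Q)%:R.
    rewrite (@sum_periodic_shift R Q (fejer r)); first exact: sum_fejer.
    by move=> j; exact: fejerQ.
  rewrite -(sh k%:Z) mulr_natl mulr2n; congr (_ + _); last first.
    by apply: eq_bigr => i _; rewrite addrC.
  rewrite sh -(sh (- k%:Z)); apply: eq_bigr => i _.
  by rewrite -fejerN; congr fejer; ring.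
rewrite big_const_seq count_predT iter_addr_0 -[_ *+ size s]mulr_natl natrM.
by field; rewrite !gt_eqF.
Qed.

Definition tent (r x : nat) : R := (r - x)%:R / r%:R.

(* The de la Vallée Poussin weights, equal to [1] up to [r] and to [0] from
   [2 r] on. *)
Definition plateau (r x : nat) : R := 2 * tent (2 * r) x - tent r x.

Lemma plateau1 r x : (0 < r)%N -> (x <= r)%N -> plateau r x = 1.
Proof.
move=> r0 xr; have rR : 0 < r%:R :> R by rewrite ltr0n.
rewrite /plateau /tent !natrB ?natrM //; last by move: xr; clear; lia.
by field; rewrite gt_eqF.
Qed.

Lemma plateau0 r x : (2 * r <= x)%N -> plateau r x = 0.
Proof.
move=> rx; rewrite /plateau /tent.
have -> : (2 * r - x = 0)%N by move: rx; clear; lia.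
have -> : (r - x = 0)%N by move: rx; clear; lia.
by rewrite !mul0r mulr0 subr0.
Qed.

Lemma plateau_itv r x : (0 < r)%N -> 0 <= plateau r x <= 1.
Proof.
move=> r0; have rR : 0 < r%:R :> R by rewrite ltr0n.
have [xr|rx] := leqP x r; first by rewrite plateau1 // ler01 lexx.
have [xr|xr] := leqP (2 * r) x; first by rewrite plateau0 // lexx ler01.
rewrite /plateau /tent; have -> : (r - x = 0)%N by move: rx; clear; lia.
rewrite mul0r subr0 natrB ?(ltnW xr) // natrM.
have -> : 2 * ((2 * r%:R - x%:R) / (2 * r%:R)) = (2 * r%:R - x%:R) / r%:R :> R.
  by field; rewrite gt_eqF.
have h1 : r%:R <= x%:R :> R by rewrite ler_nat ltnW.
have h2 : x%:R <= 2 * r%:R :> R by rewrite -natrM ler_nat ltnW.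
by rewrite ler_pdivrMr // divr_ge0 //; lra.
Qed.

Definition vp_density (r : nat) (n : int) : R := 2 * density (2 * r) n - density r n.

Lemma densityE_tent (r L : nat) n : (0 < r)%N -> (r <= L)%N ->
  density r n = 2 / Q%:R * (F 0 + \sum_(1 <= x < L) tent r x * (2 * (F x%:Z * cs (n * x%:Z)))).
Proof.
move=> r0 rL; have rR : 0 < r%:R :> R by rewrite ltr0n.
have z : \sum_(r <= x < L) tent r x * (2 * (F x%:Z * cs (n * x%:Z))) = 0.
  rewrite big_nat_cond big1 // => x /andP[/andP[rx _] _].
  by rewrite /tent (eqP rx) !mul0r.
rewrite (@big_cat_nat _ _ _ r) //= z addr0.
rewrite /density /triangle_sum mulr0 cs0 mulr1 !mulrDr; congr (_ + _).
  by field; rewrite !gt_eqF.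
rewrite !mulr_sumr; apply: eq_bigr => x _; rewrite /tent.
by field; rewrite !gt_eqF.
Qed.

Lemma vp_densityE (r L : nat) n : (0 < r)%N -> (2 * r <= L)%N ->
  vp_density r n = 2 / Q%:R *
    (F 0 + \sum_(1 <= x < L) plateau r x * (2 * (F x%:Z * cs (n * x%:Z)))).
Proof.
move=> r0 rL; rewrite /vp_density (@densityE_tent (2 * r) L) ?muln_gt0 //.
rewrite (@densityE_tent r L) //; last by move: rL; clear; lia.
rewrite [X in X - _]mulrCA -mulrBr; congr (_ * _).
have -> : \sum_(1 <= x < L) plateau r x * (2 * (F x%:Z * cs (n * x%:Z))) =
  2 * \sum_(1 <= x < L) tent (2 * r) x * (2 * (F x%:Z * cs (n * x%:Z)))
  - \sum_(1 <= x < L) tent r x * (2 * (F x%:Z * cs (n * x%:Z))).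
  by rewrite mulr_sumr -sumrB; apply: eq_bigr => x _; rewrite /plateau; ring.
ring.
Qed.

(** The two plateaus agree up to [r0] and both vanish from [2 r1] on. Plain triangle weights would
    leave a contribution from the points near 0, where [F] is not controlled. *)
Lemma vp_density_diff (r0 r1 : nat) n : (0 < r0)%N -> (2 * r0 <= r1)%N ->
  vp_density r1 n - vp_density r0 n = 4 / Q%:R *
    \sum_(r0 <= x < 2 * r1) (plateau r1 x - plateau r0 x) * (F x%:Z * cs (n * x%:Z)).
Proof.
move=> r00 r01.
have r10 : (0 < r1)%N by move: r00 r01; clear; lia.
rewrite (@vp_densityE r1 (2 * r1)) // (@vp_densityE r0 (2 * r1)) //; last first.
  by rewrite (leq_trans r01) ?leq_pmull.
rewrite -mulrBr [F 0 + _]addrC addrKA -sumrB (@big_cat_nat _ _ _ r0) //=; last first.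
  by move: r01; clear; lia.
rewrite [X in _ * (X + _)]big_nat_cond big1 ?add0r; last first.
  move=> x /andP[/andP[_ xr] _]; rewrite !plateau1 ?subrr //; first exact: ltnW.
  by move: xr r01; clear; lia.
rewrite !mulr_sumr; apply: eq_bigr => x _; field; rewrite gt_eqF //.
Qed.

Lemma plateau_diff_itv (r0 r1 x : nat) : (0 < r0)%N -> (2 * r0 <= r1)%N ->
  0 <= plateau r1 x - plateau r0 x <= 1.
Proof.
move=> r00 r01.
have r10 : (0 < r1)%N by move: r00 r01; clear; lia.
have /andP[a1 a2] := plateau_itv x r10; have /andP[b1 b2] := plateau_itv x r00.
have [xr|/ltnW rx] := leqP x r1; first by rewrite plateau1 //; lra.
by rewrite (@plateau0 r0) ?subr0 ?a1 // (leq_trans r01).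
Qed.

Lemma vp_density_diff_le (r0 r1 : nat) n : (0 < r0)%N -> (2 * r0 <= r1)%N ->
  `|vp_density r1 n - vp_density r0 n| <= 4 / Q%:R * \sum_(r0 <= x < 2 * r1) `|F x%:Z|.
Proof.
move=> r00 r01; rewrite vp_density_diff // normrM (ger0_norm (_ : 0 <= 4 / Q%:R)); last first.
  by rewrite divr_ge0 // ltW.
rewrite ler_wpM2l ?divr_ge0 ?(ltW QR) // (le_trans (ler_norm_sum _ _ _)) //.
apply: ler_sum => x _; have /andP[h1 h2] := plateau_diff_itv x r00 r01.
rewrite normrM ger0_norm // normrM -[leRHS]mul1r.
apply: ler_pM => //; rewrite ?mulr_ge0 //.
by rewrite -[leRHS]mulr1 ler_wpM2l // cos_max.
Qed.

(* Because [cos_sum s] is even and keeps its sign on the annulus, the absolute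
   values sum to a difference of two local densities at [0]. *)
Lemma annulus_bound (r0 r1 : nat) : (0 < r0)%N -> (2 * r0 <= r1)%N -> (2 * r1 <= Q)%N ->
  (forall x, (r0 <= x < 2 * r1)%N -> 0 <= F x%:Z) \/
  (forall x, (r0 <= x < 2 * r1)%N -> F x%:Z <= 0) ->
  \sum_(2 * r0 <= x < r1) `|F x%:Z| <= 3 / 2 * Q%:R.
Proof.
move=> r00 r01 r1Q sgn.
have r10 : (0 < r1)%N by move: r00 r01; clear; lia.
(* Both values lie in [[-2, 4]], whence the 6; the factor [Q / 4] turns it into [3 / 2 Q]. *)
have V06 : `|vp_density r1 0 - vp_density r0 0| <= 6.
  have b r : (0 < r)%N -> (2 * r <= Q)%N -> -2 <= vp_density r 0 <= 4.
    move=> rg rQ; have h1 := density_ge0 r 0; have h2 := density_ge0 (2 * r) 0.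
    have h3 := @density0_le2 (2 * r) (ltac:(lia)) rQ.
    have h4 := @density0_le2 r rg (ltac:(lia)).
    by rewrite /vp_density; lra.
  have /andP[a1 a2] := b r1 r10 r1Q.
  have /andP[c1 c2] := b r0 r00 (ltac:(lia)).
  by rewrite ler_norml; lra.
set S := \sum_(r0 <= x < 2 * r1) (plateau r1 x - plateau r0 x) * `|F x%:Z|.
have SE : `|vp_density r1 0 - vp_density r0 0| = 4 / Q%:R * S.
  have S0 : 0 <= S.
    apply: sumr_ge0 => x _; have /andP[h1 _] := plateau_diff_itv x r00 r01.
    by rewrite mulr_ge0.
  rewrite vp_density_diff // normrM (ger0_norm (_ : 0 <= 4 / Q%:R)); last first.
    by rewrite divr_ge0 // ltW.
  congr (_ * _); case: sgn => sgn.
    rewrite -[RHS]ger0_norm //; congr (`|_|); apply: eq_big_nat => x xr.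
    by rewrite mul0r cs0 mulr1 (ger0_norm (sgn _ xr)).
  rewrite -[RHS]ger0_norm // -[RHS]normrN /S -sumrN; congr (`|_|); apply: eq_big_nat => x xr.
  by rewrite mul0r cs0 mulr1 (ler0_norm (sgn _ xr)) mulrN opprK.
have : \sum_(2 * r0 <= x < r1) `|F x%:Z| <= S.
  rewrite /S (@big_cat_nat _ _ _ (2 * r0) r0) /=; [|by rewrite leq_pmull|]; last first.
    by rewrite (leq_trans r01) ?leq_pmull.
  rewrite (@big_cat_nat _ _ _ r1 (2 * r0) (2 * r1)) //=; last by rewrite leq_pmull.
  have pos u v : 0 <= \sum_(u <= x < v) (plateau r1 x - plateau r0 x) * `|F x%:Z|.
    apply: sumr_ge0 => x _; have /andP[h1 _] := plateau_diff_itv x r00 r01.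
    by rewrite mulr_ge0.
  rewrite -[leLHS]add0r lerD // -[leLHS]addr0 lerD //.
  rewrite !big_nat; apply: ler_sum => x /andP[h1 h2].
  by rewrite plateau1 ?(ltnW h2) // plateau0 // subr0 mul1r.
move=> /le_trans; apply; move: V06; rewrite SE => h.
have : 4 / Q%:R * S * (Q%:R / 4) <= 6 * (Q%:R / 4).
  by rewrite ler_wpM2r // divr_ge0 // ltW.
have -> : 4 / Q%:R * S * (Q%:R / 4) = S by field; rewrite gt_eqF.
lra.
Qed.

Lemma cos_lipschitz (u v : R) : `|cos u - cos v| <= `|u - v|.
Proof.
have := normc_1Bcis_le (v - u) 0; rewrite mul0r subr0 (distrC v u).
have -> : normc (1 - cis (v - u)) = normc (cis u - cis v).
  rewrite -[RHS]mul1r -(normc_cis (- u)) -normcM mulrBr -!cisD.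
  by rewrite [- u + u]addrC subrr cis0 [- u + v]addrC.
move=> /(le_trans _); apply.
rewrite /cis /= -sqrtr_sqr ler_wsqrtr //.
by rewrite lerDl sqr_ge0.
Qed.

(** As a function of [n] the average has only frequencies below [2 r], so a unit step changes each
    cosine by at most [2 r] times the grid angle. *)
Lemma vp_density_lipschitz (r : nat) n : (0 < r)%N -> (2 * r <= Q)%N ->
  `|vp_density r (n + 1) - vp_density r n| <=
  16 * pi * r%:R / Q%:R ^+ 2 * \sum_(x < Q) `|F x%:Z|.
Proof.
move=> r0 rQ; rewrite !(@vp_densityE r (2 * r)) // -mulrBr [X in X - _]addrC addrKA -sumrB.
rewrite normrM (ger0_norm (_ : 0 <= 2 / Q%:R)); last by rewrite divr_ge0 // ltW.
have -> : 16 * pi * r%:R / Q%:R ^+ 2 * \sum_(x < Q) `|F x%:Z| =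
   2 / Q%:R * \sum_(x < Q) 2 * (2 * (2 * pi / Q%:R) * r%:R) * `|F x%:Z|.
  by rewrite -mulr_sumr; field; rewrite gt_eqF.
rewrite ler_wpM2l ?divr_ge0 ?(ltW QR) // (le_trans (ler_norm_sum _ _ _)) //.
rewrite -(big_mkord xpredT (fun x => 2 * (2 * (2 * pi / Q%:R) * r%:R) * `|F x%:Z|)).
have p0 : 0 <= 2 * pi / Q%:R :> R by rewrite divr_ge0 ?mulr_ge0 ?pi_ge0 // ltW.
have pos x : 0 <= 2 * (2 * (2 * pi / Q%:R) * r%:R) * `|F x%:Z|.
  by apply: mulr_ge0 => //; do 2!apply: mulr_ge0 => //; exact: mulr_ge0.
rewrite (@big_cat_nat _ _ _ (2 * r) 0 Q) //= (@big_cat_nat _ _ _ 1 0 (2 * r)) ?muln_gt0 //=.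
rewrite -[leLHS]addr0 lerD ?sumr_ge0 // -[leLHS]add0r lerD ?sumr_ge0 //.
rewrite !big_nat; apply: ler_sum => x /andP[_ xr].
have /andP[h1 h2] := plateau_itv x r0.
rewrite -mulrBr normrM ger0_norm // -[leRHS]mul1r.
apply: ler_pM => //; rewrite -mulrBr normrM ger0_norm // -mulrA ler_wpM2l //.
rewrite -mulrBr normrM mulrC ler_wpM2r //.
apply: le_trans (cos_lipschitz _ _) _.
have -> : ang R Q ((n + 1) * x%:Z) - ang R Q (n * x%:Z) = x%:R * (2 * pi / Q%:R).
  by rewrite /ang -mulrBl -intrB mulrDl mul1r [n * _ + _]addrC addrK.
move: (2 * pi / Q%:R) p0 => th p0; rewrite ger0_norm ?mulr_ge0 //.
have -> : 2 * th * r%:R = (2 * r)%:R * th by rewrite natrM; ring.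
by rewrite ler_wpM2r // ler_nat ltnW.
Qed.

End Density.

(** * Averages over periodic blocks *)

Section PeriodicDensity.
Variables (R : realType) (s : seq nat).
Hypothesis s_uniq : uniq s.

Lemma sum_coef_window (g : int -> R) (lo : int) (L : nat) :
  (forall k, k \in s -> lo <= - k%:Z /\ k%:Z < lo + L%:Z) ->
  \sum_(y < L) (coef s (lo + y%:Z))%:~R * g (lo + y%:Z) =
  \sum_(k <- s) (g k%:Z + g (- k%:Z)).
Proof.
move=> win.
have coefE (z : int) : (coef s z)%:~R = \sum_(k <- s) ((k%:Z == z)%:R + (- k%:Z == z)%:R) :> R.
  have cnt (w : int) : \sum_(k <- s) (k%:Z == w)%:R = (w \in map Posz s)%:R :> R.
    rewrite -(big_map Posz xpredT (fun k => (k == w)%:R)).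
    have us : uniq (map Posz s) by rewrite map_inj_uniq // => i j [].
    rewrite -natr_sum; congr (_%:R).
    rewrite -(count_uniq_mem w us) -sum1_count [RHS]big_mkcond.
    by apply: eq_bigr => k _ /=; case: eqP.
  rewrite big_split /= cnt /coef -pmulrn natrD -[(- z \in _)%:R]cnt; congr (_ + _).
  by apply: eq_bigr => k _; congr (_%:R); congr nat_of_bool; apply/eqP/eqP; lia.
have pick (z : int) : lo <= z < lo + L%:Z ->
    \sum_(y < L) (z == lo + y%:Z)%:R * g (lo + y%:Z) = g z.
  move=> zw; have yL : (absz (z - lo) < L)%N by move: zw; clear; lia.
  rewrite (bigD1 (Ordinal yL)) //= big1 ?addr0 => [|y yne].
    have -> : lo + (absz (z - lo))%:Z = z by move: zw; clear; lia.
    by rewrite eqxx mul1r.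
  have [e|_] := eqVneq z (lo + y%:Z); last by rewrite mul0r.
  by move/eqP: yne; case; apply: val_inj; move: e; clear; rewrite /=; lia.
under eq_bigr do rewrite coefE mulr_suml.
rewrite exchange_big /= !big_seq; apply: eq_bigr => k /win [k1 k2].
under eq_bigr do rewrite mulrDl.
rewrite big_split /= !pick //; first by move: k1 k2; clear; lia.
by move: k1 k2; clear; lia.
Qed.

Lemma sum_inv_sq (H L : nat) : (0 < H)%N -> (H <= L)%N ->
  \sum_(H <= i < L) (i.+1%:R ^+ 2 : R)^-1 <= H%:R^-1.
Proof.
move=> H0 HL; have HR : 0 < H%:R :> R by rewrite ltr0n.
suff h : \sum_(H <= i < L) (i.+1%:R ^+ 2 : R)^-1 <= H%:R^-1 - L%:R^-1.
  by apply: le_trans h _; rewrite gerBl invr_ge0.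
elim: L HL => [|L IH]; first by rewrite leqn0 => /eqP HE; move: H0; rewrite HE.
rewrite leq_eqVlt => /orP[/eqP <-|]; first by rewrite big_geq // subrr.
rewrite ltnS => HL; rewrite big_nat_recr //=.
have L0 : 0 < L%:R :> R by rewrite ltr0n (leq_trans H0).
have L1 : 0 < L.+1%:R :> R by rewrite ltr0n.
suff h : (L.+1%:R ^+ 2 : R)^-1 <= L%:R^-1 - L.+1%:R^-1.
  by apply: le_trans (lerD (IH HL) h) _; rewrite addrA subrK.
have -> : L%:R^-1 - L.+1%:R^-1 = (L%:R * L.+1%:R)^-1 :> R.
  by rewrite -natr1; field; rewrite natr1 !gt_eqF.
rewrite lef_pV2 ?posrE ?mulr_gt0 ?exprn_gt0 // expr2 ler_wpM2r ?ltW //.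
by rewrite ltr_nat.
Qed.

Lemma sum_blocks (q P : nat) (h : int -> R) :
  \sum_(y < q * P) h y%:Z = \sum_(c < q) \sum_(i < P) h (c%:Z + q%:Z * i%:Z).
Proof.
elim: P => [|P IH].
  by rewrite muln0 big_ord0 big1 // => c _; rewrite big_ord0.
rewrite mulnS addnC big_split_ord /= IH.
under [RHS]eq_bigr do rewrite big_ord_recr /=.
rewrite big_split /=; congr (_ + _); apply: eq_bigr => c _.
by rewrite PoszD PoszM addrC.
Qed.

Variables (q P' P : nat).
Let Q := (q * P')%N.
Hypotheses (q_gt0 : (0 < q)%N) (P'_gt0 : (0 < P')%N) (QE : Q = (2 * P)%N).
Local Notation fejer := (@fejer R Q).

Let Q_gt0 : (0 < Q)%N. Proof. by rewrite muln_gt0 q_gt0. Qed.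

Lemma coef_periodic (n : int) (H : nat) (z : int) : (q <= H)%N ->
  (forall j, n - H%:Z <= j <= n + H%:Z -> diff q (coef s) j = 0) ->
  `|z| <= H%:Z -> coef s (n + z) = coef s (n + (z %% q%:Z)%Z).
Proof.
move=> qH per.
have step j : n - H%:Z <= j <= n + H%:Z -> coef s j = coef s (j - q%:Z).
  by move=> /per/eqP; rewrite subr_eq0 => /eqP.
have qz : 0 < q%:Z by rewrite ltz_nat.
have m0 := modz_ge0 z (_ : q%:Z != 0); have {}m0 := m0 (lt0r_neq0 qz).
have m1 : (z %% q%:Z)%Z < q%:Z by rewrite ltz_pmod.
have zE := divz_eq z q%:Z.
move: (z %% q%:Z)%Z (z %/ q%:Z)%Z m0 m1 zE => c t c0 c1 -> zH.
have up (i : nat) : c + i%:Z * q%:Z <= H%:Z ->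
    coef s (n + (i%:Z * q%:Z + c)) = coef s (n + c).
  elim: i => [|i IH] iH; first by rewrite mul0r add0r.
  have e : i.+1%:Z * q%:Z = i%:Z * q%:Z + q%:Z by rewrite -addn1 PoszD mulrDl mul1r.
  have iq : 0 <= i%:Z * q%:Z by [].
  rewrite step; last by move: iH c0 iq; rewrite e; clear; lia.
  rewrite -IH; last by move: iH qz; rewrite e; clear; lia.
  by congr coef; rewrite e; ring.
have down (i : nat) : - H%:Z <= c - i%:Z * q%:Z ->
    coef s (n + (c - i%:Z * q%:Z)) = coef s (n + c).
  elim: i => [|i IH] iH; first by rewrite mul0r subr0.
  have e : i.+1%:Z * q%:Z = i%:Z * q%:Z + q%:Z by rewrite -addn1 PoszD mulrDl mul1r.
  have iq : 0 <= i%:Z * q%:Z by [].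
  rewrite -IH; last by move: iH qz; rewrite e; clear; lia.
  rewrite [RHS]step; last by move: iH c1 iq qH qz; rewrite e; clear; lia.
  by congr coef; rewrite e; ring.
case: t zH => t zH; first by rewrite up //; move: zH; clear; lia.
rewrite NegzE mulNr [- _ + c]addrC down //.
by move: zH; rewrite NegzE mulNr; clear; lia.
Qed.

Definition period_sum (n : int) : int := \sum_(c < q) coef s (n + c%:Z).

Lemma sum_tail (H : nat) : (0 < H)%N -> (H <= P)%N ->
  \sum_(y < Q) (if (H%:Z < `|y%:Z - P%:Z|)%R then (2 * `|y%:Z - P%:Z|%:~R ^+ 2 : R)^-1 else 0)
  <= H%:R^-1.
Proof.
move=> H0 HP.
pose w (i : nat) : R := if (H < i)%N then (2 * i%:R ^+ 2)^-1 else 0.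
have -> : \sum_(y < Q) (if (H%:Z < `|y%:Z - P%:Z|)%R then
    (2 * `|y%:Z - P%:Z|%:~R ^+ 2 : R)^-1 else 0) =
    \sum_(0 <= y < P) w y.+1 + \sum_(0 <= y < P) w y.
  rewrite QE -(big_mkord xpredT (fun y : nat => if (H%:Z < `|y%:Z - P%:Z|)%R then
    (2 * `|y%:Z - P%:Z|%:~R ^+ 2 : R)^-1 else 0)).
  rewrite (@big_cat_nat _ _ _ P) //=; last by rewrite leq_pmull.
  congr (_ + _).
    rewrite [RHS]big_nat_rev /= add0n; apply: eq_big_nat => y /andP[_ yP].
    have -> : `|y%:Z - P%:Z| = (P - y)%N%:Z by move: yP; clear; lia.
    rewrite ltz_nat /w -pmulrn.
    by have -> : (P - y = (P - y.+1).+1)%N by move: yP; clear; lia.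
  rewrite -{1}[P]add0n big_addn mul2n -addnn addnK; apply: eq_big_nat => y _.
  have -> : `|(y + P)%N%:Z - P%:Z| = y%:Z by clear; lia.
  by rewrite ltz_nat /w -pmulrn.
have w0 i : 0 <= w i by rewrite /w; case: ifP => // _; rewrite invr_ge0 mulr_ge0 ?exprn_ge0.
have tl : \sum_(0 <= y < P) w y.+1 <= (2 * H%:R)^-1.
  rewrite (@big_cat_nat _ _ _ H) //= big_nat_cond big1 ?add0r; last first.
    by move=> y /andP[/andP[_ yH] _]; rewrite /w ltnS leqNgt yH.
  rewrite invfM; apply: le_trans (_ : 2^-1 * \sum_(H <= i < P) (i.+1%:R ^+ 2)^-1 <= _).
    rewrite mulr_sumr !big_nat; apply: ler_sum => y /andP[Hy _].
    by rewrite /w ltnS Hy invfM.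
  by rewrite ler_wpM2l ?invr_ge0 // sum_inv_sq.
have sh : \sum_(0 <= y < P) w y <= \sum_(0 <= y < P) w y.+1.
  case: (P) => [|p]; first by rewrite !big_geq.
  rewrite big_nat_recl // [leRHS]big_nat_recr //= {1}/w ltn0 add0r lerDl.
  exact: w0.
have -> : H%:R^-1 = (2 * H%:R)^-1 + (2 * H%:R)^-1 :> R.
  by field; rewrite pnatr_eq0 -lt0n.
by apply: lerD => //; exact: le_trans tl.
Qed.

(** All residue classes carry the same Fejér mass, so the [q]-periodic extension of the coefficients
    around [n] has average exactly [period_sum n / q]. The true coefficients differ from it only
    beyond distance [H], where the kernel is at most [Q^2 / (2 z^2)]. *)
Lemma periodic_density (r H : nat) (n : int) : (0 < r)%N -> (r <= P')%N ->
  (q <= H)%N -> (H <= P)%N ->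
  (forall k, k \in s -> n - P%:Z <= - k%:Z /\ k%:Z < n + P%:Z) ->
  (forall j, n - H%:Z <= j <= n + H%:Z -> diff q (coef s) j = 0) ->
  `|density R Q s r n - (period_sum n)%:~R / q%:R| <= 2 * Q%:R / (r%:R * H%:R).
Proof.
move=> r0 rP qH HP win per.
have H0 : (0 < H)%N := leq_trans q_gt0 qH.
have rR : 0 < r%:R :> R by rewrite ltr0n.
have HR : 0 < H%:R :> R by rewrite ltr0n.
have qR : 0 < q%:R :> R by rewrite ltr0n.
have P'R : 0 < P'%:R :> R by rewrite ltr0n.
have QR : 0 < Q%:R :> R by rewrite ltr0n.
pose c : R := (Q%:R * r%:R)^-1.
have c0 : 0 < c by rewrite invr_gt0 mulr_gt0.
have e1 : density R Q s r n =
    c * \sum_(y < Q) (coef s (n - P%:Z + y%:Z))%:~R * fejer r (y%:Z - P%:Z).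
  rewrite densityE //; congr (_ * _).
  rewrite (eq_bigr (fun k : nat => fejer r (k%:Z - n) + fejer r (- k%:Z - n))); last first.
    by move=> k _; congr (_ + _); rewrite -fejerN; congr fejer; ring.
  rewrite -(@sum_coef_window (fun z => fejer r (z - n)) (n - P%:Z) Q).
    by apply: eq_bigr => y _; congr (_ * fejer _ _); ring.
  move=> k /win [k1 k2]; split => //; move: k2; rewrite QE; clear; lia.
have e2 : (period_sum n)%:~R / q%:R =
    c * \sum_(y < Q) (coef s (n + ((y%:Z - P%:Z) %% q%:Z)%Z))%:~R * fejer r (y%:Z - P%:Z).
  rewrite (@sum_periodic_shift R Q
    (fun z => (coef s (n + (z %% q%:Z)%Z))%:~R * fejer r z) _ (- P%:Z)); last first.
    by move=> z; rewrite fejerQ // /Q PoszM [q%:Z * _]mulrC [z + _]addrC modzMDl.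
  rewrite (@sum_blocks q P' (fun z => (coef s (n + (z %% q%:Z)%Z))%:~R * fejer r z)).
  rewrite (eq_bigr (fun c : 'I_q => (coef s (n + c%:Z))%:~R * (r * P')%:R)).
    rewrite -mulr_suml /period_sum rmorph_sum /= /c /Q !natrM.
    by field; rewrite !gt_eqF.
  move=> i _; rewrite -(@sum_fejer_class R q P' q_gt0 P'_gt0 r i%:Z rP) mulr_sumr.
  apply: eq_bigr => j _; congr (_%:~R * _); congr (coef s (n + _)).
  by rewrite [q%:Z * _]mulrC addrC modzMDl modz_small //= ltz_nat ltn_ord.
rewrite e1 e2 -mulrBr -sumrB normrM (gtr0_norm c0).
have -> : 2 * Q%:R / (r%:R * H%:R) = c * (2 * Q%:R ^+ 2 * H%:R^-1).
  by rewrite /c; field; rewrite !gt_eqF.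
rewrite ler_wpM2l ?(ltW c0) // (le_trans (ler_norm_sum _ _ _)) //.
have Q2 : 0 <= 2 * Q%:R ^+ 2 :> R by rewrite mulr_ge0 // exprn_ge0.
apply: le_trans (ler_wpM2l Q2 (sum_tail H0 HP)).
rewrite mulr_sumr; apply: ler_sum => y _.
rewrite -mulrBl.
have -> : n - P%:Z + y%:Z = n + (y%:Z - P%:Z) by ring.
have yB : `|y%:Z - P%:Z| <= P%:Z by have : (y < 2 * P)%N by [rewrite -QE]; clear; lia.
set z := y%:Z - P%:Z in yB *.
case: ltP => [Hz|zH]; last first.
  by rewrite -(coef_periodic qH per) // subrr mul0r normr0 mulr0.
rewrite normrM (ger0_norm (fejer_ge0 _ Q_gt0 _ _)).
have fz : fejer r z <= Q%:R ^+ 2 / (2 * `|z|%:~R ^+ 2).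
  have -> : fejer r z = fejer r (absz z)%:Z.
    by case: (z) => // m; rewrite NegzE fejerN.
  rewrite -abszE -pmulrn; apply: fejer_tail => //.
    by move: Hz; clear; lia.
  by rewrite QE leq_mul2l /=; move: yB; clear; lia.
rewrite -mulrA; apply: ler_pM => //; first exact: fejer_ge0.
rewrite -intrB -intr_norm (_ : 2 = 2%:~R) // ler_int.
have := coef_ge0 s (n + z); have := coef_le2 s (n + z).
have := coef_ge0 s (n + (z %% q%:Z)%Z); have := coef_le2 s (n + (z %% q%:Z)%Z).
move: (coef _ _) (coef _ _) => a b; clear; lia.
Qed.

End PeriodicDensity.

(** * Blocks without exceptional coefficients *)

Section FreeBlocks.
Variables (Lam : seq int) (M l : nat).
Hypotheses (l_gt0 : (0 < l)%N) (sizeLam : (size Lam <= M)%N).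

Lemma free_block (u : int) :
  exists2 i : nat, (i <= M)%N &
    forall n, u + (i * l)%N%:Z <= n < u + (i * l)%N%:Z + l%:Z -> n \notin Lam.
Proof.
pose T := [seq ((n - u) %/ l%:Z)%Z | n <- Lam].
have [full|[i ii iT]] : {in iota 0 M.+1, forall i : nat, i%:Z \in T} \/
    exists2 i, i \in iota 0 M.+1 & i%:Z \notin T.
  by case: (boolP (all (fun i : nat => i%:Z \in T) (iota 0 M.+1))) => [/allP|/allPn]; [left|right].
  have : (size (map Posz (iota 0 M.+1)) <= size T)%N.
    apply: uniq_leq_size; first by rewrite map_inj_uniq ?iota_uniq // => a b [].
    by move=> z /mapP[i ii ->]; exact: full.
  by rewrite !size_map size_iota leqNgt ltnS sizeLam.
move: ii; rewrite mem_iota => /andP[_ iM]; exists i => // n nb.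
apply: contra iT => nL; apply/mapP; exists n => //.
have -> : n - u = i%:Z * l%:Z + (n - u - (i * l)%N%:Z) by rewrite PoszM; ring.
rewrite divzMDl; last by rewrite eqz_nat -lt0n.
by rewrite divz_small ?addr0 //; move: nb; rewrite abszE; clear; lia.
Qed.

(** The blocks meeting [Lam] contain at most [M * l] integers, too few to hold all of [s]. *)
Lemma occupied_free_block (s : seq nat) : uniq s -> (M * l < size s)%N ->
  exists2 b : nat,
    (forall n, (b * l)%N%:Z <= n < (b * l)%N%:Z + l%:Z -> n \notin Lam) &
    exists2 k, k \in s & (b * l <= k < b * l + l)%N.
Proof.
move=> us sM; pose T := [seq (n %/ l%:Z)%Z | n <- Lam].
have [full| [k ks kT]] : {in s, forall k, (k %/ l)%N%:Z \in T} \/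
    exists2 k, k \in s & (k %/ l)%N%:Z \notin T.
  by case: (boolP (all (fun k => (k %/ l)%N%:Z \in T) s)) => [/allP|/allPn]; [left|right].
  have : (size (map Posz s) <= size [seq (t * l%:Z + j%:Z : int) | t <- T, j <- iota 0 l])%N.
    apply: uniq_leq_size; first by rewrite map_inj_uniq // => a b [].
    move=> z /mapP[k ks ->]; apply/allpairsP; exists ((k %/ l)%N%:Z, (k %% l)%N).
    split; first exact: full.
      by rewrite mem_iota /= add0n ltn_mod.
    by rewrite /= -PoszM -PoszD -divn_eq.
  rewrite size_allpairs !size_map size_iota leqNgt.
  by rewrite (leq_ltn_trans _ sM) // leq_mul2r sizeLam orbT.
exists (k %/ l)%N; last first.
  exists k => //; rewrite {2 3}(divn_eq k l) leq_addr /= ltn_add2l ltn_mod //.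
move=> n nb; apply: contra kT => nL; apply/mapP; exists n => //.
have -> : n = (k %/ l)%N%:Z * l%:Z + (n - (k %/ l * l)%N%:Z) by rewrite PoszM; ring.
rewrite divzMDl; last by rewrite eqz_nat -lt0n.
by rewrite divz_small ?addr0 //; move: nb; rewrite abszE; clear; lia.
Qed.

End FreeBlocks.

(** * The conflict between the coarse and the fine average *)

Section Contradiction.
Variables (R : realType) (s : seq nat) (q P' P m M H r0 r1 E nfar : nat) (lam : R).
Variable Lam : seq int.
Let Q := (q * P')%N.
Let l := (2 * H).+1.
Hypotheses (s_uniq : uniq s) (q_gt0 : (0 < q)%N) (P'_gt0 : (0 < P')%N).
Hypothesis QE : Q = (2 * P)%N.
Hypothesis LamE : forall n, dcoef s q m.+1 n != 0 -> n \in Lam.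
Hypothesis sizeLam : (size Lam <= M)%N.
Hypothesis block_long : (q * (2 ^ m.+1).+1 <= l)%N.
Hypothesis s_large : (M * l < size s)%N.
Hypothesis s_ltE : forall k, k \in s -> (k < E)%N.
Hypotheses (r0_gt0 : (0 < r0)%N) (r01 : (2 * r0 <= r1)%N) (r1P : (2 * r1 <= P')%N).
Hypotheses (qH : (q <= H)%N) (HQ : (64 * q * Q <= r1 * H)%N).
Hypothesis nfar_lo : (E + l <= nfar)%N.
Hypothesis nfar_hi : (nfar + M.+1 * l + E <= P)%N.
Local Notation V := (vp_density R Q s).
Hypothesis V_close : forall n, `|V r1 n - V r0 n| <= (16 * q%:R)^-1.
Hypothesis V_lip : forall n, `|V r0 (n + 1) - V r0 n| <= lam.
Hypothesis lam_small : lam * (M.+1 * l).+1%:R <= (16 * q%:R)^-1.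
Hypothesis V_far : V r0 nfar%:Z <= (4 * q%:R)^-1.

Let l_gt0 : (0 < l)%N. Proof. by []. Qed.
Let qR : 0 < q%:R :> R. Proof. by rewrite ltr0n. Qed.

Lemma block_diff (u : int) :
  (forall n, u <= n < u + l%:Z -> n \notin Lam) ->
  forall n, u <= n < u + l%:Z -> diff q (coef s) n = 0.
Proof.
move=> free; apply: (@diff_eq0_of_iter q (coef s) q_gt0 m).
- exact: coef_norm_le2.
- by rewrite lerD2l lez_nat.
- move=> n /free nL; apply/eqP; apply: contraNT nL; exact: LamE.
Qed.

Lemma block_density (u : int) : 0 <= u -> u + l%:Z <= (nfar + M.+1 * l)%N%:Z ->
  (forall n, u <= n < u + l%:Z -> n \notin Lam) ->
  `|V r1 (u + H%:Z) - (period_sum s q (u + H%:Z))%:~R / q%:R| <= (16 * q%:R)^-1.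
Proof.
move=> u0 uP free; set n := u + H%:Z.
have r10 : (0 < r1)%N by move: r0_gt0 r01; clear; lia.
have H0 : (0 < H)%N by move: q_gt0 qH; clear; lia.
have r1R : 0 < r1%:R :> R by rewrite ltr0n.
have HR : 0 < H%:R :> R by rewrite ltr0n.
have per j : n - H%:Z <= j <= n + H%:Z -> diff q (coef s) j = 0.
  by move=> jn; apply: (block_diff free); move: jn; rewrite /n /l; clear; lia.
have win k : k \in s -> n - P%:Z <= - k%:Z /\ k%:Z < n + P%:Z.
  by move=> /s_ltE kE; move: kE u0 uP nfar_hi; rewrite /n /l; clear; lia.
have HP : (H <= P)%N by move: nfar_hi; rewrite /l mulSn; clear; lia.
have d1 := @periodic_density R s s_uniq q P' P q_gt0 P'_gt0 QE r1 H n r10 (ltac:(lia)) qH HP win per.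
have d2 := @periodic_density R s s_uniq q P' P q_gt0 P'_gt0 QE (2 * r1) H n (ltac:(lia)) r1P qH HP win per.
have e2 : 2 * Q%:R / ((2 * r1)%:R * H%:R) = Q%:R / (r1%:R * H%:R) :> R.
  by rewrite natrM; field; rewrite !gt_eqF.
(* The error [2 Q / (r1 H)] at [r1] and twice the error [Q / (r1 H)] at [2 r1] add up to the left
   side; [HQ] is tuned to this. *)
have b : 4 * (Q%:R / (r1%:R * H%:R)) <= (16 * q%:R)^-1 :> R.
  have := HQ; rewrite -(ler_nat R) !natrM => h.
  rewrite mulrA ler_pdivrMr ?mulr_gt0 // [leRHS]mulrC ler_pdivlMr ?mulr_gt0 //; lra.
rewrite -/Q e2 in d2; rewrite -/Q in d1.
move: d1 d2; rewrite /vp_density !ler_norml => /andP[a1 a2] /andP[c1 c2].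
by apply/andP; split; lra.
Qed.

Lemma density_contradiction : False.
Proof.
have [b bfree [k ks kb]] := occupied_free_block l_gt0 sizeLam s_uniq s_large.
have kE := s_ltE ks.
pose n1 := (b * l)%N%:Z + H%:Z.
have H0 : (0 < H)%N by move: q_gt0 qH; clear; lia.
have n1far : n1 <= nfar%:Z by rewrite /n1; move: kb kE nfar_lo; rewrite /l; clear; lia.
(* A periodic block containing an element of [s] has [period_sum] at least 1. Passing to the fine
   and then to the coarse average costs [1 / (16 q)] each time. *)
have V1 : 14 / 16 / q%:R <= V r0 n1.
  have bd : (b * l)%N%:Z + l%:Z <= (nfar + M.+1 * l)%N%:Z.
    by move: kb kE nfar_lo; clear; lia.
  have h1 := @block_density (b * l)%N%:Z (le0z_nat _) bd bfree.
  have ps1 : 1 <= period_sum s q n1.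
    have per j : n1 - H%:Z <= j <= n1 + H%:Z -> diff q (coef s) j = 0.
      by move=> jn; apply: (block_diff bfree); move: jn; rewrite /n1 /l; clear; lia.
    have zH : `|k%:Z - n1| <= H%:Z by move: kb; rewrite /n1 /l; clear; lia.
    have := coef_periodic q_gt0 qH per zH; rewrite addrC subrK => cE.
    have := coef_mem ks; rewrite cE => c0.
    have qz : 0 < q%:Z by rewrite ltz_nat.
    have m0 : 0 <= ((k%:Z - n1) %% q%:Z)%Z by rewrite modz_ge0 // gt_eqF.
    have m1 : ((k%:Z - n1) %% q%:Z)%Z < q%:Z by rewrite ltz_pmod.
    move: ((k%:Z - n1) %% q%:Z)%Z c0 m0 m1 {cE} => [c|//] c0 _; rewrite ltz_nat => cq.
    rewrite /period_sum (bigD1 (Ordinal cq)) //=.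
    apply: le_trans (_ : 1 + 0 <= _); first by rewrite addr0.
    by apply: lerD => //; apply: sumr_ge0 => i _; exact: coef_ge0.
  have ps2 : 1 / q%:R <= (period_sum s q n1)%:~R / q%:R :> R.
    by rewrite ler_pM2r ?invr_gt0 // (_ : 1 = 1%:~R) // ler_int.
  have h2 := V_close n1; move: h1 h2; rewrite -/n1 !ler_norml.
  have -> : (16 * q%:R)^-1 = 1 / 16 / q%:R :> R by field; rewrite gt_eqF.
  have -> : 14 / 16 / q%:R = 1 / q%:R - 2 * (1 / 16 / q%:R) :> R by field; rewrite gt_eqF.
  by move=> /andP[a1 a2] /andP[c1 c2]; lra.
(* At the first place after [n1] where the coarse average is at most [1 / (2 q)], its slow variation
   keeps it above [1 / (2 q) - lam]. *)
pose small (d : nat) := V r0 (n1 + d%:Z) <= 1 / 2 / q%:R.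
have u0 : 0 < 1 / 16 / q%:R :> R by rewrite !divr_gt0.
have qE c : c / 16 / q%:R = c * (1 / 16 / q%:R) :> R by field; rewrite gt_eqF.
have hE : 1 / 2 / q%:R = 8 * (1 / 16 / q%:R) :> R by field; rewrite gt_eqF.
have fE : (4 * q%:R)^-1 = 4 * (1 / 16 / q%:R) :> R by field; rewrite gt_eqF.
have lE : (16 * q%:R)^-1 = 1 / 16 / q%:R :> R by field; rewrite gt_eqF.
have ex : exists d, small d.
  exists (absz (nfar%:Z - n1)); rewrite /small.
  have -> : n1 + (absz (nfar%:Z - n1))%:Z = nfar%:Z by move: n1far; clear; lia.
  by apply: le_trans V_far _; rewrite fE hE ler_pM2r // ler_nat.
pose d := ex_minn ex; rewrite qE in V1.
have dsmall : small d by rewrite /d; case: ex_minnP.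
have dmin e : (e < d)%N -> ~~ small e.
  rewrite /d; case: ex_minnP => d' _ mn ed; apply/negP => /mn.
  by rewrite leqNgt ed.
have dfar : n1 + d%:Z <= nfar%:Z.
  have : small (absz (nfar%:Z - n1)).
    rewrite /small; have -> : n1 + (absz (nfar%:Z - n1))%:Z = nfar%:Z by move: n1far; clear; lia.
    by apply: le_trans V_far _; rewrite fE hE ler_pM2r // ler_nat.
  rewrite /d; case: ex_minnP => d' _ mn /mn; move: n1far; clear; lia.
have d0 : (0 < d)%N.
  rewrite lt0n; apply/eqP => dz; move: dsmall; rewrite dz /small addr0 hE.
  by move: V1 u0; lra.
pose n2 := n1 + d%:Z.
have lam0 : 0 <= lam by apply: le_trans (V_lip 0).
have V2 : 8 * (1 / 16 / q%:R) - lam <= V r0 n2 <= 8 * (1 / 16 / q%:R).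
  apply/andP; split; last by move: dsmall; rewrite /small hE.
  have : ~~ small d.-1 by apply: dmin; rewrite prednK.
  rewrite /small hE -ltNge => h.
  have := V_lip (n1 + d.-1%:Z).
  have -> : n1 + d.-1%:Z + 1 = n2 by rewrite /n2; move: d0; clear; lia.
  by rewrite ler_norml => /andP[a1 a2]; move: h a1; lra.
have walk (i : nat) : `|V r0 (n2 + i%:Z) - V r0 n2| <= lam * i%:R.
  elim: i => [|i IH]; first by rewrite addr0 subrr normr0 mulr0.
  have := V_lip (n2 + i%:Z).
  have -> : n2 + i%:Z + 1 = n2 + i.+1%:Z by rewrite -addn1 PoszD addrA.
  move=> h.
  rewrite -natr1 mulrDr mulr1.
  have -> : V r0 (n2 + i.+1%:Z) - V r0 n2 =
    (V r0 (n2 + i%:Z) - V r0 n2) + (V r0 (n2 + i.+1%:Z) - V r0 (n2 + i%:Z)) by ring.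
  by rewrite (le_trans (ler_normD _ _)) // lerD.
have n20 : 0 <= n2 by [].
(* Over the [M.+1] blocks of length [l] after [n2] the coarse average stays within [1 / (16 q)] of
   [1 / (2 q)], and one of these blocks avoids [Lam]. *)
have [i iM ifree] := free_block l_gt0 sizeLam n2.
have il : (i * l + l <= M.+1 * l)%N by rewrite mulSn addnC leq_add2l leq_mul2r iM orbT.
set u := n2 + (i * l)%N%:Z in ifree.
have ub : u + l%:Z <= (nfar + M.+1 * l)%N%:Z.
  by rewrite /u /n2; move: dfar il; clear; lia.
have u00 : 0 <= u by [].
have B := block_density u00 ub ifree.
have C := V_close (u + H%:Z).
have W := walk (i * l + H)%N.
have eW : n2 + (i * l + H)%N%:Z = u + H%:Z by rewrite PoszD addrA.
rewrite eW in W.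
have LW : lam * (i * l + H)%N%:R + lam <= 1 / 16 / q%:R.
  apply: le_trans (_ : lam * (M.+1 * l).+1%:R <= _); last by rewrite -lE.
  rewrite -[X in _ + X <= _]mulr1 -mulrDr ler_wpM2l // natr1 ler_nat.
  by rewrite ltnS; move: il; rewrite /l; clear; lia.
move: (period_sum _ _ _) B => p B.
move: B C W; rewrite lE !ler_norml => /andP[b1 b2] /andP[c1 c2] /andP[w1 w2].
have /andP[v1 v2] := V2.
have pE : p%:~R / q%:R = 16 * p%:~R * (1 / 16 / q%:R) :> R by field; rewrite gt_eqF.
rewrite pE in b1 b2.
set x := 1 / 16 / q%:R in u0 b1 b2 c1 c2 w1 w2 v1 v2 LW *.
(* In units of [x = 1 / (16 q)]: the coarse average is within 1 of 8, the fine one within 1 of the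
   coarse one, and [16 p] within 1 of the fine one. No multiple of 16 lies between 5 and 11. *)
have h1 : 16 * p%:~R * x <= 11 * x by move: lam0 b1 b2 c1 c2 w1 w2 v1 v2 LW; lra.
have h2 : 5 * x <= 16 * p%:~R * x by move: lam0 b1 b2 c1 c2 w1 w2 v1 v2 LW; lra.
rewrite ler_pM2r // in h1; rewrite ler_pM2r // in h2.
have p1 : p < 1.
  by rewrite -(ltr_int R); move: h1; lra.
have p2 : 0 < p.
  by rewrite -(ltr_int R); move: h2; lra.
by move: p1 p2; clear; lia.
Qed.

End Contradiction.

(** * Choice of the scales *)

Lemma sq_le_expn2 (n : nat) : (100 <= n)%N -> (1000 * (n * n) <= 2 ^ n)%N.
Proof.
move=> /subnKC <-; elim: (n - 100)%N => [|k IH].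
  rewrite addn0; have -> : (100 = 10 * 10)%N by [].
  rewrite expnM; apply: leq_trans (_ : 1000 ^ 3 <= _)%N; last first.
    by apply: leq_trans (_ : 1000 ^ 10 <= _)%N; [rewrite leq_exp2l | rewrite leq_exp2r].
  by rewrite expnS leq_mul2l expnS expn1 leq_mul.
rewrite addnS expnS; move: (100 + k)%N (leq_addr k 100) IH => a a100.
by move: (2 ^ a)%N => v; nia.
Qed.

(** * Norms in terms of the parameter [m] *)

Section GridWeights.
Variables (R : realType) (s : seq nat) (zz : seq R) (q m d w : nat).
Let I := (2 ^ (45 * m))%N.
Let s0 := (q * 2 ^ w)%N.
Let Q := (32 * 2 ^ I * s0)%N.
Hypotheses (s_uniq : uniq s) (q_gt0 : (0 < q)%N).
Hypothesis s_ltQ : forall k, k \in s -> (k < Q)%N.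
Hypothesis zz_zeros : forall t : R, - (2 * pi) <= t <= 4 * pi -> cos_sum s t = 0 -> t \in zz.
Hypotheses (zz_0 : 0 \in zz) (zz_2pi : 2 * pi \in zz).
Hypothesis zz_dirichlet : forall z, z \in zz -> exists p : int,
  `|q%:R * z - p%:~R * (2 * pi)| <= 2 * pi / 2 ^+ d.
Hypotheses (d50 : (50 <= d)%N) (q_le : (q <= 2 ^ m)%N) (zz_le : (size zz <= m)%N).
Hypotheses (m100 : (100 <= m)%N) (s_le : (size s <= 2 ^ I)%N).
Local Notation F := (grid_val R Q s).

Let s0_gt0 : (0 < s0)%N. Proof. by rewrite muln_gt0 q_gt0 expn_gt0. Qed.
Let Q_gt0 : (0 < Q)%N. Proof. by rewrite muln_gt0 s0_gt0 andbT muln_gt0 expn_gt0. Qed.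
Let QR : 0 < Q%:R :> R. Proof. by rewrite ltr0n. Qed.

Definition marked : seq int := [seq Num.floor (z * Q%:R / (2 * pi)) | z <- zz].

Let pi2 : 0 < 2 * pi :> R. Proof. by rewrite mulr_gt0 ?pi_gt0. Qed.

Lemma marked_itv (z : R) (w' := Num.floor (z * Q%:R / (2 * pi))) :
  ang R Q w' <= z < ang R Q (w' + 1).
Proof.
have := floor_itv (z * Q%:R / (2 * pi)); rewrite -/w' => /andP[h1 h2].
rewrite /ang; apply/andP; split.
  by rewrite mulrA ler_pdivrMr // -ler_pdivlMr.
by rewrite mulrA ltr_pdivlMr // -ltr_pdivrMr.
Qed.

Lemma marked_zeros (t : R) : - (2 * pi) <= t <= 4 * pi -> cos_sum s t = 0 ->
  exists2 w', w' \in marked & ang R Q w' <= t < ang R Q (w' + 1).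
Proof.
move=> tI t0; exists (Num.floor (t * Q%:R / (2 * pi))); last exact: marked_itv.
by apply: map_f; exact: zz_zeros.
Qed.

(** Marking [0] and [Q] as well keeps the distance to the nearest marked point within [Q / 2], the
    top of the dyadic range, however few zeros there are. *)
Lemma marked_cover (x : int) : 0 <= x < Q%:Z ->
  exists2 w', w' \in marked & `|x - w'| <= (16 * 2 ^ I * s0)%:Z.
Proof.
move=> xQ; have h0 : 0 \in marked.
  by apply/mapP; exists 0 => //; rewrite !mul0r (_ : 0 = 0%:~R :> R) // intrKfloor.
have h1 : Q%:Z \in marked.
  apply/mapP; exists (2 * pi) => //.
  have -> : 2 * pi * Q%:R / (2 * pi) = Q%:Z%:~R :> R.
    by rewrite -pmulrn mulrAC divff ?mul1r // gt_eqF.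
  by rewrite intrKfloor.
have QE : (Q = 2 * (16 * 2 ^ I * s0))%N by rewrite /Q !mulnA.
move: xQ; rewrite QE; move: (16 * 2 ^ I * s0)%N QE => v QE xQ.
have [xv|vx] := leP x v%:Z.
  by exists 0 => //; move: xQ xv; clear; lia.
by exists Q%:Z => //; move: xQ vx; rewrite QE; clear; lia.
Qed.

Lemma pi_lt4 : pi < 4 :> R.
Proof. have := pihalf_lt2 R; lra. Qed.

(** Below the top [m + 52] scales, the distance from the zero, multiplied by [q <= 2 ^ m], moves the
    angle by less than [2 pi / 2 ^ 50]. The approximation error is at most as large, and
    [4 pi < 16]. *)
Lemma weight_small (x : int) (w' : int) (i : nat) : w' \in marked ->
  (i + m + 52 <= I)%N -> `|x - w'| <= (34 * scale s0 i)%:Z ->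
  normc (1 - ez R Q (q%:Z * x)) <= (2 ^+ 46)^-1.
Proof.
move=> /mapP[z zzz ->] iI xw.
have [p pz] := zz_dirichlet zzz.
apply: le_trans (normc_1Bcis_le _ p) _.
have /andP[] := marked_itv z; set w0 := Num.floor _ in xw *.
move=> z1 z2; rewrite /ang in z1 z2 *.
set th := 2 * pi / Q%:R in z1 z2 *.
have th0 : 0 < th by rewrite divr_gt0.
have sc0 : (0 < scale s0 i)%N by rewrite muln_gt0 expn_gt0.
have xz : `|x%:~R * th - z| <= 35 * (scale s0 i)%:R * th.
  have h1 : `|x%:~R * th - w0%:~R * th| <= (34 * scale s0 i)%:R * th.
    by rewrite -mulrBl normrM (gtr0_norm th0) ler_pM2r // -intrB -intr_norm pmulrn ler_int.
  have h2 : `|w0%:~R * th - z| <= (scale s0 i)%:R * th.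
    apply: le_trans (_ : 1 * th <= _); last by rewrite ler_pM2r // (ler_nat R 1).
    rewrite intrD mulrDl in z2; rewrite ler_norml; apply/andP; split; lra.
  have -> : x%:~R * th - z = (x%:~R * th - w0%:~R * th) + (w0%:~R * th - z) by ring.
  apply: le_trans (ler_normD _ _) _; apply: le_trans (lerD h1 h2) _.
  by rewrite natrM; lra.
have -> : (q%:Z * x)%:~R * th - p%:~R * (2 * pi) =
   q%:R * (x%:~R * th - z) + (q%:R * z - p%:~R * (2 * pi)).
  by rewrite intrM -pmulrn; ring.
apply: le_trans (ler_normD _ _) _.
apply: le_trans (lerD (_ : _ <= q%:R * (35 * (scale s0 i)%:R * th)) pz) _.
  by rewrite normrM ger0_norm // ler_wpM2l.
pose u : R := (2 ^+ 50)^-1.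
have u0 : 0 < u by rewrite invr_gt0 exprn_gt0.
have -> : (2 ^+ 46)^-1 = 16 * u :> R by rewrite /u; field.
have ud : (2 ^+ d)^-1 <= u.
  by rewrite /u lef_pV2 ?posrE ?exprn_gt0 // ler_eXn2l // ltr1n.
have I0 : 0 < 2 ^+ I :> R by rewrite exprn_gt0.
have s0R : 0 < s0%:R :> R by rewrite ltr0n.
have e1 : q%:R * (35 * (scale s0 i)%:R * th) = 2 * pi * (35 / 32 * (q%:R * 2 ^+ i / 2 ^+ I)).
  rewrite /th /scale /Q !natrM !natrX; move: (2 * pi) => c; field.
  by rewrite !gt_eqF ?exprn_gt0 ?ltr0n.
have e2 : q%:R * 2 ^+ i / 2 ^+ I <= u / 4.
  rewrite ler_pdivrMr //.
  have h3 : 2 ^+ m * 2 ^+ i * 2 ^+ 52 <= 2 ^+ I :> R.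
    by rewrite -!exprD ler_eXn2l ?ltr1n // [(m + i)%N]addnC.
  have h4 : q%:R * 2 ^+ i <= 2 ^+ m * 2 ^+ i :> R.
    by rewrite ler_wpM2r ?exprn_ge0 // -natrX ler_nat.
  have h5 : 2 ^+ m * 2 ^+ i <= u / 4 * 2 ^+ I.
    have -> : u / 4 = (2 ^+ 52)^-1 by rewrite /u; field.
    by rewrite ler_pdivlMl ?exprn_gt0 // mulrC.
  exact: le_trans h5.
rewrite e1 -mulrDr.
have p4 := pi_lt4.
apply: le_trans (_ : 2 * pi * (2 * u) <= _); last first.
  by have := ltr_pM2r u0 pi 4; rewrite p4 => h; lra.
rewrite ler_pM2l //; lra.
Qed.

Lemma weight_le x : 0 <= normc (1 - ez R Q x) ^+ m <= 2 ^+ m.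
Proof.
rewrite exprn_ge0 ?normc_ge0 //= lerXn2r ?nnegrE ?normc_ge0 //.
exact: normc_1Bcis_le2.
Qed.

(** There are [2 ^ (45 m) + 1] scales. On all but the top [m + 52] the weight is at most
    [2 ^ - (46 m)], so these add up to at most 1; the others and the points next to the zeros get
    the trivial weight [2 ^ m]. *)
Lemma shifted_sum_bound :
  \sum_(x < Q) `|F x%:Z| * normc (1 - ez R Q (q%:Z * x%:Z)) ^+ m <= Q%:R * 2 ^+ (2 * m).
Proof.
pose B (i : nat) : R := if (i + m + 52 <= I)%N then (2 ^+ (46 * m))^-1 else 2 ^+ m.
have big := sq_le_expn2 m100.
have mI : (m + 52 <= I)%N.
  rewrite /I; apply: leq_trans (_ : 2 ^ m <= _)%N; last by rewrite leq_pexp2l // leq_pmull.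
  by move: big m100; clear; move: (2 ^ m)%N => v; nia.
have B0 i : 0 <= B i.
  by rewrite /B; case: ifP => _; rewrite ?invr_ge0 ?exprn_ge0.
have := @weighted_sum_bound R s I s0 marked s0_gt0 s_uniq s_ltQ marked_zeros marked_cover
  (fun x => normc (1 - ez R Q (q%:Z * x)) ^+ m) (2 ^+ m) B (fun x => weight_le _).
move=> /(_ _ B0) h; apply: le_trans (h _) _ => {h}.
  move=> x w' i w's iI xw; rewrite /B; case: ifP => [iI'|_].
    rewrite exprM -exprVn; apply: lerXn2r; rewrite ?nnegrE ?normc_ge0 ?invr_ge0 ?exprn_ge0 //.
    exact: (weight_small w's iI' xw).
  by have /andP[] := weight_le (q%:Z * x).
have sumB : \sum_(i < I.+1) B i <= 1 + (m + 52)%:R * 2 ^+ m.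
  rewrite -(big_mkord xpredT B) (@big_cat_nat _ _ _ (I.+1 - (m + 52))) //= ?leq_subr //.
  apply: lerD.
    apply: le_trans (_ : \sum_(0 <= i < I.+1 - (m + 52)) (2 ^+ (46 * m))^-1 <= _).
      rewrite !big_nat; apply: ler_sum => i /andP[_ ii].
      rewrite /B ifT //; move: ii mI; clear; lia.
    rewrite sumr_const_nat subn0 -[leLHS]mulr_natr mulrC ler_pdivrMr ?exprn_gt0 // mul1r.
    apply: le_trans (_ : (2 * I)%:R <= _).
      by rewrite ler_nat; move: mI m100; clear; lia.
    rewrite -natrX ler_nat /I -expnS leq_pexp2l //; move: m100; clear; lia.
  apply: le_trans (_ : \sum_(I.+1 - (m + 52) <= i < I.+1) 2 ^+ m <= _).
    apply: ler_sum => i _; rewrite /B; case: ifP => // _.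
    apply: le_trans (_ : 1 <= _); last by rewrite exprn_ege1 // ler1n.
    by rewrite invf_le1 ?exprn_gt0 // exprn_ege1 // ler1n.
  rewrite sumr_const_nat -[leLHS]mulr_natl ler_wpM2r ?exprn_ge0 // ler_nat.
  by move: mI; clear; lia.
have near : (32 * s0 * size s)%:R * 2 ^+ m <= Q%:R * 2 ^+ m :> R.
  by rewrite ler_wpM2r ?exprn_ge0 // ler_nat /Q mulnAC leq_mul2r leq_mul2l s_le !orbT.
have -> : \sum_(i < I.+1) (68 * Q)%:R * B i = 68 * Q%:R * \sum_(i < I.+1) B i.
  by rewrite -mulr_sumr natrM.
apply: le_trans (_ : m%:R * (Q%:R * 2 ^+ m + 68 * Q%:R * (1 + (m + 52)%:R * 2 ^+ m)) <= _).
  apply: ler_pM => //.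
  - by rewrite addr_ge0 ?mulr_ge0 ?exprn_ge0 ?sumr_ge0.
  - by rewrite ler_nat size_map.
  - by rewrite lerD // ler_wpM2l // mulr_ge0 // ltW.
have -> : m%:R * (Q%:R * 2 ^+ m + 68 * Q%:R * (1 + (m + 52)%:R * 2 ^+ m)) =
  Q%:R * (m * (2 ^ m + 68 * (1 + (m + 52) * 2 ^ m)))%N%:R :> R.
  by rewrite !(natrM, natrD, natrX); ring.
rewrite ler_wpM2l ?(ltW QR) // -natrX ler_nat mul2n -addnn expnD.
move: (2 ^ m)%N big m100 => v; clear => big m100.
apply: leq_trans (_ : 1000 * (m * m) * v <= _)%N; last by rewrite leq_mul2r big orbT.
have v1 : (1 <= v)%N by move: big m100; nia.
rewrite -mulnA -mulnA mulnCA leq_mul2l; apply/orP; right.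
move: v1 m100; clear; nia.
Qed.

(** Without damping every scale counts fully, which costs the factor [2 ^ (45 m)]. This crude bound
    is enough for the Lipschitz constant of the coarse average. *)
Lemma l1_bound : \sum_(x < Q) `|F x%:Z| <= Q%:R * 2 ^+ (47 * m).
Proof.
have big := sq_le_expn2 m100.
have := @weighted_sum_bound R s I s0 marked s0_gt0 s_uniq s_ltQ marked_zeros marked_cover
  (fun=> 1) 1 (fun=> 1).
have h01 (x : int) : 0 <= (1 : R) <= 1 by rewrite ler01 lexx.
move=> /(_ h01 (fun _ _ _ _ _ _ => lexx 1) (fun=> ler01)).
under eq_bigr do rewrite mulr1.
move=> h; apply: le_trans h _.
rewrite sumr_const card_ord !mulr1.
apply: le_trans (_ : m%:R * (Q%:R + 68 * Q%:R * I.+1%:R) <= _).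
  apply: ler_pM => //; first by rewrite size_map ler_nat.
  apply: lerD; last by rewrite -[leLHS]mulr_natr natrM.
  by rewrite ler_nat /Q mulnAC leq_mul2r leq_mul2l s_le !orbT.
have -> : m%:R * (Q%:R + 68 * Q%:R * I.+1%:R) = Q%:R * (m * (1 + 68 * I.+1))%N%:R :> R.
  by rewrite !(natrM, natrD); ring.
rewrite ler_wpM2l ?(ltW QR) // -natrX ler_nat.
have -> : (2 ^ (47 * m) = I * 2 ^ m * 2 ^ m)%N.
  by rewrite /I -!expnD; congr (2 ^ _)%N; clear; lia.
have I1 : (1 <= I)%N by rewrite expn_gt0.
move: (2 ^ m)%N I big m100 I1 => v J big m100' J1.
have vm : (137 * m <= v * v)%N by move: big m100'; clear; nia.
rewrite -mulnA; apply: leq_trans (_ : J * (137 * m) <= _)%N; last by rewrite leq_mul2l vm orbT.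
by move: J1; clear; nia.
Qed.

End GridWeights.

(** With [rho = 2 ^ j], the base contributes [5 j] to the iterated exponent and the power [rho ^ 6]
    another [6 j]; then [11 j = 22 m + 55 <= 23 m]. *)
Lemma cd_threshold_le (m : nat) (rho := (2 ^ (2 * m + 5))%N) : (100 <= m)%N ->
  (cd_base rho ^ (rho ^ 2 * rho ^ 4) <= 2 ^ (2 ^ (23 * m)))%N.
Proof.
move=> m100; set j := (2 * m + 5)%N in rho *.
have j100 : (100 <= j)%N by rewrite /j; lia.
have big := sq_le_expn2 j100.
have base : (cd_base rho <= 2 ^ (2 ^ (5 * j)))%N.
  have h1 : (((rho ^ 2) ^ 2).+1 <= 2 ^ (4 * j + 1))%N.
    have -> : ((rho ^ 2) ^ 2 = 2 ^ (4 * j))%N.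
      by rewrite /rho -!expnM; congr (2 ^ _)%N; lia.
    by rewrite addn1 expnS mul2n -addnn -addn1 leq_add2l expn_gt0.
  rewrite /cd_base; apply: leq_trans (_ : 2 * rho ^ 2 * (2 ^ (4 * j + 1)) ^ (rho ^ 4) <= _)%N.
    by rewrite leq_mul2l leq_exp2r ?h1 ?orbT // expn_gt0 expn_gt0.
  rewrite /rho -!expnM -{1}[2%N]expn1 -!expnD leq_pexp2l //.
  have -> : (5 * j = j * 4 + j)%N by lia.
  rewrite expnD; set v := (2 ^ (j * 4))%N.
  have v1 : (1 <= v)%N by rewrite expn_gt0.
  have key (a x y : nat) : (100 <= a)%N -> (1 <= x)%N -> (1000 * (a * a) <= y)%N ->
      (1 + a * 2 + (4 * a + 1) * x <= x * y)%N.
    move=> a100 x1 ay; have h : (6 * a + 2 <= y)%N by move: a100 ay; clear; nia.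
    by apply: leq_trans (_ : x * (6 * a + 2) <= _)%N; [move: x1; clear; nia|rewrite leq_mul2l h orbT].
  exact: key.
rewrite -expnD; apply: leq_trans (_ : (2 ^ (2 ^ (5 * j))) ^ (rho ^ (2 + 4)) <= _)%N.
  by rewrite leq_exp2r // expn_gt0 expn_gt0.
rewrite -expnM leq_pexp2l // /rho -expnM -expnD leq_pexp2l //.
by rewrite /j; lia.
Qed.

(** Each element spoils at most one index. The index spoiled by the head is dropped and the others
    are renumbered for the induction. *)
Lemma pigeonhole_pred (T : eqType) (zs : seq T) (p : nat -> pred T) :
  (forall i j z, p i z -> p j z -> i = j) ->
  exists2 k : nat, (k <= size zs)%N & forall z, z \in zs -> ~~ p k z.
Proof.
elim: zs p => [|z zs IH] p disj; first by exists 0%N.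
have [[k kz]|no] := pselect (exists k, p k z); last first.
  have [k ks kzs] := IH p disj; exists k; first exact: leqW.
  move=> y; rewrite inE => /orP[/eqP ->|]; last exact: kzs.
  by apply/negP => pk; apply: no; exists k.
have disj' i j y : p (if (i < k)%N then i else i.+1) y ->
    p (if (j < k)%N then j else j.+1) y -> i = j.
  by move=> h1 h2; have := disj _ _ _ h1 h2; do 2!case: ifP; lia.
have [i iz izs] := IH (fun i => p (if (i < k)%N then i else i.+1)) disj'.
exists (if (i < k)%N then i else i.+1) => /=.
  by case: ifP => // _; rewrite ?(leqW iz).
move=> y; rewrite inE => /orP[/eqP ->|/izs //].
apply/negP => pi; have := disj _ _ _ pi kz; case: ifP; lia.
Qed.

(** * Zero-free ranges of scales and places of low density *)

Section Selection.
Variables (R : realType) (s : seq nat) (Q : nat).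
Hypotheses (Q_gt0 : (0 < Q)%N) (s_uniq : uniq s).
Hypothesis s_ltQ : forall k, k \in s -> (k < Q)%N.
Local Notation F := (grid_val R Q s).

Lemma sum_telescope_blocks (g : nat -> R) (u : nat -> nat) (n : nat) :
  {homo u : i j / (i <= j)%N} ->
  \sum_(j < n) \sum_(u j <= x < u j.+1) g x = \sum_(u 0%N <= x < u n) g x.
Proof.
move=> um; elim: n => [|n IH]; first by rewrite big_ord0 big_geq.
by rewrite big_ord_recr /= IH -big_cat_nat ?um.
Qed.

Lemma small_block (g : nat -> R) (u : nat -> nat) (n : nat) (B : R) :
  {homo u : i j / (i <= j)%N} -> (0 < n)%N ->
  \sum_(u 0%N <= x < u n) g x <= B ->
  exists2 j : nat, (j < n)%N & n%:R * \sum_(u j <= x < u j.+1) g x <= B.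
Proof.
move=> um n0 gB; have [/existsP[j hj]|/existsPn no] :=
  boolP [exists j : 'I_n, n%:R * \sum_(u j <= x < u j.+1) g x <= B]; first by exists j.
have nR : 0 < n%:R :> R by rewrite ltr0n.
have : \sum_(j < n) B < n%:R * \sum_(j < n) \sum_(u j <= x < u j.+1) g x.
  rewrite mulr_sumr; apply: ltr_sum; last by move=> i _; rewrite ltNge; exact: no.
  by apply/hasP; exists (Ordinal n0); rewrite ?mem_index_enum.
rewrite sum_telescope_blocks // sumr_const card_ord -[ltLHS]mulr_natl ltr_pM2l //.
by rewrite ltNge gB.
Qed.

(** One of [(size zs).+1] disjoint ranges of [W] octaves contains no zero. It loses one octave at
    each end to the transitions of the plateaus; the rest splits into [n] blocks of [w.+1] octaves,
    one of which has at most the average share. *)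
Lemma exists_small_annulus (zs : seq R) (T B0 n w : nat) :
  (forall t : R, 0 <= t <= 2 * pi -> cos_sum s t = 0 -> t \in zs) ->
  (0 < n)%N -> (2 ^ T <= Q)%N ->
  (B0 + (size zs).+1 * (n * w.+1 + 2) <= T)%N ->
  exists b : nat, [/\ (B0 <= b)%N, (b + w.+1 <= B0 + (size zs).+1 * (n * w.+1 + 2))%N &
    n%:R * \sum_(2 ^ b <= x < 2 ^ (b + w.+1)) `|F x%:Z| <= 3 / 2 * Q%:R].
Proof.
move=> zsP n0 TQ; set W := (n * w.+1 + 2)%N => BT.
have QR : 0 < Q%:R :> R by rewrite ltr0n.
pose e k := (B0 + k * W)%N.
have W0 : (0 < W)%N by rewrite /W addn2.
have eS k : e k.+1 = (e k + W)%N by rewrite /e mulSn [(W + _)%N]addnC addnA.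
have le_ang i j : (ang R Q i <= ang R Q j) = (i <= j).
  by rewrite /ang ler_pM2r ?ler_int // divr_gt0 ?mulr_gt0 ?pi_gt0.
have lt_ang i j : (ang R Q i < ang R Q j) = (i < j) by rewrite !ltNge le_ang.
pose p k (z : R) := (ang R Q (2 ^ e k)%N%:Z <= z < ang R Q (2 ^ e k.+1)%N%:Z).
have [|k kK kfree] := @pigeonhole_pred _ zs p.
  have mono i j : (i < j)%N -> (2 ^ e i.+1 <= 2 ^ e j)%N.
    by move=> ij; rewrite leq_pexp2l // /e leq_add2l leq_mul2r ij orbT.
  have key i j z : p i z -> p j z -> ~ (i < j)%N.
    move=> /andP[_ h1] /andP[h2 _] /mono ij.
    by have := le_lt_trans h2 h1; rewrite lt_ang ltz_nat ltnNge ij.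
  move=> i j z pi pj; have [ij|ij|//] := ltngtP i j.
    by case: (key _ _ _ pi pj ij).
  by case: (key _ _ _ pj pi ij).
have ekT : (e k + W <= B0 + (size zs).+1 * W)%N.
  by rewrite -eS /e leq_add2l leq_mul2r ltnS kK orbT.
pose r0 := (2 ^ e k)%N; pose r1 := (2 ^ ((e k).+1 + n * w.+1))%N.
have r00 : (0 < r0)%N by rewrite expn_gt0.
have r1E : (2 * r1 = 2 ^ (e k + W))%N.
  by rewrite /r1 -expnS /W; congr (2 ^ _)%N; lia.
have r01 : (2 * r0 <= r1)%N by rewrite /r0 /r1 -expnS leq_pexp2l // leq_addr.
have r1Q : (2 * r1 <= Q)%N.
  by rewrite r1E (leq_trans _ TQ) // leq_pexp2l // (leq_trans ekT).
have r12 : (0 < 2 * r1)%N by rewrite r1E expn_gt0.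
have sgn : (forall t, ang R Q r0%:Z <= t <= ang R Q ((2 * r1)%N%:Z - 1) -> cos_sum s t != 0).
  move=> t /andP[t1 t2]; apply/eqP => t0.
  have t3 : t < ang R Q (2 * r1)%N%:Z by apply: le_lt_trans t2 _; rewrite lt_ang; lia.
  have tz : t \in zs.
    apply: zsP t0; apply/andP; split.
      by apply: le_trans t1; rewrite /ang mulr_ge0 // divr_ge0 ?mulr_ge0 ?pi_ge0.
    apply: le_trans (ltW t3) _.
    have -> : 2 * pi = ang R Q Q%:Z.
      by rewrite /ang -pmulrn mulrCA divff ?mulr1 // gt_eqF.
    by rewrite le_ang lez_nat.
  by have := kfree _ tz; rewrite /p t1 eS -r1E t3.
have := @annulus_bound R Q s Q_gt0 s_uniq s_ltQ r0 r1 r00 r01 r1Q.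
have inI x : (r0 <= x < 2 * r1)%N -> ang R Q r0%:Z <= ang R Q x%:Z <= ang R Q ((2 * r1)%N%:Z - 1).
  by move=> /andP[h1 h2]; rewrite !le_ang; move: h1 h2; clear; lia.
have sg2 : (forall x, (r0 <= x < 2 * r1)%N -> 0 <= F x%:Z) \/
  (forall x, (r0 <= x < 2 * r1)%N -> F x%:Z <= 0).
  have [h|h] := zero_free_sign (@continuous_cos_sum R s) sgn; [left|right] => x /inI; exact: h.
move=> /(_ sg2) total.
pose u j := (2 ^ ((e k).+1 + j * w.+1))%N.
have um : {homo u : i j / (i <= j)%N}.
  by move=> i j ij; rewrite leq_pexp2l // leq_add2l leq_mul2r ij orbT.
have [|j jn hj] := @small_block (fun x => `|F x%:Z|) u n (3 / 2 * Q%:R) um n0.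
  apply: le_trans total; rewrite le_eqVlt; apply/orP; left; apply/eqP.
  by rewrite /u /r0 -expnS mul0n addn0.
exists ((e k).+1 + j * w.+1)%N; split.
- by rewrite /e addSn leqW // -addnA leq_addr.
- apply: leq_trans ekT; rewrite /W.
  have : (j.+1 * w.+1 <= n * w.+1)%N by rewrite leq_mul2r jn orbT.
  by rewrite mulSn; clear; lia.
- apply: le_trans hj; rewrite le_eqVlt; apply/orP; left; apply/eqP.
  by rewrite /u mulSn [(w.+1 + _)%N]addnC addnA.
Qed.

Lemma exists_small_density (r lo L : nat) : (0 < r)%N -> (r <= Q)%N -> (0 < L)%N ->
  (lo + L <= Q)%N ->
  exists2 n : nat, (lo <= n < lo + L)%N &
    L%:R * density R Q s r n%:Z <= 2 * (size s)%:R.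
Proof.
move=> r0 rQ L0 loQ.
have [| | |j jL hj] := @small_block (fun x => density R Q s r x%:Z) (fun j => lo + j)%N L
    (2 * (size s)%:R).
- by move=> i j ij; rewrite leq_add2l.
- by [].
- rewrite -(@sum_density R Q s Q_gt0 r r0 rQ) addn0.
  rewrite -[leRHS](big_mkord xpredT (fun n => density R Q s r n%:Z)).
  apply: ler_sum_sub => //; first exact: iota_uniq.
    by move=> x; rewrite !mem_index_iota => /andP[_ h]; rewrite /= (leq_trans h).
  by move=> x; exact: density_ge0.
exists (lo + j)%N; first by rewrite leq_addr ltn_add2l.
by move: hj; rewrite addnS big_nat1.
Qed.

End Selection.

(** * Fixing all parameters *)

Section Assembly.
Variable R : realType.

(** Zeros from three periods are approximated, since the zero-free intervals near the ends of
    [[0, 2 pi]] reach beyond it. With [0] and [2 pi] these are [3 size zs + 2] points, whence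
    [q <= 2 ^ (d (3 size zs + 2))]. *)
Lemma marked_zeros_approx (s : seq nat) (zs : seq R) (d m : nat) :
  (forall t : R, 0 <= t <= 2 * pi -> cos_sum s t = 0 -> t \in zs) ->
  (d * (3 * size zs + 2) <= m)%N -> (0 < d)%N ->
  exists zz : seq R, exists q : nat,
    [/\ (forall t : R, - (2 * pi) <= t <= 4 * pi -> cos_sum s t = 0 -> t \in zz),
      0 \in zz /\ 2 * pi \in zz, (size zz <= m)%N,
      (0 < q)%N /\ (q <= 2 ^ m)%N &
      forall z, z \in zz -> exists p : int,
        `|q%:R * z - p%:~R * (2 * pi)| <= 2 * pi / 2 ^+ d].
Proof.
move=> zsP dm d0; have p0 := pi_gt0 R.
pose zz := 0 :: 2 * pi :: zs ++ [seq z - 2 * pi | z <- zs] ++ [seq z + 2 * pi | z <- zs].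
have szz : size zz = (3 * size zs + 2)%N.
  by rewrite /zz /= !size_cat !size_map; lia.
have [q [q0 qD qz]] := @dirichlet_approx R [seq z / (2 * pi) | z <- zz] (2 ^ d)
  (ltac:(by rewrite expn_gt0)).
exists zz, q; split.
- move=> t /andP[t1 t2] t0.
  have per (p : int) : cos_sum s (t + p%:~R * (2 * pi)) = 0 by rewrite cos_sumD2pi.
  have [tn|tp] := ltP t 0.
    have : t + 2 * pi \in zs.
      apply: zsP; last by rewrite -[2 * pi]mul1r (per 1).
      by apply/andP; split; lra.
    move=> tz; rewrite !inE !mem_cat; apply/or3P/Or33/orP; right; apply/orP; left.
    by apply/mapP; exists (t + 2 * pi); rewrite ?addrK.
  have [tl|tg] := leP t (2 * pi).
    have tz : t \in zs by apply: zsP => //; rewrite tp tl.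
    by rewrite !inE !mem_cat tz !orbT.
  have : t - 2 * pi \in zs.
    apply: zsP; last by rewrite -[2 * pi]mul1r -mulNr (per (-1)).
    by apply/andP; split; lra.
  move=> tz; rewrite !inE !mem_cat; apply/or3P/Or33/orP; right; apply/orP; right.
  by apply/mapP; exists (t - 2 * pi); rewrite ?subrK.
- by rewrite !inE !eqxx orbT.
- by rewrite szz (leq_trans _ dm) // leq_pmull.
- split=> //; apply: leq_trans qD _; rewrite size_map szz -expnM leq_pexp2l //.
- move=> z zzz; have [p hp] := qz _ (map_f _ zzz); exists p.
  have pi2 : 0 < 2 * pi :> R by rewrite mulr_gt0.
  have -> : q%:R * z - p%:~R * (2 * pi) = (q%:R * (z / (2 * pi)) - p%:~R) * (2 * pi).
    by rewrite mulrBl -!mulrA [_^-1 * _]mulVf ?mulr1 // gt_eqF.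
  rewrite normrM (gtr0_norm pi2) [leRHS]mulrC ler_pM2r //.
  by move: hp; rewrite natrX.
Qed.

(* The left side is the exponent bounding [M * l] in [density_contradiction]. *)
Lemma scales_fit (m K : nat) : (100 <= m)%N -> (K < m)%N ->
  (2 ^ (23 * m) + 8 + 2 * m +
    (m + K.+1 * (2 ^ (m + 7) * (2 ^ (23 * m) + 49 * m + 20).+1 + 2)) < 2 ^ (40 * m))%N.
Proof.
move=> m100 Km; have big := sq_le_expn2 m100.
apply: leq_trans (_ : 2 ^ (25 * m) <= _)%N; last by rewrite leq_pexp2l //; lia.
have -> : (2 ^ (25 * m) = 2 ^ (23 * m) * (2 ^ m * 2 ^ m))%N.
  by rewrite -!expnD; congr (2 ^ _)%N; lia.
have -> : (2 ^ (m + 7) = 128 * 2 ^ m)%N by rewrite expnD mulnC.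
have : (2 ^ m <= 2 ^ (23 * m))%N by rewrite leq_pexp2l // leq_pmull.
move: (2 ^ (23 * m))%N (2 ^ m)%N big => y v big vy.
have h1 : (49 * m + 21 <= y)%N by move: big vy m100; clear; nia.
have v1 : (1 <= v)%N by move: big m100; clear; nia.
have y1 : (1 <= y)%N by exact: leq_trans vy.
have h2 : (128 * v * (y + 49 * m + 20).+1 + 2 <= 258 * (v * y))%N.
  have vy1 : (1 <= v * y)%N by rewrite muln_gt0 v1 y1.
  have : (128 * v * (y + 49 * m + 20).+1 <= 128 * v * (2 * y))%N.
    by rewrite leq_mul2l; apply/orP; right; move: h1; clear; lia.
  by move: vy1; clear; nia.
have h3 : (K.+1 * (128 * v * (y + 49 * m + 20).+1 + 2) <= m * (258 * (v * y)))%N.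
  exact: leq_mul.
have h4 : (y + 8 + 2 * m + m < 12 * m * (v * y))%N.
  have : (m <= m * (v * y))%N by rewrite leq_pmulr // muln_gt0 v1 y1.
  have : (y <= v * y)%N by rewrite leq_pmull.
  have : (v * y <= m * (v * y))%N by rewrite leq_pmull //; move: m100; clear; lia.
  by move: m100; clear; lia.
have h5 : (270 * m * (v * y) <= y * (v * v))%N.
  have h6 : (270 * m <= v)%N by move: big m100; clear; nia.
  by rewrite (mulnC y) -(mulnA v v y) leq_mul2r h6 orbT.
by move: h3 h4 h5; clear; lia.
Qed.

(** The lower bound on [size s] makes [s] larger than all blocks meeting [Lam] together; the upper
    one makes the trivial bound affordable at the finest scale. *)
Lemma few_zeros_contradiction (s : seq nat) (zs : seq R) (d m : nat) : uniq s ->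
  (forall t : R, 0 <= t <= 2 * pi -> cos_sum s t = 0 -> t \in zs) ->
  (50 <= d)%N -> (100 <= m)%N -> (d * (3 * size zs + 2) <= m)%N ->
  (2 ^ (2 ^ (40 * m)) <= size s)%N -> (size s <= 2 ^ (2 ^ (45 * m)))%N -> False.
Proof.
move=> us zsP d50 m100 dm sLo sHi.
have d0 : (0 < d)%N by exact: leq_trans d50.
have [zz [q [zzP [zz0 zz2] zzm [q0 qm] zzD]]] := marked_zeros_approx zsP dm d0.
have Km : (size zs < m)%N by move: dm d0; clear; nia.
have m0 : (0 < m)%N by exact: leq_trans m100.
have [Lam uL LamE] := dcoef_support s q m.
(* Chosen so that [rho / 16] is twice the bound [2 ^ (2 m)] for the weighted norm. *)
pose rho := (2 ^ (2 * m + 5))%N.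
have rho0 : (0 < rho)%N by rewrite expn_gt0.
pose mu := (2 ^ (23 * m))%N.
(* The alternative is settled before [Q] is chosen, because [Q] depends on [Q0]. *)
have [Q0 Q0P] : exists Q0 : nat, (size Lam <= 2 ^ mu)%N \/
    forall Q : nat, (0 < Q)%N -> (Q0 <= Q)%N ->
    rho%:R / 16 * Q%:R <= \sum_(x < Q) `|grid_val R Q s x%:Z| *
      normc (1 - ez R Q (q%:Z * x%:Z)) ^+ m.
  have [h|h] := leqP (cd_base rho ^ (rho ^ 2 * rho ^ 4)) (size Lam).
    by have [Q0 Q0P] := @support_bound R s q m rho Lam us rho0 uL LamE h; exists Q0; right.
  exists 0%N; left; apply: leq_trans (ltnW h) _; exact: cd_threshold_le.
(* The scales [2 ^ b < 2 ^ (b + w)] must be so far apart that the coarse average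
   is almost constant over [2 ^ mu] blocks of length [l]; there are [n] candidate
   pairs of scales in each of [K.+1] disjoint ranges, and [U] bounds the
   resulting [c], hence [l]. *)
pose I := (2 ^ (45 * m))%N.
pose K := size zs.
pose w := (mu + 49 * m + 20)%N.
pose n := (2 ^ (m + 7))%N.
pose W := (n * w.+1 + 2)%N.
pose U := (m + K.+1 * W)%N.
pose Lmax := (2 * (64 * q ^ 2 * 2 ^ U)).+1.
pose E := (\max_(k <- s) k).+1.
have sE k : k \in s -> (k < E)%N by move=> ks; rewrite ltnS; exact: leq_bigmax_seq.
(* The sum of all quantities that must be negligible against the grid; [w' < 2 ^ w'] then yields
   [w' < P]. *)
pose w' := (Q0 + 2 * E + 16 * q * size s + (2 ^ mu + 2) * Lmax + U)%N.
pose T := (5 + I + w')%N.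
pose Q := (q * 2 ^ T)%N.
pose P := (q * 2 ^ (4 + I + w'))%N.
have QE : (32 * 2 ^ I * (q * 2 ^ w') = Q)%N.
  by rewrite /Q /T !expnD -[(2 ^ 5)%N]/32%N !mulnA [(_ * q)%N]mulnC !mulnA.
have QP : Q = (2 * P)%N by rewrite /Q /P /T [RHS]mulnCA -expnS.
have w'P : (w' < P)%N.
  apply: leq_trans (ltn_expl w' (isT : (1 < 2)%N)) _.
  apply: leq_trans (_ : 2 ^ (4 + I + w') <= _)%N; last by rewrite leq_pmull.
  by rewrite leq_pexp2l // leq_addl.
have EP : (E <= P)%N by move: w'P; rewrite /w'; clear; lia.
have sQ k : k \in s -> (k < Q)%N.
  by move=> /sE h; rewrite QP; move: h EP; clear; lia.
have Q_gt0 : (0 < Q)%N by rewrite muln_gt0 q0 expn_gt0.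
have QR : 0 < Q%:R :> R by rewrite ltr0n.
have qR : 0 < q%:R :> R by rewrite ltr0n.
have L1 : \sum_(x < Q) `|grid_val R Q s x%:Z| <= Q%:R * 2 ^+ (47 * m).
  have := @l1_bound R s zz q m w' us q0; rewrite QE => h; exact: h.
have sizeLam : (size Lam <= 2 ^ mu)%N.
  case: Q0P => // /(_ Q Q_gt0) h.
  have := @shifted_sum_bound R s zz q m d w' us q0; rewrite QE.
  move=> /(_ sQ zzP zz0 zz2 zzD d50 qm zzm m100 sHi) h2.
  have {h}h : rho%:R / 16 * Q%:R <= Q%:R * 2 ^+ (2 * m) :> R.
    apply: le_trans h2; apply: h; move: w'P; rewrite QP /w'; clear; lia.
  move: h; rewrite mulrC ler_pM2l // /rho natrX exprD.
  have : 0 < 2 ^+ (2 * m) :> R by rewrite exprn_gt0.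
  lra.
have BT : (T - U + K.+1 * W + m = T)%N.
  have : (U <= T)%N by rewrite /T /w'; clear; lia.
  by rewrite /U; move: (K.+1 * W)%N (T) => v t; clear; lia.
have n0 : (0 < n)%N by rewrite expn_gt0.
have TQ : (2 ^ T <= Q)%N by rewrite /Q leq_pmull.
(* The ranges of scales fill the octaves from [T - U] to [T - m], which leads to [m <= c <= U]
   below. *)
have [|b [bB bT bsum]] := @exists_small_annulus R s Q Q_gt0 us sQ zs T (T - U) n w zsP n0 TQ.
  by rewrite -/K -/W; move: BT; clear; lia.
rewrite -/K -/W in bT.
pose r0 := (2 ^ b)%N; pose r1 := (2 ^ (b + w))%N.
pose c := (T - (b + w))%N.
have cT : (b + w + c = T)%N by rewrite /c; move: bT BT; clear; lia.
have mc : (m <= c)%N by move: bT BT cT; clear; lia.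
have cU : (c <= U)%N by move: bB cT; clear; lia.
(* As [Q / r1 = q 2 ^ c], this is exactly [64 q Q / r1]. *)
pose H := (64 * q ^ 2 * 2 ^ c)%N.
pose l := (2 * H).+1.
have lmax : (l <= Lmax)%N by rewrite ltnS leq_mul2l leq_mul2l leq_pexp2l // !orbT.
have r00 : (0 < r0)%N by rewrite expn_gt0.
have w0 : (0 < w)%N by rewrite /w addn_gt0 orbT.
have r01 : (2 * r0 <= r1)%N.
  by rewrite /r0 /r1 -expnS leq_pexp2l // -addn1 leq_add2l.
have r12E : (2 * r1 = 2 ^ (b + w.+1))%N by rewrite /r1 -expnS addnS.
have r1P : (2 * r1 <= 2 ^ T)%N.
  by rewrite r12E leq_pexp2l // addnS -cT -addn1 leq_add2l (leq_trans m0).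
have lpow : (l.+1 <= 2 ^ (8 + 2 * m + c))%N.
  have q2 : (q ^ 2 <= 2 ^ (2 * m))%N by rewrite mulnC expnM leq_exp2r.
  have h1 : (1 <= q ^ 2 * 2 ^ c)%N by rewrite muln_gt0 !expn_gt0 q0.
  have : (q ^ 2 * 2 ^ c <= 2 ^ (2 * m) * 2 ^ c)%N by rewrite leq_mul2r q2 orbT.
  rewrite /l /H !expnD -[(2 ^ 8)%N]/256%N -!mulnA.
  by move: (q ^ 2 * 2 ^ c)%N (2 ^ (2 * m) * 2 ^ c)%N h1 => x y; clear; lia.
have r0R : 0 < r0%:R :> R by rewrite ltr0n.
have p0 := pi_gt0 R; have p4 := @pi_lt4 R.
have r1Q : (2 * r1 <= Q)%N by exact: leq_trans TQ.
have r0Q : (2 * (2 * r0) <= Q)%N by apply: leq_trans r1Q; rewrite leq_mul2l r01 orbT.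
pose lam : R := 16 * pi * r0%:R / Q%:R ^+ 2 * \sum_(x < Q) `|grid_val R Q s x%:Z|.
(* The densities add up to [2 size s], so among [16 q size s] consecutive places one has density at
   most [1 / (8 q)]; [vp_density] at most doubles it. *)
have [||| |nf /andP[nf1 nf2] nfd] :=
    @exists_small_density R s Q Q_gt0 (2 * r0) (E + l) (16 * q * size s).
- by rewrite muln_gt0.
- by apply: leq_trans r0Q; rewrite leq_pmull.
- rewrite !muln_gt0 q0 /=; apply: leq_trans sLo; rewrite expn_gt0 //.
- rewrite QP; move: w'P lmax; rewrite /w' mulnDl; clear.
  by move: (2 ^ mu * Lmax)%N (16 * q * size s)%N => x z; lia.
have mE : m.-1.+1 = m by rewrite prednK.
apply: (@density_contradiction R s q (2 ^ T) P m.-1 (2 ^ mu) H r0 r1 E nf lam Lam) => //.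
- by rewrite expn_gt0.
- by move=> k; rewrite mE LamE.
- rewrite mE; have : (2 ^ m <= 2 ^ c)%N by rewrite leq_pexp2l.
  have : (1 <= 2 ^ m)%N by rewrite expn_gt0.
  rewrite /H; move: (2 ^ c)%N (2 ^ m)%N q0 => y v; clear.
  by move=> q0 v1 vy; nia.
- apply: leq_trans sLo; apply: leq_trans (_ : 2 ^ mu * l.+1 <= _)%N.
    by rewrite ltn_pmul2l ?expn_gt0.
  apply: leq_trans (leq_mul (leqnn _) lpow) _.
  rewrite -expnD leq_pexp2l //.
  by have := scales_fit m100 Km; rewrite -/K -/mu -/w -/n -/W -/U; move: cU; clear; lia.
- by rewrite /H; move: (2 ^ c)%N (expn_gt0 2 c) q0 => y; clear; nia.
- rewrite /H /r1; have -> : (2 ^ T = 2 ^ (b + w) * 2 ^ c)%N by rewrite -expnD cT.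
  by move: (2 ^ (b + w))%N (2 ^ c)%N => x y; clear; nia.
- have h : (2 ^ mu * l <= 2 ^ mu * Lmax)%N by rewrite leq_mul2l lmax orbT.
  move: w'P lmax nf2 h; rewrite /w' -/l [((2 ^ mu).+1 * _)%N]mulSn mulnDl; clear.
  by move: (2 ^ mu * l)%N (2 ^ mu * Lmax)%N (16 * q * size s)%N => x y z; lia.
(* The annulus has norm at most [3 Q / (2 n)], and [n = 2 ^ (m + 7) >= 128 q] makes [6 / n] less
   than [1 / (16 q)]. *)
- move=> k; apply: le_trans (@vp_density_diff_le R Q s Q_gt0 r0 r1 k r00 r01) _.
  rewrite r12E; set S := \sum_(_ <= x < _) _ in bsum *.
  have nR : 0 < n%:R :> R by rewrite ltr0n.
  have nq : 128 * q%:R <= n%:R :> R.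
    by rewrite -natrM ler_nat /n expnD mulnC leq_mul2r qm orbT.
  have S0 : 0 <= S by apply: sumr_ge0.
  have : 128 * q%:R * S <= 3 / 2 * Q%:R by apply: le_trans bsum; rewrite ler_wpM2r.
  have -> : 4 / Q%:R * S = 4 * S / Q%:R by rewrite mulrAC.
  by rewrite ler_pdivrMr // ler_pdivlMl ?mulr_gt0 //; lra.
- move=> k; apply: (@vp_density_lipschitz R Q s Q_gt0 r0 k r00).
  by apply: leq_trans r0Q; rewrite leq_pmull.
- have lam1 : lam <= 64 * r0%:R / Q%:R * 2 ^+ (47 * m).
    apply: le_trans (_ : 16 * pi * r0%:R / Q%:R ^+ 2 * (Q%:R * 2 ^+ (47 * m)) <= _).
      by rewrite ler_wpM2l // divr_ge0 ?exprn_ge0 ?mulr_ge0 // ltW.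
    have -> : 16 * pi * r0%:R / Q%:R ^+ 2 * (Q%:R * 2 ^+ (47 * m)) =
       pi * (16 * r0%:R / Q%:R * 2 ^+ (47 * m)) :> R.
      by move: (@pi R) => y; field; rewrite gt_eqF.
    have h : 0 <= 16 * r0%:R / Q%:R * 2 ^+ (47 * m) :> R.
      by rewrite mulr_ge0 ?exprn_ge0 // divr_ge0 // ltW.
    apply: le_trans (ler_wpM2r h (ltW p4)) _; lra.
  have X1 : ((2 ^ mu).+1 * l).+1%:R <= 2 ^+ (mu + 9 + 2 * m + c) :> R.
    rewrite -natrX ler_nat.
    have -> : (2 ^ (mu + 9 + 2 * m + c) = 2 * 2 ^ mu * 2 ^ (8 + 2 * m + c))%N.
      rewrite -expnS -expnD; congr (2 ^ _)%N; move: (mu) (c) => x z; clear; lia.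
    apply: leq_trans (_ : 2 * 2 ^ mu * l.+1 <= _)%N; last by rewrite leq_mul2l lpow orbT.
    by have := expn_gt0 2 mu; move: (2 ^ mu)%N (l) => x y /=; clear; nia.
  apply: le_trans (ler_pM _ _ lam1 X1) _ => //.
    by rewrite /lam mulr_ge0 ?sumr_ge0 // divr_ge0 ?exprn_ge0 ?mulr_ge0 // ltW.
  rewrite /Q /r0 natrM !natrX.
  have -> : 64 * 2 ^+ b / (q%:R * 2 ^+ T) * 2 ^+ (47 * m) * 2 ^+ (mu + 9 + 2 * m + c) =
     (2 ^+ (b + 47 * m + (mu + 9 + 2 * m + c)) * 64 / 2 ^+ T) / q%:R :> R.
    by rewrite !exprD; field; rewrite !gt_eqF ?exprn_gt0.
  have -> : (16 * q%:R)^-1 = 1 / 16 / q%:R :> R by field; rewrite gt_eqF.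
  rewrite ler_pM2r ?invr_gt0 // ler_pdivrMr ?exprn_gt0 //.
  (* This is what [w = mu + 49 m + 20] is made for: [47 m] pays for the norm of [F], [mu + 9 + 2 m]
     for the stretch of blocks, and [2 ^ 11] exceeds [64 * 16]. *)
  have -> : T = (b + 47 * m + (mu + 9 + 2 * m + c) + 11)%N.
    by rewrite -cT /w; move: (mu) (c) => x z; clear; lia.
  rewrite [in leRHS]exprD; have : 0 < 2 ^+ (b + 47 * m + (mu + 9 + 2 * m + c)) :> R by rewrite exprn_gt0.
  by move: (2 ^+ (b + 47 * m + (mu + 9 + 2 * m + c))) => y y0; lra.
- have sR : 0 < (size s)%:R :> R by rewrite ltr0n; apply: leq_trans sLo; rewrite expn_gt0.
  have D0 := @density_ge0 R Q s Q_gt0 r0 nf%:Z.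
  have D1 : density R Q s (2 * r0) nf%:Z <= (8 * q%:R)^-1.
    move: nfd; rewrite !natrM => h.
    rewrite -[leRHS]mulr1 ler_pdivlMl ?mulr_gt0 //.
    have : 16 * q%:R * (size s)%:R * density R Q s (2 * r0) nf = (2 * (size s)%:R) * (8 * q%:R * density R Q s (2 * r0) nf) by ring.
    move=> e; rewrite e -[leRHS]mulr1 ler_pM2l ?mulr_gt0 // in h.
  have e : (4 * q%:R)^-1 = 2 * (8 * q%:R)^-1 :> R by field; rewrite gt_eqF.
  rewrite e /vp_density -/Q; lra.
Qed.

End Assembly.

(** * The lower bound *)

(** Here [m] is the iterated binary logarithm of [N] divided by 40 and rounded down; the gap between
    [40 m] and [45 m] absorbs the rounding. *)
Lemma lnln_bracket (R : realType) (N : nat) (Y : R) : (45 * 200)%N%:R <= Y -> Y <= ln (ln N%:R) ->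
  exists m : nat, [/\ (200 <= m)%N, (2 ^ (2 ^ (40 * m)) <= N)%N,
    (N <= 2 ^ (2 ^ (45 * m)))%N & ln (ln N%:R) <= 80 * m%:R :> R].
Proof.
move=> Y1 YN; set y := ln (ln N%:R) in YN *.
have ln2 : ln 2 <= 1 :> R.
  have -> : 2 = 1 + 1 :> R by ring.
  exact: le_ln1Dx.
have ln2_gt0 : 0 < ln 2 :> R by rewrite ln_gt0 // ltr1n.
have lnN0 : 0 < ln N%:R :> R.
  rewrite ltNge; apply/negP => h; move: (le_trans Y1 YN).
  by rewrite /y ln0 // leNgt ltr0n muln_gt0.
have N2 : (2 <= N)%N.
  rewrite ltnNge; apply/negP => h; move: lnN0.
  by case: N h {y YN} => [|[|//]] _; rewrite ?ln1 ?ln0 ?ltxx.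
pose a := trunc_log 2 N; have /andP[a1 a2] : (2 ^ a <= N < 2 ^ a.+1)%N.
  by apply: trunc_log_bounds => //; exact: ltnW.
have a0 : (0 < a)%N by rewrite trunc_log_gt0.
pose b := trunc_log 2 a; have /andP[b1 b2] : (2 ^ b <= a < 2 ^ b.+1)%N.
  by apply: trunc_log_bounds.
have NR : 0 < N%:R :> R by rewrite ltr0n ltnW.
have Nhi : (N <= 2 ^ (2 ^ b.+1))%N.
  by apply: leq_trans (ltnW a2) _; rewrite leq_pexp2l.
have yb : y <= b.+1%:R.
  have h1 : ln N%:R <= 2 ^+ b.+1 :> R.
    apply: le_trans (_ : ln (2 ^+ (2 ^ b.+1)) <= _).
      by rewrite ler_ln ?posrE ?exprn_gt0 // -natrX ler_nat.
    rewrite lnXn // -[leRHS]mulr1 -[leLHS]mulr_natl natrX.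
    by rewrite ler_wpM2l ?exprn_ge0.
  apply: le_trans (_ : ln (2 ^+ b.+1) <= _).
    by rewrite ler_ln ?posrE ?exprn_gt0.
  by rewrite lnXn // -[leRHS]mulr1 -[leLHS]mulr_natl ler_wpM2l.
have b9 : (45 * 200 <= b.+1)%N.
  by rewrite -(ler_nat R) (le_trans Y1) // (le_trans YN).
exists (b %/ 40)%N; set m := (b %/ 40)%N.
have m1 : (40 * m <= b)%N by rewrite mulnC leq_trunc_div.
have m2 : (b < 40 * m.+1)%N by rewrite mulnC ltn_ceil.
have m200 : (200 <= m)%N by move: b9 m2; clear; lia.
split => //.
- apply: leq_trans a1; rewrite leq_pexp2l //.
  by apply: leq_trans b1; rewrite leq_pexp2l.
- apply: leq_trans Nhi _; rewrite leq_pexp2l // leq_pexp2l //.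
  by move: m2 m200; clear; lia.
- apply: le_trans yb _; rewrite -natrM ler_nat.
  by move: m2 m200; clear; lia.
Qed.

Lemma num_zeros_lower_bound (R : realType) (eps : R) : 0 < eps ->
  exists N0 : nat, forall N : nat, (N0 <= N)%N ->
    forall A : {fset nat}, #|` A|%fset = N ->
      ((ln (ln (N%:R : R)) `^ (1 - eps))%:E <= num_zeros R A)%E.
Proof.
move=> eps0; pose C : R := (240 * 100)%N%:R.
have C0 : 0 < C by rewrite ltr0n muln_gt0.
pose Y0 : R := Num.max (45 * 200)%N%:R (C `^ eps^-1).
exists (Num.truncn (expR (expR Y0))).+1 => N NN0 A AN.
have NE : expR (expR Y0) <= N%:R.
  apply: ltW; apply: lt_le_trans (truncnS_gt _) _.
  by rewrite ler_nat.
set y := ln (ln _).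
have Yy : Y0 <= y.
  rewrite /y -[leLHS]expRK ler_ln ?posrE ?expR_gt0 //.
    rewrite -[leLHS]expRK ler_ln ?posrE ?expR_gt0 //.
    exact: lt_le_trans NE.
  rewrite ln_gt0 //; apply: lt_le_trans NE.
  by rewrite expR_gt1 expR_gt0.
have Y9 : (45 * 200)%N%:R <= Y0 by rewrite /Y0 le_max lexx.
have [m [m200 mlo mhi ym]] := lnln_bracket Y9 Yy.
have y0 : 0 < y.
  by apply: lt_le_trans Yy; apply: lt_le_trans Y9; rewrite ltr0n muln_gt0.
have yC : C <= y `^ eps.
  have -> : C = (C `^ eps^-1) `^ eps by rewrite -powRrM mulVf ?gt_eqF // powRr1 // ltW.
  apply: ge0_ler_powR; rewrite ?nnegrE ?powR_ge0 ?(ltW eps0) ?(ltW y0) //.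
  by apply: le_trans Yy; rewrite /Y0 le_max lexx orbT.
rewrite /num_zeros /counting; case: asboolP => [fin|_]; last by rewrite leey.
rewrite lee_fin leNgt; apply/negP => small.
set zs : seq R := fset_set (@cos_poly_zeros R A) in small.
have zsP t : 0 <= t <= 2 * pi -> cos_sum (A : seq nat) t = 0 -> t \in zs.
  by move=> t1 t2; rewrite /zs in_fset_set // inE.
have pw : y `^ (1 - eps) = y / y `^ eps.
  by rewrite powRB ?(lt0r_neq0 y0) ?implybT // powRr1 // ltW.
have K : (size zs)%:R * C < y.
  apply: le_lt_trans (_ : (size zs)%:R * y `^ eps < _).
    by rewrite ler_wpM2l.
  by move: small; rewrite pw ltr_pdivlMr // powR_gt0.
apply: (@few_zeros_contradiction R A zs 50 m) => //.
- exact: fset_uniq.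
- exact: leq_trans m200.
- have : ((size zs) * 300 <= m)%N.
    have : (size zs * (240 * 100) <= 80 * m)%N.
      by rewrite -(ler_nat R) natrM [(80 * m)%:R]natrM; apply: ltW; apply: lt_le_trans K ym.
    by clear; lia.
  by move: m200; clear; lia.
- by rewrite AN.
- by rewrite AN.
Qed.

Theorem theorem1p4 (R : realType) (eps : R) :
  0 < eps ->
  exists N0 : nat, forall N : nat, (N0 <= N)%N ->
    (((ln (ln (N%:R : R)) `^ (1 - eps))%:E <= min_num_zeros R N)%E
     /\ forall A : {fset nat}, #|` A|%fset = N ->
          ((ln (ln (N%:R : R)) `^ (1 - eps))%:E <= num_zeros R A)%E).
Proof.
move=> /num_zeros_lower_bound[N0 N0P]; exists N0 => N NN0; split; last exact: N0P.
by apply: le_ereal_inf_tmp => _ [A AN <-]; exact: N0P.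
Qed.
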